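(* Let $\Gamma$ be a lattice in ${\rm SL}_2({\mathbb R})$ such that $\infty$ is a cusp of $\Gamma$ of width $1$ and $0$ is a cusp of $\Gamma$. Let $k,l\ge0$ be even integers, $f\in S_k(\Gamma)$ and $g\in S_l(\Gamma)$ with Fourier expansions $f(z)=\sum_{n\ge1}a_ne^{2\pi inz}$, $g(z)=\sum_{n\ge1}b_ne^{2\pi inz}$. Then the function $$(L_f\#L_g)(s,t)\=\sum_{n=1}^\infty n^{-s}\sum_{j=1}^{n-1}\frac{a_{n-j}b_j}{j^t},$$ defined for ${\rm Re}(s),{\rm Re}(t)$ sufficiently large, extends to an entire function on ${\mathbb C}^2$.
   Context: ${\rm SL}_2({\mathbb R})$ acts on the upper half plane ${\mathbb H}$ by linear fractional transformations; $(f|_k\gamma)(z)=(cz+d)^{-k}f(\gamma z)$ for $\gamma=\begin{pmatrix}*&*\\c&d\end{pmatrix}$. A cusp of $\Gamma$ is a point of ${\mathbb R}\cup\{\infty\}$ fixed by a parabolic element of $\Gamma$; for a cusp $c$ with stabilizer $\Gamma_c$ choose $\sigma_c\in{\rm SL}_2({\mathbb R})$ with $\sigma_c\infty=c$ such that $\sigma_c^{-1}\Gamma_c\sigma_c$ acts on ${\mathbb H}$ as the group generated by $z\mapsto z+1$; ''$\infty$ is a cusp of width 1'' means $\Gamma_\infty$ acts as the group generated by $z\mapsto z+1$. $S_k(\Gamma)$ is the space of cusp forms of weight $k$: holomorphic $f:{\mathbb H}\to{\mathbb C}$ with $f|_k\gamma=f$ for all $\gamma\in\Gamma$ and, for each cusp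 $c$, $(f|_k\sigma_c)(x+iy)=O(e^{-\alpha y})$ as $y\to\infty$ for some $\alpha>0$. *)

(* Defs.v *)
From HB Require Import structures.
From mathcomp Require Import all_boot all_order all_algebra.
From mathcomp Require Import complex.
From mathcomp Require Import all_classical all_reals all_analysis.
Set Implicit Arguments.
Unset Strict Implicit.
Unset Printing Implicit Defensive.
Import Order.TTheory GRing.Theory Num.Theory.
Import numFieldNormedType.Exports.
Local Open Scope classical_set_scope.
Local Open Scope ring_scope.
Local Open Scope complex_scope.

Definition SL2 (R : realType) : set 'M[R]_2 := [set A | \det A = 1].

Definition upper_half_plane (R : realType) : set R[i] :=
  [set z | 0 < complex.Im z].

Definition automorphy (R : realType) (A : 'M[R]_2) (z : R[i]) : R[i] :=
  (A 1 0)%:C * z + (A 1 1)%:C.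

Definition mobius (R : realType) (A : 'M[R]_2) (z : R[i]) : R[i] :=
  ((A 0 0)%:C * z + (A 0 1)%:C) / automorphy A z.

Definition slash (R : realType) (k : nat) (f : R[i] -> R[i]) (A : 'M[R]_2)
    (z : R[i]) : R[i] :=
  automorphy A z ^- k * f (mobius A z).

(* The action on the boundary: [None] is the point at infinity. *)
Definition boundary_act (R : realType) (A : 'M[R]_2)
    (x : one_point_compactification R) : one_point_compactification R :=
  match x with
  | None => if A 1 0 == 0 then None else Some (A 0 0 / A 1 0)
  | Some r => if A 1 0 * r + A 1 1 == 0 then None
              else Some ((A 0 0 * r + A 0 1) / (A 1 0 * r + A 1 1))
  end.

Definition subgroup_SL2 (R : realType) (G : set 'M[R]_2) : Prop :=
  [/\ G `<=` @SL2 R, G 1%:M,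
      forall A B, G A -> G B -> G (A *m B) & forall A, G A -> G (invmx A)].

Definition discrete_subgroup (R : realType) (G : set 'M[R]_2) : Prop :=
  subgroup_SL2 G /\ (forall A, G A -> isolated G A).

Definition borel_M2 (R : realType) := g_sigma_algebraType (@open 'M[R]_2).

(* A Haar measure of SL_2(R), viewed as a Borel measure on the space of all
   matrices that is concentrated on the closed subset [SL2]. *)
Definition haar_SL2 (R : realType)
    (mu : {measure set (borel_M2 R) -> \bar R}) : Prop :=
  [/\ mu (~` @SL2 R) = 0%E, mu (@SL2 R) != 0%E,
      forall K : set 'M[R]_2, compact K -> (mu K < +oo)%E
    & forall (A : 'M[R]_2) (E : set (borel_M2 R)), SL2 A -> measurable E ->
        mu [set A *m B | B in E] = mu E].

(* A Borel set of representatives for G \ SL_2(R): every coset G B meets [F] in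
   exactly one point, so the covolume of G is the Haar measure of [F]. *)
Definition fundamental_domain (R : realType) (G : set 'M[R]_2)
    (F : set (borel_M2 R)) : Prop :=
  [/\ measurable F, F `<=` @SL2 R
    & forall B : 'M[R]_2, SL2 B -> exists! A : 'M[R]_2, G A /\ F (A *m B)].

Definition lattice_SL2 (R : realType) (G : set 'M[R]_2) : Prop :=
  discrete_subgroup G /\
  exists (mu : {measure set (borel_M2 R) -> \bar R}) (F : set (borel_M2 R)),
    [/\ haar_SL2 mu, fundamental_domain G F & (mu F < +oo)%E].

Definition parabolic (R : realType) (A : 'M[R]_2) : Prop :=
  [/\ SL2 A, `|\tr A| = 2, A <> 1%:M & A <> - 1%:M].

Definition cusp (R : realType) (G : set 'M[R]_2)
    (c : one_point_compactification R) : Prop :=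
  exists A, [/\ G A, parabolic A & boundary_act A c = c].

Definition stabilizer (R : realType) (G : set 'M[R]_2)
    (c : one_point_compactification R) : set 'M[R]_2 :=
  [set A | G A /\ boundary_act A c = c].

(* [G] acts on the upper half plane as the group generated by z |-> z + 1. *)
Definition acts_as_unit_translations (R : realType) (G : set 'M[R]_2) : Prop :=
  (forall A, G A -> exists n : int,
     forall z, upper_half_plane z -> mobius A z = z + n%:~R) /\
  (forall n : int, exists A, G A /\
     forall z, upper_half_plane z -> mobius A z = z + n%:~R).

Definition cusp_oo_width1 (R : realType) (G : set 'M[R]_2) : Prop :=
  cusp G None /\ acts_as_unit_translations (stabilizer G None).

Definition scaling_matrix (R : realType) (G : set 'M[R]_2)
    (c : one_point_compactification R) (S : 'M[R]_2) : Prop :=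
  [/\ SL2 S, boundary_act S None = c
    & acts_as_unit_translations
        [set invmx S *m A *m S | A in stabilizer G c]].

(* Only the values of [f] on the upper half plane matter.  The bound at a cusp
   is uniform in x; it then does not depend on the choice of scaling matrix
   when [k] is even. *)
Definition cusp_form (R : realType) (k : nat) (G : set 'M[R]_2)
    (f : R[i] -> R[i]) : Prop :=
  [/\ forall z : R[i], upper_half_plane z ->
        derivable (f : R[i]^o -> R[i]^o) z 1,
      forall A z, G A -> upper_half_plane z -> slash k f A z = f z
    & forall c S, cusp G c -> scaling_matrix G c S ->
        exists alpha M y0 : R, 0 < alpha /\
          forall x y : R, y0 <= y -> 0 < y ->
            `|slash k f S (x +i* y)| <= (M * expR (- alpha * y))%:C].

Definition cexp (R : realType) (z : R[i]) : R[i] :=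
  (expR (complex.Re z))%:C * (cos (complex.Im z) +i* sin (complex.Im z)).

(* n^s for a positive integer n *)
Definition natcpow (R : realType) (n : nat) (s : R[i]) : R[i] :=
  cexp (s * (ln n%:R)%:C).

Definition fourier_expansion (R : realType) (f : R[i] -> R[i])
    (a : nat -> R[i]) : Prop :=
  forall z : R[i], upper_half_plane z ->
    (fun N : nat => \sum_(1 <= n < N)
       a n * cexp (2 * pi%:C * 'i * n%:R * z) : R[i]^o) @ \oo --> (f z : R[i]^o).

Definition sharp_term (R : realType) (a b : nat -> R[i]) (s t : R[i])
    (n : nat) : R[i] :=
  natcpow n (- s) * \sum_(1 <= j < n) a (n - j)%N * b j / natcpow j t.

(* Differentiability over the scalar field R[i], i.e. holomorphy on C^2. *)
Definition entire2 (R : realType) (F : R[i]^o * R[i]^o -> R[i]^o) : Prop :=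
  forall p, differentiable F p.

(* Main.v *)
(** Write [A_m(n)] for the [m]-fold iterated partial sums of the coefficients [a_n].
    Summing by parts [2p] times in [n] turns the double series into
    [sum_n (sum_(j < n) A_2p(n - j) b_j j^-t) D^(2p) n^-s], where [D] is the difference
    operator [w_n |-> w_n - w_(n+1)], and [D^(2p) n^-s] is [O(n^(-Re s - 2p))] up to
    logarithms.  If [A_2p(n)] only satisfied the trivial bound [O(n^(k/2 + 2p))] nothing
    would be gained.  But the generating function of [A_2p] is [f(z) / (1 - q)^(2p)], and
    the decay of [f] at the cusp [0] absorbs the pole at [q = 1]: averaging over a
    horizontal line at height [1 / n] gives [A_2p(n) = O(n^(k/2 + p))].  Each step
    [p -> p + 1] thus moves the region of convergence to the left by one.

    The remaining input is the growth [f(z) = O(y^(-k/2))] for an arbitrary lattice.  It is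
    enough to bound [|f| y^(k/2)] at points [z] which are almost highest in their orbit,
    and low ones accumulate only at points [x] with [(c x + d)^2 >= 1/2] on the whole
    group.  For such [x] the finite covolume produces elements of small displacement along
    the vertical geodesic ending at [x], and a commutator argument shows that one of
    them is parabolic with fixed point [x]; so [x] is a cusp, where [f] decays. *)

(* The decay at 0 acts through [y / |z|^2], the height of [z] seen from that cusp: [|f| y^(k/2)]
   times any power of this height stays bounded. On the line of height [1 / n] this gives
   [f = O(|z|^(2p) n^(k/2 + p))], and [|z|^(2p)] cancels the pole of [(1 - q)^(-2p)] at 0. Raising
   [p] by one thus costs one power of [n] in the sums and gains two in the differences.

   The value of the continuation at a point is the limit for any sufficiently large [p]; it does not
   depend on [p] because the boundary terms of the summation by parts vanish in the limit.
   Differentiability on C^2 is proved termwise: each term has a first order Taylor expansion whose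
   quadratic remainder has a constant summable over [n]. For this reason bounds for the value, the
   derivative and the remainder are carried together.

   In the growth estimate the lattice is known only through its finite covolume, so cusps have to be
   produced point by point. Compactness of [[-1/2, 1/2]] then turns the local bounds at low points
   into a single one, and the Fourier expansion controls the high points. *)
Require Import Defs.
From HB Require Import structures.
From mathcomp Require Import all_boot all_order all_algebra.
From mathcomp Require Import complex ring lra zify.
From mathcomp Require Import all_classical all_reals all_analysis.
Import Order.TTheory GRing.Theory Num.Theory.
Import numFieldNormedType.Exports.
Import ComplexField.Normc.
Local Open Scope classical_set_scope.
Local Open Scope ring_scope.
Local Open Scope complex_scope.

Set Implicit Arguments.
Unset Strict Implicit.
Unset Printing Implicit Defensive.

(** * Complex exponentials and series *)

Section ComplexModulus.
Variable R : realType.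
Implicit Types (z w : R[i]) (x y : R).

Lemma norm_normc z : `|z| = (normc z)%:C. Proof. by []. Qed.

Lemma normc_ge0 z : 0 <= normc z.
Proof. by case: z => a b; rewrite sqrtr_ge0. Qed.

Lemma normc_distC z w : normc (z - w) = normc (w - z).
Proof. by rewrite -normcN opprB. Qed.

Lemma normcB z w : normc (z - w) <= normc z + normc w.
Proof. by rewrite -(normcN w) le_normcD. Qed.

Lemma normcR x : normc x%:C = `|x|.
Proof. by rewrite /= expr0n /= addr0 sqrtr_sqr. Qed.

Lemma normcX z n : normc (z ^+ n) = normc z ^+ n.
Proof. by elim: n => [|n IH]; rewrite ?expr0 ?normc1 // !exprS normcM IH. Qed.

Lemma normc_sq z : normc z ^+ 2 = complex.Re z ^+ 2 + complex.Im z ^+ 2.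
Proof. by case: z => a b /=; rewrite sqr_sqrtr // addr_ge0 ?sqr_ge0. Qed.

Lemma ler_Re_normc z : `|complex.Re z| <= normc z.
Proof.
rewrite -(@ler_pXn2r _ 2) ?nnegrE ?normc_ge0 // normc_sq real_normK ?num_real //.
by rewrite lerDl sqr_ge0.
Qed.

Lemma ler_Im_normc z : `|complex.Im z| <= normc z.
Proof.
rewrite -(@ler_pXn2r _ 2) ?nnegrE ?normc_ge0 // normc_sq real_normK ?num_real //.
by rewrite lerDr sqr_ge0.
Qed.

Lemma ler_normc_ReIm z : normc z <= `|complex.Re z| + `|complex.Im z|.
Proof.
rewrite -(@ler_pXn2r _ 2) ?nnegrE ?normc_ge0 ?addr_ge0 // normc_sq sqrrD.
rewrite !real_normK ?num_real // -addrA lerD2l lerDr.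
by rewrite mulrn_wge0 // mulr_ge0.
Qed.

Lemma normc_sum (I : Type) (r : seq I) (P : pred I) (F : I -> R[i]) :
  normc (\sum_(i <- r | P i) F i) <= \sum_(i <- r | P i) normc (F i).
Proof.
elim/big_rec2: _ => [|i x z _ IH]; first by rewrite normc0.
by rewrite (le_trans (le_normcD _ _)) // lerD2l.
Qed.

Lemma ReD z w : complex.Re (z + w) = complex.Re z + complex.Re w.
Proof. by case: z w => a b [c d]. Qed.
Lemma ImD z w : complex.Im (z + w) = complex.Im z + complex.Im w.
Proof. by case: z w => a b [c d]. Qed.
Lemma ReN z : complex.Re (- z) = - complex.Re z.
Proof. by case: z. Qed.
Lemma ImN z : complex.Im (- z) = - complex.Im z.
Proof. by case: z. Qed.

Lemma cexpD z w : cexp (z + w) = cexp z * cexp w.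
Proof.
case: z w => a b [c d]; rewrite /cexp; simpc => /=.
rewrite expRD cosD sinD; congr (_ +i* _); ring.
Qed.

Lemma cexp0 : cexp (0 : R[i]) = 1.
Proof. by rewrite /cexp /= expR0 cos0 sin0 mul1r. Qed.

Lemma normc_cexp z : normc (cexp z) = expR (complex.Re z).
Proof.
rewrite /cexp normcM normcR ger0_norm ?expR_ge0 //=.
by rewrite cos2Dsin2 sqrtr1 mulr1.
Qed.

Lemma cexp_neq0 z : cexp z != 0.
Proof.
apply: contra_neq (lt0r_neq0 (expR_gt0 (complex.Re z))).
by rewrite -normc_cexp => ->; rewrite normc0.
Qed.

Lemma cexpN z : cexp (- z) = (cexp z)^-1.
Proof.
apply: (mulfI (cexp_neq0 z)); rewrite mulfV ?cexp_neq0 //.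
by rewrite -cexpD subrr cexp0.
Qed.

Lemma cexpMn z n : cexp (z * n%:R) = cexp z ^+ n.
Proof.
elim: n => [|n IH]; first by rewrite mulr0 cexp0 expr0.
by rewrite -addn1 natrD mulrDr mulr1 cexpD IH exprD expr1.
Qed.

End ComplexModulus.

Section ComplexLimits.
Variable R : realType.
Implicit Types (u v : nat -> R[i]) (l : R[i]).

(** The norm of [R[i]] takes values in [R[i]] itself. Limits are therefore handled with the real
    modulus [normc], and [ctendsP] translates back. *)
Definition ctends u l := forall e : R, 0 < e ->
  exists N : nat, forall n, (N <= n)%N -> normc (u n - l) <= e.

Lemma ctendsP u l :
  ctends u l <-> ((fun n => u n : R[i]^o) @ \oo --> (l : R[i]^o)).
Proof.
split=> [ul|ul e e0].
  apply/cvgrPdist_le => e; rewrite ltcE /= => /andP[/eqP e1 e0].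
  have [N HN] := ul _ e0.
  exists N => // n /= Nn; rewrite norm_normc normc_distC lecE /= -e1 eqxx /=.
  exact: HN.
have : 0 < e%:C by rewrite ltcE /= eqxx.
move/cvgrPdist_le : ul => /[apply] -[N _ HN].
exists N => n Nn; have := HN n Nn.
by rewrite /= norm_normc normc_distC lecR.
Qed.

Lemma ctends_le u l (B : R) : ctends u l ->
  (exists N : nat, forall n, (N <= n)%N -> normc (u n) <= B) -> normc l <= B.
Proof.
move=> ul [N HN]; apply/ler_addgt0Pr => e e0.
have [N' HN'] := ul _ e0.
have -> : l = u (maxn N N') - (u (maxn N N') - l) by ring.
by rewrite (le_trans (normcB _ _)) // lerD ?HN ?HN' ?leq_maxl ?leq_maxr.
Qed.

Lemma ctends_ext u v l : (exists N : nat, forall n, (N <= n)%N -> u n = v n) ->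
  ctends u l -> ctends v l.
Proof.
move=> [N HN] ul e e0; have [N' HN'] := ul _ e0.
exists (maxn N N') => n; rewrite geq_max => /andP[Nn N'n].
by rewrite -HN // HN'.
Qed.

Lemma ctendsD u v l l' : ctends u l -> ctends v l' ->
  ctends (fun n => u n + v n) (l + l').
Proof.
move=> ul vl e e0; have e20 : 0 < e / 2 by rewrite divr_gt0.
have [N HN] := ul _ e20; have [N' HN'] := vl _ e20.
exists (maxn N N') => n; rewrite geq_max => /andP[Nn N'n].
have -> : u n + v n - (l + l') = (u n - l) + (v n - l') by ring.
by rewrite (le_trans (le_normcD _ _)) // (splitr e) lerD ?HN ?HN'.
Qed.

Lemma ctendsMl u l c : ctends u l -> ctends (fun n => c * u n) (c * l).
Proof.
move=> ul e e0.
have c0 : 0 < normc c + 1 by rewrite ltr_wpDl ?normc_ge0.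
have [N HN] := ul _ (divr_gt0 e0 c0).
exists N => n Nn; rewrite -mulrBr normcM.
apply: le_trans (_ : (normc c + 1) * (e / (normc c + 1)) <= _).
  by rewrite ler_pM ?normc_ge0 ?HN // lerDl.
by rewrite mulrC divfK ?gt_eqF.
Qed.

Lemma ctendsB u v l l' : ctends u l -> ctends v l' ->
  ctends (fun n => u n - v n) (l - l').
Proof.
move=> ul vl; have := ctendsD ul (ctendsMl (-1) vl).
by rewrite mulN1r; apply: ctends_ext; exists 0%N => n _; rewrite mulN1r.
Qed.

Lemma ctends_cst l : ctends (fun=> l) l.
Proof. by move=> e e0; exists 0%N => n _; rewrite subrr normc0 ltW. Qed.

Lemma ctends_unique u l l' : ctends u l -> ctends u l' -> l = l'.
Proof.
move=> ul ul'; apply/eqP; rewrite -subr_eq0; apply/eqP/eq0_normc/eqP.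
rewrite eq_le normc_ge0 andbT; apply: (ctends_le (ctendsB ul ul')).
by exists 0%N => n _; rewrite subrr normc0.
Qed.

Lemma real_dominated_series (w M : nat -> R) (B : R) :
  (forall n, (0 < n)%N -> `|w n| <= M n) ->
  (forall N, \sum_(1 <= n < N) M n <= B) ->
  exists l : R, forall e, 0 < e -> exists N : nat, forall n, (N <= n)%N ->
    `|\sum_(1 <= i < n) w i - l| <= e.
Proof.
move=> wM MB.
have M0 n : 0 <= M n.+1 by rewrite (le_trans _ (wM n.+1 _)).
have cM : cvgn (series (fun n => M n.+1)).
  apply: nondecreasing_is_cvgn.
    by apply/nondecreasing_seqP => n; rewrite /series /= big_nat_recr //= lerDl.
  exists B => _ [n _ <-]; rewrite /series /=.
  by have := MB n.+1; rewrite big_add1.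
have /normed_cvg cw : cvgn [normed series (fun n => w n.+1)].
  by apply: (series_le_cvg _ M0) => // n; [exact: normr_ge0 | exact: wM].
exists (limn (series (fun n => w n.+1))) => e e0.
move/cvgrPdist_le : cw => /(_ e e0)[N _ HN].
exists N.+1 => -[//|n] Nn; rewrite distrC big_add1; exact: HN.
Qed.

Lemma dominated_series u (M : nat -> R) (B : R) :
  (forall n, (0 < n)%N -> normc (u n) <= M n) ->
  (forall N, \sum_(1 <= n < N) M n <= B) ->
  exists l, ctends (fun N => \sum_(1 <= n < N) u n) l.
Proof.
move=> uM MB.
have [|a Ha] := @real_dominated_series (fun n => complex.Re (u n)) M B _ MB.
  by move=> n n0; rewrite (le_trans (ler_Re_normc _)) // uM.
have [|b Hb] := @real_dominated_series (fun n => complex.Im (u n)) M B _ MB.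
  by move=> n n0; rewrite (le_trans (ler_Im_normc _)) // uM.
exists (a +i* b) => e e0; have e20 : 0 < e / 2 by rewrite divr_gt0.
have [N HN] := Ha _ e20; have [N' HN'] := Hb _ e20.
exists (maxn N N') => n; rewrite geq_max => /andP[Nn N'n].
rewrite (le_trans (ler_normc_ReIm _)) // (splitr e).
rewrite !(ReD, ImD) !(ReN, ImN) /=.
by rewrite (big_morph _ (@ReD R) (erefl _)) (big_morph _ (@ImD R) (erefl _)) lerD ?HN ?HN'.
Qed.

Lemma ctends_tail u l (b : R) (m : nat) : (0 < m)%N ->
  ctends (fun N => \sum_(1 <= n < N) u n) l ->
  (forall N, (m <= N)%N -> \sum_(m <= n < N) normc (u n) <= b) ->
  normc (l - \sum_(1 <= n < m) u n) <= b.
Proof.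
move=> m0 ul ub.
apply: (ctends_le (ctendsB ul (ctends_cst _))); exists m => N mN.
rewrite (@big_cat_nat _ _ _ m) //= addrAC subrr add0r.
exact: le_trans (normc_sum _ _ _) (ub _ mN).
Qed.

End ComplexLimits.

Section Geometric.
Variable R : realType.

Lemma geometric_tail_le (rho : R) (m N : nat) : 0 <= rho < 1 ->
  \sum_(m <= n < N) rho ^+ n <= rho ^+ m / (1 - rho).
Proof.
move=> /andP[r0 r1]; have d0 : 0 < 1 - rho by rewrite subr_gt0.
case: (leqP m N) => [mN|Nm]; last first.
  by rewrite big_geq ?(ltnW Nm)// divr_ge0 ?exprn_ge0 // ltW.
rewrite ler_pdivlMr //.
suff -> : (\sum_(m <= n < N) rho ^+ n) * (1 - rho) = rho ^+ m - rho ^+ N.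
  by rewrite gerBl exprn_ge0.
rewrite mulr_suml (telescope_sumr_eq (fun n => - rho ^+ n) _ mN) ?opprK 1?addrC //.
by move=> n _; rewrite exprS; ring.
Qed.

Lemma expr_small (rho e : R) : 0 <= rho < 1 -> 0 < e ->
  exists N : nat, forall n, (N <= n)%N -> rho ^+ n <= e.
Proof.
move=> /andP[r0 r1] e0.
have /cvgrPdist_le/(_ e e0)[N _ HN] : (fun n => rho ^+ n) @ \oo --> (0 : R).
  by apply: cvg_expr; rewrite ger0_norm.
exists N => n Nn; have := HN n Nn.
by rewrite /= sub0r normrN ger0_norm // exprn_ge0.
Qed.

End Geometric.

(** * The variable q and roots of unity *)

Section QVariable.
Variable R : realType.
Implicit Types (z w : R[i]) (x y : R).

Definition qvar z : R[i] := cexp (2 * pi%:C * 'i * z).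
Definition qabs y : R := expR (- (2 * pi * y)).

Lemma qvarE n z : cexp (2 * pi%:C * 'i * n%:R * z) = qvar z ^+ n.
Proof. by rewrite -cexpMn; congr cexp; ring. Qed.

Lemma normc_qvar z : normc (qvar z) = qabs (complex.Im z).
Proof.
rewrite normc_cexp /qabs; congr expR; case: z => x y.
rewrite -[2]/(2%:R) -(rmorph_nat (real_complex R)).
by simpc => /=; ring.
Qed.

Lemma qabs_gt0 y : 0 < qabs y. Proof. exact: expR_gt0. Qed.

Lemma qabs_lt1 y : 0 < y -> qabs y < 1.
Proof. by move=> y0; rewrite expR_lt1 oppr_lt0 !mulr_gt0 // pi_gt0. Qed.

Lemma qabs_le x y : x <= y -> qabs y <= qabs x.
Proof. by move=> xy; rewrite ler_expR lerN2 ler_pM2l // mulr_gt0 // pi_gt0. Qed.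

Lemma qabsD x y : qabs (x + y) = qabs x * qabs y.
Proof. by rewrite -expRD; congr expR; ring. Qed.

Lemma qabsMn n y : qabs (n%:R * y) = qabs y ^+ n.
Proof. by rewrite -expRM_natl; congr expR; ring. Qed.

Lemma qvarD z w : qvar (z + w) = qvar z * qvar w.
Proof. by rewrite -cexpD; congr cexp; ring. Qed.

Lemma qvar_realE x : qvar x%:C = cos (2 * pi * x) +i* sin (2 * pi * x).
Proof.
rewrite /qvar -[2]/(2%:R) -(rmorph_nat (real_complex R)) /cexp; simpc => /=.
rewrite expR0 !mul1r ; congr (cos _ +i* sin _); ring.
Qed.

Lemma qvar_real_neq1 x : 0 < x < 1 -> qvar x%:C != 1.
Proof.
move=> /andP[x0 x1]; rewrite qvar_realE; apply/eqP => -[c1 _].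
have : sin (pi * x) ^+ 2 = 0 :> R.
  have := cosD (pi * x) (pi * x); rewrite -mulrDl -mulr2n -[pi *+ 2]mulr_natl c1.
  have := cos2Dsin2 (pi * x); nra.
move/eqP; rewrite sqrf_eq0 gt_eqF // sin_gt0_pi // mulr_gt0 ?pi_gt0 //=.
by rewrite gtr_pMr // pi_gt0.
Qed.

Lemma qvar_nat n : qvar n%:R = 1.
Proof.
have -> : qvar n%:R = qvar 1%:C ^+ n by rewrite -cexpMn; congr cexp; ring.
have c2 : cos (pi + pi) = 1 :> R by rewrite cosD cospi sinpi; ring.
have s2 : sin (pi + pi) = 0 :> R by rewrite [LHS]sinD cospi sinpi; ring.
rewrite qvar_realE mulr1 [2 * pi]mulr_natl mulr2n c2 s2.
by rewrite -[1 +i* 0]/(1 : R[i]) expr1n.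
Qed.

Lemma sum_root_unity (N j : nat) : (0 < N)%N -> ~~ (N %| j)%N ->
  \sum_(k < N) qvar (k%:R / N%:R) ^+ j = 0.
Proof.
move=> N0 Nj.
have Nn0 : (N%:R : R[i]) != 0 by rewrite pnatr_eq0 -lt0n.
set w := qvar (j%:R / N%:R).
have w1 : w != 1.
  have -> : w = qvar ((j %% N)%:R / N%:R)%:C.
    rewrite /w {1}(divn_eq j N) natrD natrM mulrDl mulfK // qvarD qvar_nat mul1r.
    by rewrite rmorphM fmorphV !rmorph_nat.
  apply: qvar_real_neq1; rewrite divr_gt0 ?ltr0n ?ltr_pdivrMr ?ltr0n //; last first.
    by rewrite lt0n; apply: contra Nj.
  by rewrite mul1r ltr_nat ltn_mod.
have wN : w ^+ N = 1.
  by rewrite -cexpMn -[RHS](qvar_nat j); congr cexp; field.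
apply: (mulfI (_ : w - 1 != 0)); first by rewrite subr_eq0.
have := subrX1 w N; rewrite wN subrr mulr0 => E.
rewrite [RHS]E; congr (_ * _).
by apply: eq_bigr => k _; rewrite -!cexpMn; congr cexp; field.
Qed.

End QVariable.

Section CoefficientBound.
Variable R : realType.

(* Averaging over the [N]-th roots of unity isolates one coefficient. *)
Lemma coef_le_sup (A : nat -> R[i]) (N n : nat) (y M : R) : (0 < n < N)%N ->
  (forall x : R, normc (\sum_(1 <= i < N) A i * qvar (x +i* y) ^+ i) <= M) ->
  normc (A n) * qabs y ^+ n <= M.
Proof.
move=> /andP[n0 nN] HM; have N0 : (0 < N)%N by rewrite (leq_trans _ nN).
pose z := 0 +i* y : R[i].
have W (k i : nat) : qvar (k%:R / N%:R) ^+ (N - n) *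
    (A i * qvar (k%:R / N%:R + z) ^+ i) =
    A i * qvar z ^+ i * qvar (k%:R / N%:R) ^+ (N - n + i).
  by rewrite qvarD [(_ * _) ^+ i]exprMn exprD mulrCA -mulrA; congr (_ * _); rewrite mulrCA
    mulrC -mulrA mulrC -mulrA [X in _ * X = _]mulrC.
(* The twist by the power [N - n] moves the coefficient [n] to the exponent [N]. Every other
   exponent [N - n + i] lies strictly between 0 and [2 N] and differs from [N], so its sum over the
   roots of unity vanishes. *)
have E : \sum_(k < N) qvar (k%:R / N%:R) ^+ (N - n) *
    (\sum_(1 <= i < N) A i * qvar (k%:R / N%:R + z) ^+ i) =
    N%:R * (A n * qvar z ^+ n).
  under eq_bigr do rewrite mulr_sumr.
  rewrite exchange_big /= (bigD1_seq n) ?mem_index_iota ?n0 ?iota_uniq //=.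
  rewrite [X in _ + X]big1_seq ?addr0; last first.
    move=> i /andP[iNn]; rewrite mem_index_iota => /andP[i0 iN].
    under eq_bigr do rewrite W.
    rewrite -mulr_sumr sum_root_unity ?mulr0 //.
    apply/negP => /dvdnP[c]; case: c => [|[|c]]; [lia | | nia].
    by move: iNn; lia.
  rewrite (eq_bigr (fun=> A n * qvar z ^+ n)) ?sumr_const ?card_ord ?mulr_natl //.
  move=> k _; rewrite W subnK ?(ltnW nN) //.
  have -> : qvar (k%:R / N%:R : R[i]) ^+ N = 1; last by rewrite mulr1.
  rewrite -cexpMn -[RHS](qvar_nat R k); congr cexp.
  by field; rewrite pnatr_eq0 -lt0n.
have nn : normc (N%:R : R[i]) = N%:R.
  by rewrite -(rmorph_nat (real_complex R)) normcR ger0_norm.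
have q1 (k j : nat) : normc (qvar (k%:R / N%:R : R[i]) ^+ j) = 1.
  rewrite normcX normc_qvar.
  rewrite -!(rmorph_nat (real_complex R)) -fmorphV -rmorphM /=.
  by rewrite /qabs mulr0 oppr0 expR0 expr1n.
rewrite -(@ler_pM2l _ N%:R) ?ltr0n //.
have -> : N%:R * (normc (A n) * qabs y ^+ n) = normc (N%:R * (A n * qvar z ^+ n)).
  by rewrite !normcM nn normcX normc_qvar.
have -> : N%:R * M = \sum_(k < N) M by rewrite sumr_const card_ord mulr_natl.
rewrite -E; apply: le_trans (normc_sum _ _ _) _.
apply: ler_sum => k _; rewrite normcM q1 mul1r.
have -> : k%:R / N%:R + z = (k%:R / N%:R) +i* y.
  by rewrite -!(rmorph_nat (real_complex R)) -fmorphV -rmorphM /z; simpc.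
exact: HM.
Qed.

End CoefficientBound.

(** * Partial sums of Fourier coefficients *)

Section FourierGrowth.
Variable R : realType.
Implicit Types (f : R[i] -> R[i]) (a A : nat -> R[i]) (z : R[i]).

(** Equivalent to convergence of the power series for [|q| < 1]. It is available before any growth
    of [f] is known, and it passes to iterated partial sums. *)
Definition subexponential A := forall c : R, 0 < c ->
  exists C : R, forall n, (0 < n)%N -> normc (A n) <= C * expR (c * n%:R).

Lemma subexponential_ge0 A (c : R) : subexponential A -> 0 < c ->
  exists2 C : R, 0 <= C & forall n, (0 < n)%N -> normc (A n) <= C * expR (c * n%:R).
Proof.
move=> sA c0; have [C HC] := sA c c0; exists C => //.
have := HC 1%N isT; rewrite -(pmulr_lge0 C (expR_gt0 (c * 1))) mulrC.
exact: le_trans (normc_ge0 _).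
Qed.

Lemma fourier_ctends f a z : fourier_expansion f a -> 0 < complex.Im z ->
  ctends (fun N => \sum_(1 <= n < N) a n * qvar z ^+ n) (f z).
Proof.
move=> fa z0; apply/ctendsP; have := fa z z0.
by under eq_fun do under eq_bigr do rewrite qvarE.
Qed.

Lemma ctends_term_bound (u : nat -> R[i]) l :
  ctends (fun N => \sum_(1 <= n < N) u n) l ->
  exists C : R, forall n, (0 < n)%N -> normc (u n) <= C.
Proof.
move=> /(_ 1 ltr01)[N HN].
exists (\sum_(i < N) normc (u i) + 2) => n n0.
case: (ltnP n N) => [nN|Nn].
  rewrite (bigD1 (Ordinal nN)) //= -addrA lerDl addr_ge0 // sumr_ge0 // => i _.
  exact: normc_ge0.
rewrite (le_trans (_ : _ <= 2)) //; last first.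
  by rewrite lerDr sumr_ge0 // => i _; exact: normc_ge0.
have -> : u n = (\sum_(1 <= i < n.+1) u i - l) - (\sum_(1 <= i < n) u i - l).
  by rewrite big_nat_recr //=; ring.
by rewrite (le_trans (normcB _ _)) // -[2]/(1 + 1 : R) lerD ?HN // leqW.
Qed.

Lemma fourier_subexponential f a : fourier_expansion f a -> subexponential a.
Proof.
(* At this height [|q| = e^(-c)], so the bound follows from the boundedness of the terms of a
   convergent series. *)
move=> fa c c0; pose y := c / (2 * pi) : R.
have pi20 : 0 < 2 * pi :> R by rewrite mulr_gt0 ?pi_gt0.
have y0 : 0 < y by rewrite divr_gt0.
have [C HC] := ctends_term_bound (fourier_ctends fa (y0 : 0 < complex.Im (0 +i* y))).
exists C => n n0; have := HC n n0; rewrite normcM normcX normc_qvar /=.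
suff -> : qabs y ^+ n = (expR (c * n%:R))^-1 by rewrite ler_pdivrMr ?expR_gt0.
rewrite -qabsMn -expRN; congr expR; rewrite /y.
by move: (pi : R) (lt0r_neq0 (pi_gt0 R)) => p pn0; field.
Qed.

(** Half of the height [y] is given up to absorb the subexponential growth of the coefficients; the
    other half still yields a geometric series. *)
Lemma subexponential_qabs A (y : R) : subexponential A -> 0 < y ->
  exists2 C : R, 0 <= C &
    forall n z, (0 < n)%N -> y <= complex.Im z ->
      normc (A n * qvar z ^+ n) <= C * qabs (complex.Im z - y / 2) ^+ n.
Proof.
move=> sA y0; have c0 : 0 < 2 * pi * (y / 2) by rewrite !mulr_gt0 ?pi_gt0 ?invr_gt0.
have [C C0 HC] := subexponential_ge0 sA c0; exists C => // n z n0 yz.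
have -> : C * qabs (complex.Im z - y / 2) ^+ n =
    C * expR (2 * pi * (y / 2) * n%:R) * qabs (complex.Im z) ^+ n.
  rewrite -mulrA -!qabsMn -expRD; congr (_ * expR _).
  by move: (pi : R) => p; field.
rewrite normcM normcX normc_qvar ler_wpM2r ?HC //.
by rewrite exprn_ge0 // ltW ?qabs_gt0.
Qed.

(** The expansion has no constant term, so one factor of the geometric ratio can be pulled out, and
    it carries the decay in [complex.Im z]. *)
Lemma fourier_decay f a (y : R) : fourier_expansion f a -> 0 < y ->
  exists2 C : R, 0 <= C &
    forall z, y <= complex.Im z -> normc (f z) <= C * qabs (complex.Im z).
Proof.
move=> fa y0; have sa := fourier_subexponential fa.
have [C C0 HC] := subexponential_qabs sa y0.
have y20 : 0 < y / 2 by rewrite divr_gt0.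
have d0 : 0 < 1 - qabs (y / 2) by rewrite subr_gt0 qabs_lt1.
exists (C * qabs (- (y / 2)) / (1 - qabs (y / 2))).
  by rewrite divr_ge0 ?mulr_ge0 // ltW ?qabs_gt0.
move=> z yz; pose rho := qabs (complex.Im z - y / 2).
have z0 : 0 < complex.Im z by rewrite (lt_le_trans y0).
have rhole : rho <= qabs (y / 2) by apply: qabs_le; lra.
have rho1 : 0 <= rho < 1 by rewrite ltW ?qabs_gt0 // (le_lt_trans rhole) ?qabs_lt1.
have -> : f z = f z - \sum_(1 <= n < 1) a n * qvar z ^+ n.
  by rewrite big_geq // subr0.
apply: (@ctends_tail _ _ _ _ 1%N isT (fourier_ctends fa z0)) => N _.
apply: le_trans (_ : C * (rho / (1 - rho)) <= _).
  rewrite -[rho in rho / _]expr1; apply: le_trans (_ : C * \sum_(1 <= n < N) rho ^+ n <= _);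
    last first.
    by rewrite ler_wpM2l // geometric_tail_le.
  by rewrite mulr_sumr ler_sum_nat // => n /andP[n0 _]; rewrite HC.
have -> : C * qabs (- (y / 2)) / (1 - qabs (y / 2)) * qabs (complex.Im z) =
    C * (rho / (1 - qabs (y / 2))).
  by rewrite /rho qabsD; move: (_^-1) => u; ring.
rewrite !ler_wpM2l ?(andP rho1).1 // lef_pV2 ?posrE ?subr_gt0 ?(andP rho1).2 //.
  by rewrite lerD2l lerN2.
by rewrite -subr_gt0.
Qed.

Fixpoint itersum (m : nat) (a : nat -> R[i]) (n : nat) : R[i] :=
  if m is m'.+1 then \sum_(1 <= i < n.+1) itersum m' a i else a n.

Lemma itersum_subexponential a m : subexponential a -> subexponential (itersum m a).
Proof.
move=> sa; elim: m => [//|m IH] c c0 /=.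
have c20 : 0 < c / 2 by rewrite divr_gt0.
have [C C0 HC] := subexponential_ge0 IH c20.
exists (C * (2 / c)) => n n0.
apply: le_trans (normc_sum _ _ _) _.
apply: le_trans (_ : n%:R * (C * expR (c / 2 * n%:R)) <= _).
  have -> : n%:R * (C * expR (c / 2 * n%:R)) =
      \sum_(1 <= i < n.+1) C * expR (c / 2 * n%:R).
    by rewrite sumr_const_nat subSS subn0 mulr_natl.
  apply: ler_sum_nat => i /andP[i0 iN].
  rewrite (le_trans (HC i i0)) // ler_wpM2l // ler_expR ler_wpM2l ?(ltW c20) //.
  by rewrite ler_nat.
have -> : c * n%:R = c / 2 * n%:R + c / 2 * n%:R by rewrite -mulrDl -splitr.
rewrite expRD mulrCA -!mulrA ler_wpM2l // !mulrA ler_wpM2r ?expR_ge0 //.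
rewrite -[2 / c]invf_div mulrC ler_pdivlMr // mulrC.
by rewrite (le_trans _ (expR_ge1Dx _)) // lerDr.
Qed.

(** Taking partial sums of the coefficients divides a generating function by [1 - q]; truncation
    leaves one boundary term, which is small when [|q| < 1]. *)
Lemma abel_step (A : nat -> R[i]) (q : R[i]) (n : nat) :
  (1 - q) * \sum_(1 <= i < n.+1) (\sum_(1 <= j < i.+1) A j) * q ^+ i =
  \sum_(1 <= i < n.+1) A i * q ^+ i - (\sum_(1 <= j < n.+1) A j) * q ^+ n.+1.
Proof.
elim: n => [|n IH]; first by rewrite !big_geq // mulr0 mul0r subrr.
rewrite big_nat_recr //= mulrDr IH [in RHS]big_nat_recr //= [\sum_(1 <= j < n.+2)
  _]big_nat_recr //=.
by rewrite !exprS; ring.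
Qed.

(* The generating function of the iterated partial sums of [a] is
   [f / (1 - q) ^ m], uniformly on horizontal lines. *)
Lemma itersum_generating f a m (y e : R) : fourier_expansion f a -> 0 < y -> 0 < e ->
  exists N : nat, forall n z, (N <= n)%N -> complex.Im z = y ->
    normc (\sum_(1 <= i < n) itersum m a i * qvar z ^+ i -
           f z / (1 - qvar z) ^+ m) <= e.
Proof.
move=> fa y0; have sa := fourier_subexponential fa.
have q1 : 0 < 1 - qabs y by rewrite subr_gt0 qabs_lt1.
have rho1 : 0 <= qabs (y / 2) < 1 by rewrite ltW ?qabs_gt0 // qabs_lt1 ?divr_gt0.
have d0 : 0 < 1 - qabs (y / 2) by rewrite subr_gt0 (andP rho1).2.
elim: m e => [|m IH] e e0.
  have [C C0 HC] := subexponential_qabs sa y0.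
  have D0 : 0 < C / (1 - qabs (y / 2)) + 1 by rewrite ltr_wpDl // divr_ge0 // ltW.
  have [N HN] := expr_small rho1 (divr_gt0 e0 D0).
  exists N.+1 => -[//|n] z Nn zy; rewrite expr0 divr1 normc_distC.
  have z0 : 0 < complex.Im z by rewrite zy.
  apply: (@ctends_tail _ _ _ _ n.+1 isT (fourier_ctends fa z0)) => M _.
  apply: le_trans (_ : C * (qabs (y / 2) ^+ n.+1 / (1 - qabs (y / 2))) <= _).
    apply: le_trans (_ : C * \sum_(n.+1 <= i < M) qabs (y / 2) ^+ i <= _); last first.
      by rewrite ler_wpM2l // geometric_tail_le.
    rewrite mulr_sumr ler_sum_nat // => i /andP[i0 _].
    rewrite (le_trans (HC i z _ _)) ?zy // ?(leq_trans _ i0) //.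
    by have -> : y - y / 2 = y / 2 by field.
  apply: le_trans (_ : (C / (1 - qabs (y / 2)) + 1) * qabs (y / 2) ^+ n.+1 <= _).
    by rewrite [leRHS]mulrDl mulrAC -mulrA lerDl mul1r exprn_ge0 ?(andP rho1).1.
  by rewrite -ler_pdivlMl // [leRHS]mulrC HN // leqW.
have [C C0 HC] := subexponential_qabs (itersum_subexponential m.+1 sa) y0.
have D0 : 0 < C + 1 by rewrite ltr_wpDl.
have e20 : 0 < e * (1 - qabs y) / 2 by rewrite !mulr_gt0 ?invr_gt0.
have [N1 HN1] := IH _ e20.
have [N2 HN2] := expr_small rho1 (divr_gt0 e20 D0).
exists (maxn N1 N2).+2 => -[//|n] z; rewrite ltnS => Nn zy.
have [N1n N2n] : (N1 <= n.+1)%N /\ (N2 <= n)%N.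
  by split; lia.
have n0 : (0 < n)%N by rewrite (leq_ltn_trans _ Nn).
set q := qvar z; set g := f z.
(* This bound depends on the height alone, which makes the division by [1 - q] uniform on the
   line. *)
have dq : 1 - qabs y <= normc (1 - q).
  rewrite lerBlDr -zy -normc_qvar -/q.
  by have := le_normcD (1 - q) q; rewrite subrK normc1.
have dq0 : 1 - q != 0.
  by apply: contraTneq dq => ->; rewrite normc0 -ltNge.
set D := _ - g / _; rewrite -(ler_pM2l q1).
apply: le_trans (_ : normc (1 - q) * normc D <= _).
  by rewrite ler_wpM2r ?normc_ge0.
rewrite -normcM mulrBr abel_step -/q.
have -> : (1 - q) * (g / (1 - q) ^+ m.+1) = g / (1 - q) ^+ m.
  by rewrite exprS; field; rewrite expf_neq0.
rewrite addrAC (le_trans (normcB _ _)) // [leRHS]mulrC [leRHS]splitr lerD //.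
  by rewrite HN1.
rewrite exprS mulrCA normcM.
apply: le_trans (_ : 1 * (C * qabs (y / 2) ^+ n) <= _).
  apply: ler_pM; rewrite ?normc_ge0 //; first by rewrite normc_qvar zy ltW ?qabs_lt1.
  rewrite (le_trans (HC n z n0 _)) ?zy //.
  by have -> : y - y / 2 = y / 2 by field.
rewrite mul1r; apply: le_trans (_ : (C + 1) * qabs (y / 2) ^+ n <= _).
  by rewrite ler_wpM2r ?exprn_ge0 ?(andP rho1).1 // lerDl.
by rewrite -ler_pdivlMl // [leRHS]mulrC HN2.
Qed.

(** The average over roots of unity applies to finite sums. The truncations satisfy the bound up to
    an error [e] uniformly in [x], and [e] is arbitrary. *)
Lemma itersum_coef_bound f a m n (y M : R) : fourier_expansion f a -> 0 < y ->
  (0 < n)%N ->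
  (forall z, complex.Im z = y -> normc (f z / (1 - qvar z) ^+ m) <= M) ->
  normc (itersum m a n) * qabs y ^+ n <= M.
Proof.
move=> fa y0 n0 HM; apply/ler_addgt0Pr => e e0.
have [N HN] := itersum_generating m fa y0 e0.
apply: (@coef_le_sup _ _ (maxn N n.+1)); first by rewrite n0 leq_maxr.
move=> x; set S := \sum_(1 <= i < _) _.
rewrite -(subrK (f (x +i* y) / (1 - qvar (x +i* y)) ^+ m) S).
by rewrite (le_trans (le_normcD _ _)) // addrC lerD ?HM ?HN ?leq_maxl.
Qed.

End FourierGrowth.

(** * The gain from the decay at the cusp 0 *)

Section CoefficientGain.
Variable R : realType.
Implicit Types (f : R[i] -> R[i]) (a : nat -> R[i]) (z : R[i]) (x y : R).

Lemma expR_poly_bound (alpha : R) (n : nat) : 0 < alpha ->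
  exists2 C : R, 0 < C & forall Y, 0 <= Y -> Y ^+ n * expR (- alpha * Y) <= C.
Proof.
elim: n alpha => [|n IH] alpha alpha0.
  exists 1 => // Y Y0; rewrite expr0 mul1r expR_le1.
  by rewrite mulNr oppr_le0 mulr_ge0 // ltW.
have a20 : 0 < alpha / 2 by rewrite divr_gt0.
have [C C0 HC] := IH _ a20; exists (C * (2 / alpha)); first by rewrite mulr_gt0 ?divr_gt0.
move=> Y Y0.
have -> : - alpha * Y = - (alpha / 2) * Y + - (alpha / 2) * Y by field.
rewrite expRD exprSr mulrACA ler_pM ?HC ?mulr_ge0 ?exprn_ge0 ?expR_ge0 //.
rewrite mulNr expRN ler_pdivrMr ?expR_gt0 //.
rewrite -ler_pdivrMl ?divr_gt0 // invf_div mulrC mulrC.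
by rewrite (le_trans _ (expR_ge1Dx _)) // lerDr.
Qed.

(** With [v = u / 2] the mean value theorem gives [sin v >= v cos v], hence [sin u = 2 sin v cos v
    >= 2 v cos^2 v = v (1 + cos u) >= v]. *)
Lemma sin_ge_half (u : R) : 0 <= u <= pi / 2 -> u / 2 <= sin u.
Proof.
move=> /andP[u0 u1].
have [->|un0] := eqVneq u 0; first by rewrite sin0 mul0r.
have {}u0 : 0 < u by rewrite lt_neqAle eq_sym un0.
pose v := u / 2.
have v0 : 0 < v by rewrite divr_gt0.
have p0 := pi_gt0 R.
have [c cv Hc] : exists2 c : R, c \in `]0, v[ & sin v - sin 0 = cos c * (v - 0).
  apply: (@MVT R sin cos 0 v v0).
  by apply: continuous_subspaceT => x; exact: continuous_sin.
move: cv; rewrite in_itv /= => /andP[c0 cv].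
have vpi : v <= pi / 4.
  by rewrite /v; move: (pi : R) u1 p0 => p u1 p0; lra.
have cosle : cos v <= cos c.
  rewrite ltW // ltr_cos // in_itv /=; move: (pi : R) vpi p0 => p vpi p0; lra.
have sv : v * cos v <= sin v.
  by move: Hc; rewrite sin0 !subr0 => ->; rewrite mulrC ler_wpM2r // ltW.
have c2 : cos u = 2 * cos v ^+ 2 - 1.
  have -> : u = v + v by rewrite /v -splitr.
  by rewrite cosD; have := cos2Dsin2 v; nra.
have cu0 : 0 <= cos u.
  apply: cos_ge0_pihalf; rewrite u1 andbT.
  by move: (pi : R) p0 => p p0; lra.
have s2 : sin u = 2 * sin v * cos v.
  have -> : u = v + v by rewrite /v -splitr.
  by rewrite sinD; ring.
have cv0 : 0 <= cos v.
  by apply: cos_ge0_pihalf; move: (pi : R) p0 vpi => p p0 vpi; lra.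
by rewrite -/v s2; nra.
Qed.

Lemma qvar_xyE x y :
  qvar (x +i* y) = qabs y * cos (2 * pi * x) +i* (qabs y * sin (2 * pi * x)).
Proof.
have -> : x +i* y = x%:C + 'i * y%:C by simpc.
rewrite qvarD mulrC qvar_realE.
have -> : qvar ('i * y%:C) = (qabs y)%:C; last by simpc.
rewrite /qvar /cexp /qabs -[2]/(2%:R) -(rmorph_nat (real_complex R)); simpc => /=.
by rewrite ?(mul0r, mulr0, mul1r, mulr1, subr0, sub0r, addr0, add0r, cos0, sin0, oppr0); simpc;
  congr (expR _ +i* _); ring.
Qed.

(** On the closure of this rectangle [1 - q] vanishes only at 0, and to first order. With [r = |q|]
    one has [|1 - q|^2 = (1 - r)^2 + 4 r sin^2 (pi x)]. *)
Lemma normc_one_sub_qvar_ge : exists2 c : R, 0 < c &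
  forall z, `|complex.Re z| <= 2^-1 -> 0 < complex.Im z <= 1 ->
    c * normc z <= normc (1 - qvar z).
Proof.
have p0 := pi_gt0 R.
have p2 : 2 <= pi :> R := pi_ge2 R.
(* The first entry comes from [1 - r >= y / 2], the second is the minimum of [r] for [y <= 1]. *)
pose c2 := Num.min (4^-1) (qabs (1 : R)).
have c20 : 0 < c2 by rewrite lt_min invr_gt0 ltr0n qabs_gt0.
exists (Num.sqrt c2); first by rewrite sqrtr_gt0.
move=> z zx zy; rewrite -(@ler_pXn2r _ 2) ?nnegrE ?mulr_ge0 ?sqrtr_ge0 ?normc_ge0 //.
rewrite exprMn sqr_sqrtr ?(ltW c20) // !normc_sq.
case: z zx zy => [x y]; rewrite qvar_xyE; simpc => /= x2 /andP[y0 y1].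
set r := qabs y; set co := cos _; set si := sin _.
have r0 : 0 < r := qabs_gt0 y.
have cs : co ^+ 2 + si ^+ 2 = 1 := cos2Dsin2 _.
set s := sin (pi * x).
have coE : co = 1 - 2 * s ^+ 2.
  rewrite /co /s; have -> : 2 * pi * x = pi * x + pi * x by ring.
  by rewrite cosD; have := cos2Dsin2 (pi * x); nra.
have sx : x ^+ 2 <= s ^+ 2.
  have H (t : R) : 0 <= t <= 2^-1 -> t ^+ 2 <= sin (pi * t) ^+ 2.
    move=> /andP[t0 t1]; have : pi * t / 2 <= sin (pi * t).
      by apply: sin_ge_half; rewrite mulr_ge0 ?(ltW p0) // ler_wpM2l // ltW.
    move: (sin _) => S HS; have : t <= S.
      by move: (pi : R) p2 HS => p p2 HS; nra.
    by nra.
  rewrite /s; have [x0|x0] := leP 0 x; first by apply: H; rewrite x0 -(ger0_norm x0).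
  have := H (- x); rewrite mulrN sinN !sqrrN; apply.
  by rewrite oppr_ge0 ltW //= -ler0_norm // ltW.
have ry : y / 2 <= 1 - r.
  have e1 : 1 + 2 * pi * y <= expR (2 * pi * y) := expR_ge1Dx _.
  have -> : r = (expR (2 * pi * y))^-1 by rewrite -expRN.
  move: (expR _) e1 => E e1.
  have E0 : 0 < E by rewrite (lt_le_trans _ e1) // ltr_wpDr // !mulr_ge0 // ltW.
  have : E^-1 * E = 1 by rewrite mulVf ?gt_eqF.
  move: (E^-1) (pi : R) p2 e1 => F p p2 e1 FE.
  suff : y / 2 * E <= (1 - F) * E by rewrite ler_pM2r.
  rewrite mulrBl FE mul1r.
  have H1 : (1 + 2 * p * y) * (1 - y / 2) <= E * (1 - y / 2).
    by rewrite ler_wpM2r //; lra.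
  have H2 : 0 <= (p - 2) * y by rewrite mulr_ge0 ?subr_ge0 // ltW.
  have H3 : 0 <= p * y * (1 - y) by rewrite !mulr_ge0 ?subr_ge0 ?(le_trans _ p2) // ltW.
  by lra.
have rr : c2 <= r.
  by rewrite ge_min; apply/orP; right; exact: qabs_le.
have c4 : c2 <= 4^-1 by rewrite ge_min lexx.
have -> : (1 - r * co) ^+ 2 + (- (r * si)) ^+ 2 = (1 - r) ^+ 2 + 4 * r * s ^+ 2.
  rewrite sqrrN exprMn (_ : si ^+ 2 = 1 - co ^+ 2); last by rewrite -cs addrC addKr.
  by rewrite coE; ring.
rewrite mulrDr addrC lerD //.
  apply: le_trans (_ : 4^-1 * y ^+ 2 <= _); first by rewrite ler_wpM2r ?sqr_ge0.
  have -> : 4^-1 * y ^+ 2 = (y / 2) ^+ 2 by field.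
  by rewrite ler_pXn2r ?nnegrE ?divr_ge0 ?(le_trans _ ry) // ?divr_ge0 // ltW.
have := sqr_ge0 x; nra.
Qed.

(** Here and below [kap] is half the weight, so that [|f| y^kap] is the function invariant under the
    group. *)
Definition moderate_growth f (kap : nat) := exists C : R,
  forall z, 0 < complex.Im z -> normc (f z) * complex.Im z ^+ kap <= C.

(** The imaginary part of [z] in the coordinate of the cusp [x0], that is, after applying the
    inverse of [cusp_matrix r x0]. Its level sets are the horocycles at [x0]. *)
Definition horocycle_height (r x0 : R) z : R :=
  complex.Im z / (r * normc (z - x0%:C)) ^+ 2.

(** The power of [r * normc (z - x0%:C)] is the modulus of the automorphy factor, so the left side
    of the bound is the modulus of the slashed form in the coordinate of the cusp. *)
Definition cusp_decay f (kap : nat) (x0 : R) := exists r M alpha Y0 : R,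
  [/\ 0 < r, 0 < alpha, 0 <= M & forall z, 0 < complex.Im z ->
    Y0 <= horocycle_height r x0 z ->
    normc (f z) * (r * normc (z - x0%:C)) ^+ (2 * kap) <=
    M * expR (- alpha * horocycle_height r x0 z)].

Lemma normc_Im_gt0 z : 0 < complex.Im z -> 0 < normc z.
Proof. by move=> z0; rewrite (lt_le_trans z0) // (le_trans _ (ler_Im_normc z)) // ler_norm. Qed.

(** Write [y = h w] with [w = (r |z|)^2] and [h] the height at the cusp 0. For large [h] the
    exponential decay beats [h^(kap + p)]; for bounded [h] one has [y <= Y1 w], and [p] of the
    factors [y] are replaced by [w]. The constant adds up both cases. The factor [|z|^(2p)] on the
    right will cancel the pole of [(1 - q)^(-2p)]. *)
Lemma decay_over_power f kap p : moderate_growth f kap -> cusp_decay f kap 0 ->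
  exists2 C : R, 0 <= C & forall z, 0 < complex.Im z ->
    normc (f z) * complex.Im z ^+ (kap + p) <= C * normc z ^+ (2 * p).
Proof.
move=> [C1 HC1] [r [M [alpha [Y0 [r0 alpha0 M0 Hd]]]]].
have [C2 C20 HC2] := expR_poly_bound (kap + p) alpha0.
have C10 : 0 <= C1.
  by apply: le_trans (HC1 (0 +i* 1) ltr01); rewrite mulr_ge0 ?normc_ge0 //= expr1n.
pose Y1 := Num.max Y0 0; have Y10 : 0 <= Y1 by rewrite le_max lexx orbT.
exists (M * C2 * r ^+ (2 * p) + C1 * Y1 ^+ p * r ^+ (2 * p)).
  by rewrite addr_ge0 ?mulr_ge0 ?exprn_ge0 // ltW.
move=> z z0; have n0 := normc_Im_gt0 z0.
pose h := horocycle_height r 0 z.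
pose w := (r * normc z) ^+ 2.
have w0 : 0 < w by rewrite exprn_gt0 ?mulr_gt0.
have zE : complex.Im z = h * w by rewrite /h /horocycle_height subr0 divfK ?gt_eqF.
have h0 : 0 <= h by rewrite /h /horocycle_height divr_ge0 ?exprn_ge0 ?mulr_ge0 ?normc_ge0 // ltW.
have wp : w ^+ p = r ^+ (2 * p) * normc z ^+ (2 * p).
  by rewrite /w -exprM exprMn.
have [hY|hY] := leP Y1 h.
  have : normc (f z) * w ^+ kap <= M * expR (- alpha * h).
    by rewrite /w -exprM; have := Hd z z0; rewrite subr0; apply; rewrite (le_trans _ hY) //
      le_max lexx.
  move=> H; rewrite mulrDl -[leLHS]addr0 lerD ?mulr_ge0 ?exprn_ge0 ?normc_ge0 ?(ltW r0) //.
  have yw : complex.Im z ^+ (kap + p) = h ^+ (kap + p) * (w ^+ kap * w ^+ p).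
    transitivity ((h * w) ^+ (kap + p)); first exact: (congr1 (fun t : R => t ^+ (kap + p)) zE).
    by rewrite exprMn; congr (_ * _); rewrite exprD.
  rewrite -!mulrA -wp yw.
  apply: le_trans (_ : M * expR (- alpha * h) * (h ^+ (kap + p) * w ^+ p) <= _).
    have -> : normc (f z) * (h ^+ (kap + p) * (w ^+ kap * w ^+ p)) =
      normc (f z) * w ^+ kap * (h ^+ (kap + p) * w ^+ p) by ring.
    by rewrite ler_wpM2r // mulr_ge0 // exprn_ge0 // ltW.
  have -> : M * expR (- alpha * h) * (h ^+ (kap + p) * w ^+ p) =
    M * (h ^+ (kap + p) * expR (- alpha * h) * w ^+ p) by ring.
  by rewrite ler_wpM2l // ler_wpM2r ?HC2 // exprn_ge0 // ltW.
rewrite mulrDl -[leLHS]add0r lerD ?mulr_ge0 ?exprn_ge0 ?normc_ge0 ?(ltW r0) ?(ltW C20) //.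
rewrite exprD mulrA -!mulrA -wp mulrA ler_pM ?HC1 ?exprn_ge0 ?mulr_ge0 ?exprn_ge0 ?normc_ge0
  ?(ltW z0) //.
have zle : complex.Im z <= Y1 * w.
  by have : h * w <= Y1 * w by [rewrite ler_wpM2r // ltW]; rewrite -zE.
rewrite -exprMn; apply: lerXn2r zle; rewrite nnegrE; first exact: ltW.
by apply: mulr_ge0 => //; exact: ltW.
Qed.

Lemma qvar_intr (m : int) : qvar (m%:~R : R[i]) = 1.
Proof.
case: m => n; first by rewrite -pmulrn qvar_nat.
rewrite NegzE mulrNz -pmulrn; have := qvarD (- n.+1%:R : R[i]) n.+1%:R.
by rewrite addNr (qvar_nat R n.+1) mulr1 (qvar_nat R 0) => <-.
Qed.

Lemma strip_repr f a z : fourier_expansion f a -> 0 < complex.Im z ->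
  exists w, [/\ `|complex.Re w| <= 2^-1, complex.Im w = complex.Im z,
    qvar w = qvar z & f w = f z].
Proof.
move=> fa z0; pose m := Num.floor (complex.Re z + 2^-1).
exists (z - m%:~R).
have mE : m%:~R = (m%:~R : R)%:C by rewrite rmorph_int.
have qE : qvar (z - m%:~R) = qvar z.
  by rewrite qvarD -mulrNz qvar_intr mulr1.
have iE : complex.Im (z - m%:~R) = complex.Im z.
  by rewrite mE ImD ImN /= subr0.
split => //.
  rewrite mE ReD ReN /=.
  have /andP[] := floor_itv (complex.Re z + 2^-1).
  by rewrite -/m intrD ler_norml; move: (m%:~R) => u ? ?; lra.
apply: (ctends_unique (fourier_ctends fa _)); first by rewrite iE.
by rewrite qE; exact: fourier_ctends.
Qed.

(* Trivially the [2p]-fold sums are [O(n ^ (kap + 2p))]: the decay of [f] at the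
   cusp [0] saves a factor [n ^ p]. *)
Lemma itersum_cusp_bound f a kap p : fourier_expansion f a ->
  moderate_growth f kap -> cusp_decay f kap 0 ->
  exists2 C : R, 0 <= C & forall n, (0 < n)%N ->
    normc (itersum (2 * p) a n) <= C * n%:R ^+ (kap + p).
Proof.
move=> fa fg fd.
have [C C0 HC] := decay_over_power p fg fd.
have [c c0 Hc] := normc_one_sub_qvar_ge.
have q10 := qabs_gt0 (1 : R).
exists (C / c ^+ (2 * p) / qabs 1).
  by rewrite !divr_ge0 ?exprn_ge0 // ltW.
move=> n n0; have nR : 0 < n%:R :> R by rewrite ltr0n.
have y0 : 0 < n%:R^-1 :> R by rewrite invr_gt0.
have y1 : n%:R^-1 <= 1 :> R by rewrite invf_le1 // ler1n.
have := @itersum_coef_bound R f a (2 * p) n n%:R^-1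
  (C / c ^+ (2 * p) * n%:R ^+ (kap + p)) fa y0 n0.
(* At height [1 / n] the factor [|q|^n] is [qabs 1], independent of [n]. *)
rewrite -qabsMn mulfV ?gt_eqF // => H.
rewrite [leRHS]mulrAC ler_pdivlMr //.
apply: H => z zy; have z0 : 0 < complex.Im z by rewrite zy.
have [w [w2 wz qwz fwz]] := strip_repr fa z0.
rewrite -fwz -qwz normcM normcV normcX.
have w0 : 0 < complex.Im w by rewrite wz.
have Hw := Hc w w2 (_ : 0 < complex.Im w <= 1).
have nw := normc_Im_gt0 w0.
have {}Hw : c * normc w <= normc (1 - qvar w) by apply: Hw; rewrite w0 wz zy.
have cw0 : 0 < c * normc w by rewrite mulr_gt0.
rewrite ler_pdivrMr ?exprn_gt0 ?(lt_le_trans cw0) //.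
apply: le_trans (_ : C / c ^+ (2 * p) * n%:R ^+ (kap + p) * (c * normc w) ^+ (2 * p) <= _);
  last first.
  rewrite ler_wpM2l ?mulr_ge0 ?invr_ge0 ?exprn_ge0 ?(ltW c0) //.
  by rewrite lerXn2r ?nnegrE ?normc_ge0 // ltW.
rewrite exprMn.
have -> : C / c ^+ (2 * p) * n%:R ^+ (kap + p) * (c ^+ (2 * p) * normc w ^+ (2 * p)) =
  C * normc w ^+ (2 * p) * n%:R ^+ (kap + p).
  by field; rewrite expf_neq0 // gt_eqF.
rewrite -ler_pdivrMr ?exprn_gt0 // -exprVn -zy -wz.
exact: HC.
Qed.

End CoefficientGain.

(** * Differences of Dirichlet monomials *)

Section Differences.
Variable V : zmodType.
Implicit Types w : nat -> V.

Fixpoint dif (m : nat) w (n : nat) : V :=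
  if m is m'.+1 then dif m' w n - dif m' w n.+1 else w n.

Lemma dif_shift m w j n : dif m w (j + n) = dif m (fun i => w (j + i)%N) n.
Proof. by elim: m n => [//|m IH] n /=; rewrite -addnS !IH. Qed.

End Differences.

Section RealDerivatives.
Variable R : realType.
Implicit Types (f g : R -> R) (x a b : R).

Let deriv f x a := is_derive x 1 f a.

Lemma is_derive_add f g x a b : deriv f x a -> deriv g x b ->
  deriv (fun t => f t + g t) x (a + b).
Proof. exact: is_deriveD. Qed.

Lemma is_derive_mul f g x a b : deriv f x a -> deriv g x b ->
  deriv (fun t => f t * g t) x (a * g x + f x * b).
Proof.
move=> fa gb; apply: (is_derive_eq (is_deriveM fa gb)).
by rewrite addrC [a * _]mulrC.
Qed.

Lemma is_derive_scale f x a b : deriv f x a -> deriv (fun t => b * f t) x (b * a).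
Proof.
move=> fa; apply: (is_derive_eq (is_derive_mul (is_derive_cst b x 1) fa)).
by rewrite mul0r add0r.
Qed.

Lemma is_derive_sub f g x a b : deriv f x a -> deriv g x b ->
  deriv (fun t => f t - g t) x (a - b).
Proof. exact: is_deriveB. Qed.

Lemma is_derive_compose f g x a b : deriv f (g x) a -> deriv g x b ->
  deriv (fun t => f (g t)) x (a * b).
Proof. exact: is_derive1_comp. Qed.

Lemma is_derive_exprn x n : deriv (fun t => t ^+ n) x (n%:R * x ^+ n.-1).
Proof.
have := @is_deriveX R R id n x 1 1 (is_derive_id x 1).
rewrite (_ : id ^+ n = fun t => t ^+ n); last by apply/funext => t; rewrite exprfctE.
by move=> H; apply: (is_derive_eq H); exact: mulr1.
Qed.

Lemma is_derive_linear x a b : deriv (fun t => a + b * t) x b.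
Proof.
have := is_derive_add (is_derive_cst a x 1) (is_derive_scale b (is_derive_id x 1)).
by rewrite add0r mulr1.
Qed.

Lemma mean_value (f df : R -> R) x y : x < y ->
  (forall z, x <= z <= y -> deriv f z (df z)) ->
  exists2 c, x <= c <= y & f y - f x = df c * (y - x).
Proof.
move=> xy fd.
have [||c] := @MVT R f df x y xy.
- by move=> z; rewrite in_itv /= => /andP[xz zy]; apply: fd; rewrite !ltW.
- apply: derivable_within_continuous => z; rewrite in_itv /= => zxy.
  by have [] := fd z zxy.
- by rewrite in_itv /= => /andP[xc cy] E; exists c; rewrite ?ltW.
Qed.

End RealDerivatives.

Section PowerDifferences.
Variable R : realType.
Implicit Types (c s h : R[i]) (u x : R) (r : nat).

(** The real part of [c (log x)^r x^(-s)] at [u = log x]. This family is closed under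
    differentiation in [u] and in [s]; the free constant [c] gives access to the imaginary part as
    well. *)
Definition logpow r c s u : R := complex.Re (c * (u ^+ r)%:C * cexp (- s * u%:C)).

Lemma logpowE r c s u : logpow r c s u =
  u ^+ r * (expR (- (complex.Re s * u)) *
   (complex.Re c * cos (complex.Im s * u) + complex.Im c * sin (complex.Im s * u))).
Proof.
case: c s => c1 c2 [s1 s2]; rewrite /logpow /cexp; simpc => /=.
have -> : cos (- (s2 * u)) = cos (s2 * u) by exact: cosN.
have -> : sin (- (s2 * u)) = - sin (s2 * u) by exact: sinN.
ring.
Qed.

Lemma normc_logpow r c s u :
  `|logpow r c s u| <= `|u| ^+ r * normc c * expR (- (complex.Re s * u)).
Proof.
rewrite (le_trans (ler_Re_normc _)) // normcM normc_cexp normcM normcR normrX [`|u| ^+ r *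
  _]mulrC.
by case: s => s1 s2; simpc => /=.
Qed.

Lemma logpow_is_derive r c s u : is_derive u 1 (logpow r c s)
  (logpow r (- s * c) s u + r%:R * logpow r.-1 c s u).
Proof.
set E := fun v : R => expR (- complex.Re s * v).
have dE : is_derive u 1 E (E u * - complex.Re s).
  apply: is_derive_compose (is_derive_expR _) _.
  by have := is_derive_linear u 0 (- complex.Re s); under eq_fun do rewrite add0r.
set C := fun v : R => cos (complex.Im s * v).
set S := fun v : R => sin (complex.Im s * v).
have dl : is_derive u 1 (fun v => complex.Im s * v) (complex.Im s).
  by have := is_derive_linear u 0 (complex.Im s); under eq_fun do rewrite add0r.
have dC : is_derive u 1 C (- S u * complex.Im s).
  exact: is_derive_compose (is_derive_cos _) dl.
have dS : is_derive u 1 S (C u * complex.Im s).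
  exact: is_derive_compose (is_derive_sin _) dl.
have FE r' c' : logpow r' c' s =
    (fun v => v ^+ r' * (E v * (complex.Re c' * C v + complex.Im c' * S v))).
  by apply/funext => v; rewrite logpowE /E mulNr.
have := is_derive_mul (is_derive_exprn u r) (is_derive_mul dE
  (is_derive_add (is_derive_scale (complex.Re c) dC) (is_derive_scale (complex.Im c) dS))).
rewrite -FE => H; apply: (is_derive_eq H).
rewrite !FE; move: (E u) (C u) (S u) => e co si.
case: c s {FE H dE dC dS dl E C S} => c1 c2 [s1 s2]; simpc => /=.
by case: r => [|r] /=; ring.
Qed.

Lemma logpow_ln_shift r c s x : 0 < x ->
  logpow r c (s + 1) (ln x) = logpow r c s (ln x) * x^-1.
Proof.
move=> x0; rewrite !logpowE ReD ImD /= addr0.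
have -> : - ((complex.Re s + 1) * ln x) = - (complex.Re s * ln x) - ln x by ring.
by rewrite expRD [expR (- ln x)]expRN lnK ?posrE //; ring.
Qed.

Lemma logpow_ln_is_derive r c s x : 0 < x ->
  is_derive x 1 (fun y => logpow r c s (ln y))
    (logpow r (- s * c) (s + 1) (ln x) + r%:R * logpow r.-1 c (s + 1) (ln x)).
Proof.
move=> x0.
have := is_derive_compose (logpow_is_derive r c s (ln x)) (is_derive1_ln x0).
by move=> H; apply: (is_derive_eq H); rewrite !logpow_ln_shift //; ring.
Qed.

(** As a function of [v] this is again a [logpow], with exponent [h * u%:C], so the derivative in
    the variable already known applies. *)
Lemma logpow_is_derive_exponent r c s h u (v : R) :
  is_derive v 1 (fun v => logpow r c (s + v%:C * h) u)
    (logpow r.+1 (- h * c) (s + v%:C * h) u).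
Proof.
pose c' := c * (u ^+ r)%:C * cexp (- s * u%:C).
have E : (fun v => logpow r c (s + v%:C * h) u) = logpow 0 c' (h * u%:C).
  apply/funext => t; rewrite /logpow expr0 rmorph1 mulr1 /c'; congr complex.Re.
  by rewrite -[RHS]mulrA -cexpD; congr (_ * cexp _); ring.
rewrite E; apply: (is_derive_eq (logpow_is_derive 0 c' (h * u%:C) v)).
rewrite mul0r addr0 /logpow expr0 rmorph1 mulr1 /c'.
have -> : - (s + v%:C * h) * u%:C = - s * u%:C + - (h * u%:C) * v%:C by ring.
have uE : (u ^+ r.+1)%:C = u%:C * (u ^+ r)%:C by rewrite exprS rmorphM.
rewrite cexpD uE; congr complex.Re.
move: (cexp _) (cexp _) ((u ^+ r)%:C) => p q w; ring.
Qed.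

(* Unlike [powR], positive also at the junk points [x <= 0]. *)
Definition rpow (rho x : R) : R := expR (rho * ln x).

Lemma rpow_gt0 rho x : 0 < rpow rho x. Proof. exact: expR_gt0. Qed.

Lemma rpowD rho sig x : rpow (rho + sig) x = rpow rho x * rpow sig x.
Proof. by rewrite /rpow mulrDl expRD. Qed.

Lemma rpow1 x : 0 < x -> rpow 1 x = x.
Proof. by move=> x0; rewrite /rpow mul1r lnK. Qed.

Lemma rpow_nat n x : 0 < x -> rpow n%:R x = x ^+ n.
Proof. by move=> x0; rewrite /rpow expRM_natl lnK. Qed.

Lemma rpow_le rho sig x : 1 <= x -> rho <= sig -> rpow rho x <= rpow sig x.
Proof. by move=> x1 rs; rewrite ler_expR ler_wpM2r // ln_ge0. Qed.

(** Brings the intermediate point of the mean value theorem on [[x, x + 1]] back to [x]. *)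
Lemma rpow_step rho x y : 1 <= x -> x <= y <= x + 1 ->
  rpow rho y <= expR `|rho| * rpow rho x.
Proof.
move=> x1 /andP[xy yx]; have x0 : 0 < x by rewrite (lt_le_trans _ x1).
have y0 : 0 < y by rewrite (lt_le_trans x0).
rewrite -expRD ler_expR -lerBlDr -mulrBr.
have l0 : 0 <= ln y - ln x by rewrite subr_ge0 ler_ln.
have l1 : ln y - ln x <= 1.
  rewrite -ln_div ?posrE // -ler_expR lnK ?posrE ?divr_gt0 //.
  rewrite (le_trans _ (expR_ge1Dx _)) // ler_pdivrMr //; lra.
rewrite (le_trans (ler_norm _)) // normrM (ger0_norm l0).
by rewrite -[leRHS]mulr1 ler_wpM2l.
Qed.

Lemma dif_is_derive m (w dw : nat -> R -> R) n x :
  (forall i, (n <= i)%N -> is_derive x 1 (w i) (dw i x)) ->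
  is_derive x 1 (fun y => dif m (fun i => w i y) n) (dif m (fun i => dw i x) n).
Proof.
elim: m n => [|m IH] n H /=; first exact: H.
by apply: is_derive_sub; apply: IH => // i /ltnW/H.
Qed.

(** Powers of the logarithm are bounded crudely by [x ^ 2], whence the 2 in the exponent. Two
    logarithms suffice for a Taylor estimate of second order in [s]. *)
Lemma logpow_ln_bound r c s x : (r <= 2)%N -> 1 <= x ->
  `|logpow r c s (ln x)| <= normc c * rpow (2 - complex.Re s) x.
Proof.
move=> r2 x1; have x0 : 0 < x by rewrite (lt_le_trans _ x1).
rewrite (le_trans (normc_logpow _ _ _ _)) // ger0_norm ?ln_ge0 //.
rewrite mulrAC mulrC ler_wpM2l ?normc_ge0 //.
rewrite rpowD /rpow mulNr ler_wpM2r ?expR_ge0 // expRM_natl lnK ?posrE //.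
have l1 : ln x <= x by rewrite -ler_expR lnK ?posrE // (le_trans _ (expR_ge1Dx _)) // lerDr.
rewrite (le_trans (lerXn2r _ _ _ l1)) ?nnegrE ?ln_ge0 // ?(ltW x0) //.
by rewrite ler_weXn2l.
Qed.

(** By the mean value theorem each difference is a derivative at an intermediate point, and
    differentiating in [x] replaces [s] by [s + 1]. The induction therefore runs over all [B], using
    the bound [B + 1] one level below. *)
Lemma dif_logpow_bound m (B : R) : 0 <= B -> exists2 C : R, 0 <= C &
  forall r c s x, (r <= 2)%N -> normc s <= B -> 1 <= x ->
    `|dif m (fun i => logpow r c s (ln (x + i%:R))) 0| <=
    C * normc c * rpow (2 - complex.Re s - m%:R) x.
Proof.
elim: m B => [|m IH] B B0.
  exists 1 => // r c s x r2 _ x1; rewrite /= addr0 subr0 mul1r.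
  exact: logpow_ln_bound.
have [C C0 HC] := IH (B + 1) (addr_ge0 B0 ler01).
(* The factor [B + 2] bounds the two terms [- s] and [r] of the derivative; the exponential is the
   price of [rpow_step], as [B + 3 + m%:R] bounds the exponent in absolute value. *)
exists (C * (B + 2) * expR (B + 3 + m%:R)); first by rewrite !mulr_ge0 ?expR_ge0 ?addr_ge0.
move=> r c s x r2 sB x1 /=.
pose g (y : R) := dif m (fun i => logpow r c s (ln (y + i%:R))) 0.
have -> : dif m (fun i => logpow r c s (ln (x + i%:R))) 1 = g (x + 1).
  rewrite -[1%N]addn0 dif_shift /g; congr (dif m _ 0); apply/funext => i.
  by rewrite natrD addrA.
pose dg (y : R) := dif m (fun i => logpow r (- s * c) (s + 1) (ln (y + i%:R))) 0 +
   r%:R * dif m (fun i => logpow r.-1 c (s + 1) (ln (y + i%:R))) 0.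
have gd (y : R) : 1 <= y -> is_derive y 1 g (dg y).
  move=> y1.
  have := @dif_is_derive m (fun i (y : R) => logpow r c s (ln (y + i%:R)))
    (fun i (y : R) => logpow r (- s * c) (s + 1) (ln (y + i%:R)) + r%:R * logpow r.-1 c (s + 1)
      (ln (y + i%:R))) 0 y.
  move=> H; apply: (is_derive_eq (H _)).
    move=> i _; have yi : 0 < y + i%:R by rewrite ltr_wpDr // (lt_le_trans _ y1).
    have dl : is_derive y 1 (fun t : R => t + i%:R) 1.
      by have := is_derive_linear y i%:R 1; under eq_fun do rewrite mul1r addrC.
    have := @is_derive_compose R (fun t => logpow r c s (ln t)) _ y _ _
      (logpow_ln_is_derive r c s yi) dl.
    by rewrite mulr1.
  rewrite /dg; elim: {H} m 0%N {IH HC g dg} => [//|m IH] n /=.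
  by rewrite !IH; ring.
have [|y|z /andP[xz zx1]] := @mean_value R g dg x (x + 1); first by rewrite ltrDl.
  by move=> /andP[xy _]; apply: gd; rewrite (le_trans x1).
rewrite -/(g x) distrC => ->; rewrite [x + 1]addrC addrK mulr1.
have z1 : 1 <= z by rewrite (le_trans x1).
have s1 : normc (s + 1) <= B + 1 by rewrite (le_trans (le_normcD _ _)) // normc1 lerD2r.
have r1 : (r.-1 <= 2)%N by rewrite (leq_trans _ r2) // leq_pred.
have H1 := HC r (- s * c) (s + 1) z r2 s1 z1.
have H2 := HC r.-1 c (s + 1) z r1 s1 z1.
have rhoE : 2 - complex.Re (s + 1) - m%:R = 2 - complex.Re s - m.+1%:R.
  by rewrite ReD /= -addn1 natrD; ring.
rewrite rhoE normcM normcN in H1; rewrite rhoE in H2.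
set rho := 2 - complex.Re s - m.+1%:R.
have rhoB : `|rho| <= B + 3 + m%:R.
  have := le_trans (ler_Re_normc s) sB; rewrite /rho -[m.+1]addn1 natrD !ler_norml.
  have := ler0n R m; move: (m%:R : R) => M M0 /andP[? ?]; apply/andP; split; lra.
have st : rpow rho z <= expR (B + 3 + m%:R) * rpow rho x.
  rewrite (le_trans (rpow_step rho x1 _)) ?xz // ler_wpM2r ?ler_expR //.
  exact: ltW (rpow_gt0 _ _).
rewrite (le_trans (ler_normD _ _)) // normrM [`|r%:R|]ger0_norm ?ler0n //.
apply: le_trans (_ : C * (B + 2) * normc c * rpow rho z <= _); last first.
  have -> : C * (B + 2) * expR (B + 3 + m%:R) * normc c * rpow rho x =
    C * (B + 2) * normc c * (expR (B + 3 + m%:R) * rpow rho x) by ring.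
  by rewrite ler_wpM2l // !mulr_ge0 ?normc_ge0 ?addr_ge0.
rewrite mulrDr !mulrDl lerD //.
  rewrite (le_trans H1) // ler_wpM2r ?(ltW (rpow_gt0 _ _)) // -mulrA ler_wpM2l //.
  by rewrite ler_wpM2r ?normc_ge0.
rewrite (le_trans (ler_pM _ _ (_ : r%:R <= 2) H2)) ?normr_ge0 ?ler0n ?ler_nat //.
by rewrite le_eqVlt; apply/orP; left; apply/eqP; ring.
Qed.

End PowerDifferences.

(** * Taylor estimates in the exponent *)

Section DirichletJets.
Variable R : realType.
Implicit Types (c s t h Z : R[i]) (u x : R) (m n : nat).

(* Reduces complex estimates to real functions, for which the mean value theorem holds. *)
Lemma normc_le_test Z (X : R) :
  (forall c, normc c <= 1 -> `|complex.Re (c * Z)| <= X) -> normc Z <= 2 * X.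
Proof.
move=> H; rewrite (le_trans (ler_normc_ReIm _)) // mulrDl !mul1r lerD //.
  by have := H 1; rewrite normc1 mul1r; apply.
have := H (- 'i); rewrite normcN /= expr0n /= add0r expr1n sqrtr1 => /(_ (lexx 1)).
by case: Z {H} => a b; simpc => /=.
Qed.

Lemma Re_dif c (w : nat -> R[i]) m n :
  complex.Re (c * dif m w n) = dif m (fun i => complex.Re (c * w i)) n.
Proof. by elim: m n => [//|m IH] n /=; rewrite mulrBr ReD ReN !IH. Qed.

Definition npow_dif m s n : R[i] := dif m (fun i => natcpow i (- s)) n.

(** The derivative of [npow_dif m s n] in [s]. *)
Definition npow_dif' m s n : R[i] :=
  dif m (fun i => - (ln (i%:R : R))%:C * natcpow i (- s)) n.

Lemma Re_npow_dif c m s n :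
  complex.Re (c * npow_dif m s n) =
  dif m (fun i => logpow 0 c s (ln (n%:R + i%:R))) 0.
Proof.
rewrite Re_dif -[n in LHS]addn0 dif_shift; congr (dif m _ 0); apply/funext => i.
by rewrite /logpow /natcpow expr0 rmorph1 mulr1 natrD.
Qed.

Lemma Re_npow_dif' c m s n :
  complex.Re (c * npow_dif' m s n) =
  dif m (fun i => logpow 1 (- c) s (ln (n%:R + i%:R))) 0.
Proof.
rewrite Re_dif -[n in LHS]addn0 dif_shift; congr (dif m _ 0); apply/funext => i.
by rewrite /logpow /natcpow expr1 natrD; congr complex.Re; move: (cexp _) => e; ring.
Qed.

(** A first order expansion with derivative [q], where one constant controls the value, the
    derivative and the quadratic remainder. Such bounds can be added and multiplied, which makes
    termwise differentiation of the series elementary. *)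
Definition jet (F : R[i] -> R[i]) (s q : R[i]) (B : R) :=
  [/\ normc (F s) <= B, normc q <= B & forall h, normc h <= 1 ->
    normc (F (s + h) - F s - h * q) <= B * normc h ^+ 2].

Lemma jet_ge0 F s q B : jet F s q B -> 0 <= B.
Proof. by case=> H _ _; exact: le_trans (normc_ge0 _) H. Qed.

Lemma jet_le F s q (B B' : R) : B <= B' -> jet F s q B -> jet F s q B'.
Proof.
move=> BB [H1 H2 H3]; split; [exact: le_trans BB|exact: le_trans BB|].
by move=> h h1; rewrite (le_trans (H3 h h1)) // ler_wpM2r ?exprn_ge0 ?normc_ge0.
Qed.

Lemma jet_sum (I : eqType) (r : seq I) (c : I -> R[i]) (F : I -> R[i] -> R[i])
    s (q : I -> R[i]) (B : I -> R) :
  (forall i, i \in r -> jet (F i) s (q i) (B i)) ->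
  jet (fun s => \sum_(i <- r) c i * F i s) s (\sum_(i <- r) c i * q i)
    (\sum_(i <- r) normc (c i) * B i).
Proof.
move=> H; split.
- rewrite (le_trans (normc_sum _ _ _)) // !big_seq ler_sum // => i ir.
  by rewrite normcM ler_wpM2l ?normc_ge0 //; have [] := H i ir.
- rewrite (le_trans (normc_sum _ _ _)) // !big_seq ler_sum // => i ir.
  by rewrite normcM ler_wpM2l ?normc_ge0 //; have [] := H i ir.
- move=> h h1; rewrite mulr_sumr -!sumrB mulr_suml.
  rewrite (le_trans (normc_sum _ _ _)) // !big_seq ler_sum // => i ir.
  have -> : c i * F i (s + h) - c i * F i s - h * (c i * q i) =
    c i * (F i (s + h) - F i s - h * q i) by ring.
  rewrite normcM -mulrA ler_wpM2l ?normc_ge0 //.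
  by have [_ _] := H i ir; apply.
Qed.

(** Two applications of the mean value theorem on the segment from [s] to [s + h] express the
    remainder by a second derivative at some [s + v2 h]. Since the real part can drop by 1 there,
    the 2 of [dif_logpow_bound] becomes 3. The factor 2 comes from [normc_le_test]. *)
Lemma npow_dif_jet m (B : R) : 0 <= B -> exists2 C : R, 0 <= C &
  forall s n, normc s <= B -> (0 < n)%N ->
    jet (fun s => npow_dif m s n) s (npow_dif' m s n)
      (C * rpow (3 - complex.Re s - m%:R) n%:R).
Proof.
move=> B0; have [C C0 HC] := dif_logpow_bound m (addr_ge0 B0 ler01).
exists (2 * C) => [|s n sB n0]; first exact: mulr_ge0.
have n1 : 1 <= n%:R :> R by rewrite ler1n.
have sB1 : normc s <= B + 1 by rewrite (le_trans sB) // lerDl.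
have rle : rpow (2 - complex.Re s - m%:R) n%:R <= rpow (3 - complex.Re s - m%:R) n%:R.
  by rewrite rpow_le // !lerD2r ler_nat.
set Q := rpow (3 - _ - _) _ in rle *.
have Q0 : 0 <= Q by exact: ltW (rpow_gt0 _ _).
have step r c : (r <= 2)%N -> normc c <= 1 ->
    `|dif m (fun i => logpow r c s (ln (n%:R + i%:R))) 0| <= C * Q.
  move=> r2 c1; apply: le_trans (HC r c s n%:R r2 sB1 n1) _.
  by rewrite -mulrA ler_wpM2l // -[leRHS]mul1r ler_pM ?normc_ge0 // ltW ?rpow_gt0.
split.
- rewrite -mulrA; apply: normc_le_test => c c1.
  by rewrite Re_npow_dif step.
- rewrite -mulrA; apply: normc_le_test => c c1.
  by rewrite Re_npow_dif' step // normcN.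
move=> h h1.
have -> : 2 * C * Q * normc h ^+ 2 = 2 * (C * Q * normc h ^+ 2) by ring.
apply: normc_le_test => c c1.
pose phi r c' (v : R) := dif m (fun i => logpow r c' (s + v%:C * h) (ln (n%:R + i%:R))) 0.
have dphi r c' v : is_derive v (1 : R) (phi r c') (phi r.+1 (- h * c') v).
  apply: (@dif_is_derive R m (fun i v => logpow r c' (s + v%:C * h) (ln (n%:R + i%:R)))
    (fun i v => logpow r.+1 (- h * c') (s + v%:C * h) (ln (n%:R + i%:R))) 0 v) => i _.
  exact: logpow_is_derive_exponent.
have phi0 r c' : dif m (fun i => logpow r c' s (ln (n%:R + i%:R))) 0 = phi r c' 0.
  by rewrite /phi mul0r addr0.
have -> : complex.Re (c * (npow_dif m (s + h) n - npow_dif m s n - h * npow_dif' m s n)) =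
    phi 0 c 1 - phi 0 c 0 - phi 1 (- h * c) 0.
  rewrite !mulrBr !ReD !ReN !Re_npow_dif -phi0 mulrA [c * h]mulrC.
  by rewrite Re_npow_dif' /phi mul0r addr0 mul1r mulNr.
have [v1 /andP[v10 v11]] := @mean_value R _ _ 0 1 ltr01 (fun z _ => dphi 0 c z).
rewrite subr0 mulr1 => ->.
have : exists2 v2, 0 <= v2 <= 1 & `|phi 1 (- h * c) v1 - phi 1 (- h * c) 0| <= `|phi 2 (- h *
  (- h * c)) v2|.
  have [->|vn0] := eqVneq v1 0.
    by exists 0; rewrite ?lexx ?ler01 // subrr normr0.
  have v1_gt0 : 0 < v1 by rewrite lt_neqAle eq_sym vn0.
  have [v2 /andP[v20 v21] ->] := @mean_value R _ _ 0 v1 v1_gt0 (fun z _ => dphi 1 (- h * c) z).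
  exists v2; first by rewrite v20 (le_trans v21).
  by rewrite subr0 normrM -[leRHS]mulr1 ler_wpM2l // ger0_norm.
move=> [v2 /andP[v20 v21] H]; apply: le_trans H _.
have vh1 : normc (v2%:C * h) <= 1.
  by rewrite normcM normcR ger0_norm // -[1]mulr1 ler_pM ?normc_ge0.
have sv : normc (s + v2%:C * h) <= B + 1.
  by rewrite (le_trans (le_normcD _ _)) // lerD.
apply: le_trans (HC 2 _ _ n%:R (leqnn 2) sv n1) _.
rewrite -!mulrA ler_wpM2l // mulrC ler_pM ?normc_ge0 ?(ltW (rpow_gt0 _ _)) //.
  rewrite rpow_le // lerD2r ReD.
  have := le_trans (ler_Re_normc _) vh1; rewrite ler_norml => /andP[? ?]; lra.
by rewrite !normcM !normcN mulrA -expr2 -[leRHS]mulr1 ler_wpM2l // exprn_ge0 ?normc_ge0.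
Qed.

End DirichletJets.

(** * Summation by parts *)

Section Continuation.
Variable R : realType.
Variables (a b : nat -> R[i]) (K : nat).
Implicit Types (s t h : R[i]) (m n p : nat).

(** This hypothesis and the next are all that the continuation takes from modular forms: the gain of
    [n ^ p] in the [2p]-fold sums, and polynomial growth of [b]. *)
Hypothesis itersum_le : forall p, exists2 C : R, 0 <= C & forall n, (0 < n)%N ->
  normc (itersum (2 * p) a n) <= C * n%:R ^+ (K + p).
Hypothesis coef_le : exists2 C : R, 0 <= C & forall n, (0 < n)%N ->
  normc (b n) <= C * n%:R ^+ K.

Definition convsum m t n : R[i] :=
  \sum_(1 <= j < n) itersum m a (n - j) * b j * natcpow j (- t).

Definition convsum' m t n : R[i] :=
  \sum_(1 <= j < n) itersum m a (n - j) * b j * npow_dif' 0 t j.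

Lemma convsumS m t n : convsum m.+1 t n.+1 = convsum m.+1 t n + convsum m t n.+1.
Proof.
rewrite /convsum; case: n => [|n]; first by rewrite !big_geq // addr0.
(* The added term [j = n.+1] contains the empty partial sum [itersum m.+1 a 0], so both sums may be
   taken over the same range. *)
have -> : \sum_(1 <= j < n.+1) itersum m.+1 a (n.+1 - j) * b j * natcpow j (- t) =
    \sum_(1 <= j < n.+2) itersum m.+1 a (n.+1 - j) * b j * natcpow j (- t).
  by rewrite [RHS]big_nat_recr //= subnn [\sum_(1 <= _ < 1) _]big_geq // !mul0r addr0.
rewrite -big_split /= big_nat [RHS]big_nat; apply: eq_bigr => j /andP[j0 jn].
rewrite -!mulrDl; congr (_ * _ * _).
by rewrite subSn // [LHS]big_nat_recr //=.
Qed.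

(** Summation in [n] passes through the convolution to the factor [a] alone; this is what brings the
    iterated sums of [a] into play. *)
Lemma convsum_itersum m t n : convsum m.+1 t n = \sum_(1 <= i < n.+1) convsum m t i.
Proof.
elim: n => [|n IH]; first by rewrite /convsum !big_geq.
by rewrite convsumS IH [RHS]big_nat_recr.
Qed.

Lemma abel_summation m s t n :
  \sum_(1 <= i < n.+1) convsum m t i * npow_dif m s i =
  \sum_(1 <= i < n.+1) convsum m.+1 t i * npow_dif m.+1 s i +
  convsum m.+1 t n * npow_dif m s n.+1.
Proof.
elim: n => [|n IH]; first by rewrite !big_geq // /convsum big_geq // mul0r addr0.
rewrite big_nat_recr //= IH [in RHS]big_nat_recr //= convsumS.
by rewrite /npow_dif /=; ring.
Qed.

Lemma sum_nat_le (F : nat -> R) (B : R) n : (forall j, (1 <= j < n)%N -> F j <= B) ->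
  0 <= B -> \sum_(1 <= j < n) F j <= n%:R * B.
Proof.
move=> FB B0; rewrite (le_trans (ler_sum_nat FB)) // sumr_const_nat -[leLHS]mulr_natl.
by rewrite ler_wpM2r // ler_nat leq_subr.
Qed.

(** There are fewer than [n] terms, each at most a constant times [n^(K + p) n^K n^tau]; here [tau]
    dominates both 0 and [- Re t], so that [j^(- Re t) <= n^tau]. *)
Lemma convsum_le p : exists2 C : R, 0 <= C & forall (tau : R) t n, (0 < n)%N ->
  0 <= tau -> - complex.Re t <= tau ->
  normc (convsum (2 * p) t n) <= C * rpow ((2 * K + p).+1%:R + tau) n%:R.
Proof.
have [Ca Ca0 HCa] := itersum_le p; have [Cb Cb0 HCb] := coef_le.
exists (Ca * Cb) => [|tau t n n0 tau0 ttau]; first exact: mulr_ge0.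
have n1 : 1 <= n%:R :> R by rewrite ler1n.
have nR : 0 < n%:R :> R by rewrite ltr0n.
apply: le_trans (normc_sum _ _ _) _.
have -> : Ca * Cb * rpow ((2 * K + p).+1%:R + tau) n%:R =
    n%:R * (Ca * n%:R ^+ (K + p) * (Cb * n%:R ^+ K) * rpow tau n%:R).
  rewrite rpowD rpow_nat // exprS (_ : (2 * K + p)%N = (K + p + K)%N) 1?exprD; last by lia.
  by ring.
apply: sum_nat_le => [j /andP[j0 jn]|]; last first.
  by rewrite !mulr_ge0 ?exprn_ge0 // ltW ?rpow_gt0.
have jR : 0 < j%:R :> R by rewrite ltr0n.
have jn' : j%:R <= n%:R :> R by rewrite ler_nat ltnW.
rewrite 2!normcM; apply: ler_pM; rewrite ?mulr_ge0 ?normc_ge0 //.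
  apply: ler_pM; rewrite ?normc_ge0 //.
    rewrite (le_trans (HCa _ _)) ?subn_gt0 // ler_wpM2l // lerXn2r ?nnegrE ?ler0n //.
    by rewrite ler_nat leq_subr.
  by rewrite (le_trans (HCb _ _)) // ler_wpM2l // lerXn2r ?nnegrE ?ler0n.
rewrite normc_cexp (_ : complex.Re _ = - complex.Re t * ln j%:R).
  rewrite ler_expR (le_trans (ler_wpM2r _ ttau)) ?ln_ge0 ?ler1n // ler_wpM2l //.
  by rewrite ler_ln ?posrE.
by case: t ttau => t1 t2 _; simpc => /=.
Qed.

Lemma npow_dif_le m s : exists2 C : R, 0 <= C & forall n, (0 < n)%N ->
  normc (npow_dif m s n) <= C * rpow (3 - complex.Re s - m%:R) n%:R.
Proof.
have [C C0 HC] := npow_dif_jet m (normc_ge0 s).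
by exists C => // n n0; have [] := HC s n (lexx _) n0.
Qed.

Lemma convsum_jet p (B : R) : 0 <= B -> exists2 C : R, 0 <= C &
  forall (tau : R) t n, (0 < n)%N -> 0 <= tau -> - complex.Re t <= tau -> normc t <= B ->
  jet (fun t => convsum (2 * p) t n) t (convsum' (2 * p) t n)
    (C * rpow ((2 * K + p).+1%:R + (tau + 3)) n%:R).
Proof.
move=> B0; have [Ca Ca0 HCa] := itersum_le p; have [Cb Cb0 HCb] := coef_le.
have [C C0 HC] := npow_dif_jet 0 B0.
exists (Ca * Cb * C) => [|tau t n n0 tau0 ttau tB]; first by rewrite !mulr_ge0.
have n1 : 1 <= n%:R :> R by rewrite ler1n.
have nR : 0 < n%:R :> R by rewrite ltr0n.
have J := @jet_sum R nat (index_iota 1 n) (fun j => itersum (2 * p) a (n - j) * b j)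
  (fun j t => npow_dif 0 t j) t (fun j => npow_dif' 0 t j)
  (fun j => C * rpow (3 - complex.Re t - 0%:R) j%:R).
apply: jet_le (J _) => [|j]; last first.
  by rewrite mem_index_iota => /andP[j0 _]; exact: HC.
have -> : Ca * Cb * C * rpow ((2 * K + p).+1%:R + (tau + 3)) n%:R =
    n%:R * (Ca * n%:R ^+ (K + p) * (Cb * n%:R ^+ K) * (C * rpow (tau + 3) n%:R)).
  rewrite (rpowD (2 * K + p).+1%:R (tau + 3)) (rpow_nat (2 * K + p).+1 nR).
  have -> : n%:R ^+ (2 * K + p).+1 = n%:R * n%:R ^+ (K + p) * n%:R ^+ K :> R.
    by rewrite -mulrA -exprD -exprS; congr (_ ^+ _); lia.
  by move: (rpow _ _) => w; ring.
apply: sum_nat_le => [j /andP[j0 jn]|]; last first.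
  by rewrite !mulr_ge0 ?exprn_ge0 // ltW ?rpow_gt0.
have jR : 0 < j%:R :> R by rewrite ltr0n.
have jn' : j%:R <= n%:R :> R by rewrite ler_nat ltnW.
rewrite normcM; apply: ler_pM; rewrite ?mulr_ge0 ?normc_ge0 ?(ltW (rpow_gt0 _ _)) //.
  apply: ler_pM; rewrite ?normc_ge0 //.
    rewrite (le_trans (HCa _ _)) ?subn_gt0 // ler_wpM2l // lerXn2r ?nnegrE ?ler0n //.
    by rewrite ler_nat leq_subr.
  by rewrite (le_trans (HCb _ _)) // ler_wpM2l // lerXn2r ?nnegrE ?ler0n.
rewrite ler_wpM2l // subr0 ler_expR.
apply: le_trans (_ : (tau + 3) * ln j%:R <= _).
  by rewrite ler_wpM2r ?ln_ge0 ?ler1n // addrC lerD2r.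
by rewrite ler_wpM2l ?addr_ge0 // ler_ln ?posrE.
Qed.

(** With remainders [e1] of [G] and [e2] of [F], the error is [F e1 + h2 q (h1 q' + e1) + e2 (G + h1
    q' + e1)]. As the increments are at most 1, it is bounded by [B B'] times
    [2 |h1|^2 + |h1| |h2| + 3 |h2|^2]. *)
Lemma jet_prod (F G : R[i] -> R[i]) t s q q' (B B' : R) h1 h2 :
  jet F t q B -> jet G s q' B' -> normc h1 <= 1 -> normc h2 <= 1 ->
  normc (F (t + h2) * G (s + h1) - F t * G s - (h1 * (F t * q') + h2 * (q * G s))) <=
  3 * (B * B') * (normc h1 + normc h2) ^+ 2.
Proof.
move=> JF JG h11 h21; have [F1 F2 F3] := JF; have [G1 G2 G3] := JG.
have B0 := jet_ge0 JF; have B'0 := jet_ge0 JG.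
have := F3 h2 h21; set e2 := F (t + h2) - F t - h2 * q => He2.
have := G3 h1 h11; set e1 := G (s + h1) - G s - h1 * q' => He1.
have -> : F (t + h2) * G (s + h1) - F t * G s - (h1 * (F t * q') + h2 * (q * G s)) =
  F t * e1 + h2 * q * (h1 * q' + e1) + e2 * (G s + h1 * q' + e1).
  rewrite /e1 /e2; move: (F (t + h2)) (G (s + h1)) (F t) (G s) => u v w z; ring.
move: (normc_ge0 h1) (normc_ge0 h2) => x0 y0.
have x2 : normc h1 ^+ 2 <= 1 by rewrite exprn_ile1.
have GG : normc (G s + h1 * q' + e1) <= 3 * B'.
  have -> : 3 * B' = B' + 1 * B' + B' * 1 by ring.
  rewrite (le_trans (le_normcD _ _)) // lerD //; last by rewrite (le_trans He1) // ler_wpM2l.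
  by rewrite (le_trans (le_normcD _ _)) // lerD // normcM ler_pM ?normc_ge0.
have H1 : normc (F t * e1) <= B * (B' * normc h1 ^+ 2).
  by rewrite normcM ler_pM ?normc_ge0.
have H2 : normc (h2 * q * (h1 * q' + e1)) <= normc h2 * B * (normc h1 * B') + 1 * B * (B' *
  normc h1 ^+ 2).
  rewrite mulrDr (le_trans (le_normcD _ _)) // lerD //.
    by rewrite 3!normcM !ler_pM ?mulr_ge0 ?normc_ge0.
  by rewrite 2!normcM !ler_pM ?mulr_ge0 ?normc_ge0.
have H3 : normc (e2 * (G s + h1 * q' + e1)) <= B * normc h2 ^+ 2 * (3 * B').
  by rewrite normcM ler_pM ?normc_ge0.
apply: le_trans (le_normcD _ _) _; apply: le_trans (lerD (le_normcD _ _) (lexx _)) _.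
apply: le_trans (lerD (lerD H1 H2) H3) _.
have BB : 0 <= B * B' by rewrite mulr_ge0.
have -> : 3 * (B * B') * (normc h1 + normc h2) ^+ 2 =
   B * (B' * normc h1 ^+ 2) + (normc h2 * B * (normc h1 * B') + 1 * B * (B' * normc h1 ^+ 2)) +
   B * normc h2 ^+ 2 * (3 * B') + B * B' * (normc h1 ^+ 2 + 5 * (normc h1 * normc h2)) by ring.
by rewrite lerDl mulr_ge0 // addr_ge0 ?exprn_ge0 ?mulr_ge0.
Qed.

Lemma rpowN2_sum_le N : \sum_(1 <= n < N) rpow (- 2) n%:R <= 2 :> R.
Proof.
case: N => [|[|N]]; [by rewrite big_geq|by rewrite big_geq|].
have E n : rpow (- 2) n.+1%:R = n.+1%:R ^- 2 :> R.
  by rewrite /rpow mulNr expRN expRM_natl lnK // posrE.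
(* The induction runs on a telescoping bound, since [(x + 1)^(-2) <= x^(-1) - (x + 1)^(-1)]. *)
suff H : \sum_(1 <= n < N.+2) rpow (- 2) n%:R <= 2 - N.+1%:R^-1 :> R.
  by apply: le_trans H _; rewrite gerBl invr_ge0.
elim: N => [|N IH]; first by rewrite big_nat1 E expr1n invr1; lra.
rewrite big_nat_recr //= E (le_trans (lerD IH (lexx _))) //.
have N0 : 0 < N.+1%:R :> R by rewrite ltr0n.
have -> : N.+2%:R = N.+1%:R + 1 :> R by rewrite -[in LHS]addn1 natrD.
move: (N.+1%:R : R) N0 => x x0.
have x10 : x + 1 != 0 by rewrite gt_eqF // ltr_wpDr.
rewrite -subr_ge0.
have -> : 2 - (x + 1)^-1 - (2 - x^-1 + (x + 1) ^- 2) = x^-1 * (x + 1) ^- 2.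
  by field; rewrite x10 gt_eqF.
by rewrite mulr_ge0 ?invr_ge0 ?exprn_ge0 ?addr_ge0 // ltW.
Qed.

Definition term p s t n : R[i] := convsum (2 * p) t n * npow_dif (2 * p) s n.

Definition continues p s t l := ctends (fun N => \sum_(1 <= n < N) term p s t n) l.

(* The constant makes [term p s t n] an [O(n ^ -2)], with room to spare for the factors
   [ln n] of the derivatives. *)
Definition admissible p s t := exists tau : R, [/\ 0 <= tau, - complex.Re t <= tau &
  (2 * K + 9)%:R + tau <= complex.Re s + p%:R].

Lemma admissible_leq p p' s t : (p <= p')%N -> admissible p s t -> admissible p' s t.
Proof.
move=> pp [tau [H1 H2 H3]]; exists tau; split => //.
by rewrite (le_trans H3) // lerD2l ler_nat.
Qed.

Lemma dominated_rpowN2 (u : nat -> R[i]) (C : R) : 0 <= C ->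
  (forall n, (0 < n)%N -> normc (u n) <= C * rpow (- 2) n%:R) ->
  exists l, ctends (fun N => \sum_(1 <= n < N) u n) l.
Proof.
move=> C0 H; apply: (dominated_series (M := fun n => C * rpow (- 2) n%:R) (B := C * 2) H).
by move=> N; rewrite -mulr_sumr ler_wpM2l // rpowN2_sum_le.
Qed.

Lemma continues_ex p s t : admissible p s t -> exists l, continues p s t l.
Proof.
move=> [tau [tau0 ttau H]].
have [C C0 HC] := convsum_le p; have [D D0 HD] := npow_dif_le (2 * p) s.
apply: (@dominated_rpowN2 _ (C * D)); first exact: mulr_ge0.
move=> n n0; rewrite normcM (le_trans (ler_pM _ _ (HC tau t n n0 tau0 ttau) (HD n n0)))
  ?normc_ge0 //.
rewrite mulrACA ler_wpM2l ?mulr_ge0 // -rpowD rpow_le ?ler1n //.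
move: H; rewrite -(addn1 (_ + p)%N) !natrD.
move: (K%:R : R) (p%:R : R) (complex.Re s) => k q x; lra.
Qed.

(** Two summations by parts lead from stage [p] to stage [p + 1]. Their boundary terms [r n] are
    [O(1 / n)], so the limit does not change. *)
Lemma continues_succ p s t l : admissible p s t -> continues p s t l ->
  continues p.+1 s t l.
Proof.
move=> [tau [tau0 ttau H]] cl.
have [C C0 HC] := convsum_le p.
have [D D0 HD] := npow_dif_le (2 * p) s.
have [D' D'0 HD'] := npow_dif_le (2 * p).+1 s.
have eq2 : (2 * p.+1 = (2 * p).+2)%N by rewrite mulnS.
pose rho := (2 * K + p).+1%:R + tau.
(* The next two iterated sums are bounded trivially, at the cost of one factor [n.+1] per summation;
   the margin in [admissible] pays for it. *)
have HC1 n : normc (convsum (2 * p).+1 t n) <= n.+1%:R * (C * rpow rho n.+1%:R).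
  rewrite convsum_itersum (le_trans (normc_sum _ _ _)) //.
  apply: sum_nat_le => [j /andP[j0 jn]|]; last by rewrite mulr_ge0 // ltW ?rpow_gt0.
  rewrite (le_trans (HC tau t j j0 tau0 ttau)) // ler_wpM2l // ler_expR.
  rewrite ler_wpM2l ?addr_ge0 ?ler0n // ler_ln ?posrE ?ltr0n //.
  by rewrite ler_nat ltnW.
have HC2 n : normc (convsum (2 * p).+2 t n) <= n.+1%:R * (n.+1%:R * (C * rpow rho n.+1%:R)).
  rewrite convsum_itersum (le_trans (normc_sum _ _ _)) //.
  apply: sum_nat_le => [j /andP[j0 jn]|]; last by rewrite !mulr_ge0 // ltW ?rpow_gt0.
  rewrite (le_trans (HC1 j)) // ler_pM ?mulr_ge0 ?(ltW (rpow_gt0 _ _)) // ?ler_nat //.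
  rewrite ler_wpM2l // ler_expR ler_wpM2l ?addr_ge0 ?ler0n // ler_ln ?posrE ?ltr0n //.
  by rewrite ler_nat.
pose r n := convsum (2 * p).+1 t n * npow_dif (2 * p) s n.+1 +
   convsum (2 * p).+2 t n * npow_dif (2 * p).+1 s n.+1.
have rE n : \sum_(1 <= i < n.+1) term p.+1 s t i =
    \sum_(1 <= i < n.+1) term p s t i - r n.
  by rewrite /term eq2 (abel_summation (2 * p)) (abel_summation (2 * p).+1) /r; ring.
have rle n : normc (r n) <= C * (D + D') / n.+1%:R.
  have N1 : 1 <= n.+1%:R :> R by rewrite ler1n.
  have N0 : 0 < n.+1%:R :> R by rewrite ltr0n.
  set Q := rpow (3 - complex.Re s - (2 * p)%:R) n.+1%:R.
  have expo : n.+1%:R * rpow rho n.+1%:R * Q <= n.+1%:R^-1 :> R.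
    rewrite -[X in X * rpow _ _]rpow1 // /Q -!rpowD.
    have -> : n.+1%:R^-1 = rpow (-1) n.+1%:R :> R by rewrite /rpow mulN1r expRN lnK ?posrE.
    rewrite rpow_le // /rho; move: H; rewrite -(addn1 (_ + p)%N) !natrD.
    move: (K%:R : R) (p%:R : R) (complex.Re s) => k q x; lra.
  have W0 : 0 <= rpow rho n.+1%:R by exact: ltW (rpow_gt0 _ _).
  rewrite mulrDr mulrDl (le_trans (le_normcD _ _)) // lerD // normcM.
    rewrite (le_trans (ler_pM _ _ (HC1 n) (HD n.+1 isT))) ?normc_ge0 //.
    have -> : n.+1%:R * (C * rpow rho n.+1%:R) * (D * Q) =
      C * D * (n.+1%:R * rpow rho n.+1%:R * Q) by ring.
    by rewrite ler_wpM2l ?mulr_ge0.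
  rewrite (le_trans (ler_pM _ _ (HC2 n) (HD' n.+1 isT))) ?normc_ge0 //.
  have -> : 3 - complex.Re s - (2 * p).+1%:R = -1 + (3 - complex.Re s - (2 * p)%:R) :> R.
    by rewrite -[(2 * p).+1]addn1 natrD; ring.
  have Nm : rpow (-1) n.+1%:R = n.+1%:R^-1 :> R by rewrite /rpow mulN1r expRN lnK ?posrE.
  rewrite (rpowD (-1)) Nm -/Q.
  have -> : n.+1%:R * (n.+1%:R * (C * rpow rho n.+1%:R)) * (D' * (n.+1%:R^-1 * Q)) =
      C * D' * (n.+1%:R * rpow rho n.+1%:R * Q).
    by field; rewrite gt_eqF.
  by rewrite ler_wpM2l ?mulr_ge0.
have rlim : ctends (fun N => r N.-1) 0.
  move=> e e0.
  have [N HN] : exists N : nat, C * (D + D') / e < N%:R.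
    exists (Num.bound (C * (D + D') / e)); apply: archi_boundP.
    by rewrite divr_ge0 ?mulr_ge0 ?addr_ge0 // ltW.
  exists N.+1 => -[//|n] Nn; rewrite subr0 /= (le_trans (rle n)) //.
  rewrite ler_pdivrMr ?ltr0n // [e * _]mulrC -ler_pdivrMr // (le_trans (ltW HN)) // ler_nat.
  by rewrite ltnW.
have := ctendsB cl rlim; rewrite subr0; apply: ctends_ext.
by exists 1%N => -[//|n] _ /=; rewrite rE.
Qed.

Lemma continues_leq p p' s t l : (p <= p')%N -> admissible p s t ->
  continues p s t l -> continues p' s t l.
Proof.
move=> pp adm cl; rewrite -(subnKC pp); elim: (p' - p)%N => [|d IH]; first by rewrite addn0.
by rewrite addnS; apply: continues_succ => //; apply: admissible_leq adm; rewrite leq_addr.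
Qed.

End Continuation.

(** * Differentiability on C^2 from a quadratic remainder *)

Section QuadraticRemainder.
Variable R : realType.

Definition pair_form (al be : R[i]) (q : R[i]^o * R[i]^o) : R[i]^o :=
  q.1 * al + q.2 * be.

Lemma pair_form_is_linear al be : linear (pair_form al be).
Proof.
move=> c [u1 u2] [v1 v2]; rewrite /pair_form /=.
change ((c * u1 + v1 : R[i]) * al + (c * u2 + v2) * be =
  c * (u1 * al + u2 * be) + (v1 * al + v2 * be)).
ring.
Qed.

HB.instance Definition _ al be :=
  GRing.isLinear.Build R[i] (R[i]^o * R[i]^o)%type R[i]^o *:%R (pair_form al be)
    (pair_form_is_linear al be).

Lemma pair_form_continuous al be : continuous (pair_form al be).
Proof.
move=> q; apply: cvgD; apply: cvgMl; [exact: cvg_fst | exact: cvg_snd].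
Qed.

Lemma pair_normE (q : R[i]^o * R[i]^o) :
  `|q| = (Num.max (normc q.1) (normc q.2))%:C.
Proof.
have H (x y : R) : Num.max x%:C y%:C = (Num.max x y)%:C :> R[i].
  by rewrite /Order.max ltcR; case: ifP.
rewrite prod_normE; exact: H.
Qed.

Lemma differentiable_quadratic (F : R[i]^o * R[i]^o -> R[i]^o) (p : R[i]^o * R[i]^o)
    (al be : R[i]) (C : R) :
  0 <= C ->
  (forall h1 h2 : R[i], normc h1 <= 1 -> normc h2 <= 1 ->
    normc (F (p.1 + h1, p.2 + h2) - F p - (h1 * al + h2 * be)) <=
    C * (normc h1 + normc h2) ^+ 2) ->
  differentiable F p.
Proof.
move=> C0 H.
have E : F \o shift p = cst (F p) + pair_form al be +o_ (0 : R[i]^o * R[i]^o) id.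
  apply/eqaddoP => e; rewrite ltcE /= => /andP[/eqP e1 e0].
  have D0 : 0 < 4 * C + 1 by rewrite ltr_wpDl ?mulr_ge0.
  (* Since [|h1| + |h2| <= 2 M] for the norm [M] of the increment, the remainder is at most
     [4 C M^2]; the added 1 keeps the denominator positive. *)
  pose d := Num.min 1 (complex.Re e / (4 * C + 1)).
  have d0 : 0 < d by rewrite lt_min ltr01 divr_gt0.
  have : 0 < d%:C by rewrite ltcE /= eqxx.
  move=> /(@nbhs0_lt R[i] (R[i]^o * R[i]^o)%type); apply: filterS => -[h1 h2].
  rewrite pair_normE ltcR => hd.
  have -> : e = (complex.Re e)%:C by case: e e1 {e0 d d0 hd} => x y /= ->.
  set M := Num.max _ _ in hd *.
  have h1M : normc h1 <= M by rewrite le_max lexx.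
  have h2M : normc h2 <= M by rewrite le_max lexx orbT.
  have M0 : 0 <= M := le_trans (normc_ge0 _) h1M.
  have Md : M <= d := ltW hd.
  have d1 : d <= 1 by rewrite ge_min lexx.
  have dC : d * (4 * C + 1) <= complex.Re e.
    by rewrite -ler_pdivlMr // ge_min lexx orbT.
  have eM : (complex.Re e)%:C * M%:C = (complex.Re e * M)%:C by rewrite rmorphM.
  rewrite /= eM.
  suff : normc (F ((h1, h2) + p) - (F p + (h1 * al + h2 * be))) <= complex.Re e * M.
    by rewrite -lecR.
  have := H h1 h2 (le_trans h1M (le_trans Md d1)) (le_trans h2M (le_trans Md d1)).
  have -> : (h1, h2) + p = (p.1 + h1, p.2 + h2) by rewrite [LHS]addrC; case: (p).
  rewrite [in X in _ -> X]opprD [in X in _ -> X]addrA.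
  move=> H'; apply: le_trans H' _.
  have S : (normc h1 + normc h2) ^+ 2 <= (M + M) ^+ 2.
    by rewrite lerXn2r ?nnegrE ?addr_ge0 ?normc_ge0 // lerD.
  apply: le_trans (ler_wpM2l C0 S) _.
  have -> : C * (M + M) ^+ 2 = (4 * C) * M * M by ring.
  rewrite ler_wpM2r // (le_trans _ dC) // mulrC ler_pM ?mulr_ge0 //.
  by rewrite lerDl.
have D := @diff_unique _ _ _ F (pair_form al be) p (@pair_form_continuous al be) E.
apply/diff_locallyP; rewrite D; split; first exact: pair_form_continuous.
exact: E.
Qed.

End QuadraticRemainder.

Section Entire.
Variable R : realType.
Variables (a b : nat -> R[i]) (K : nat).

Hypothesis itersum_le : forall p, exists2 C : R, 0 <= C & forall n, (0 < n)%N ->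
  normc (itersum (2 * p) a n) <= C * n%:R ^+ (K + p).
Hypothesis coef_le : exists2 C : R, 0 <= C & forall n, (0 < n)%N ->
  normc (b n) <= C * n%:R ^+ K.

(** A single stage [p] serves the whole closed unit polydisc around [(s, t)], so increments can be
    estimated inside one series. *)
Lemma admissible_nbhs (s t : R[i]) : exists p, forall h1 h2 : R[i],
  normc h1 <= 1 -> normc h2 <= 1 -> exists tau : R,
    [/\ 0 <= tau, - complex.Re (t + h2) <= tau &
     (2 * K + 11)%:R + tau <= complex.Re (s + h1) + p%:R].
Proof.
have := @archi_boundP R (normc s + normc t) (addr_ge0 (normc_ge0 _) (normc_ge0 _)).
set N := Num.bound _ => HN.
(* [N] exceeds [|s| + |t|]. The displacement of [s] and the 1 in [tau] cost one unit each, whence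
   [13 = 11 + 2]. *)
exists (2 * K + 13 + N)%N => h1 h2 h11 h21; exists (normc t + 1).
have := ler_Re_normc s; have := ler_Re_normc t; have := ler_Re_normc h1.
have := ler_Re_normc h2; rewrite !ler_norml => /andP[? ?] /andP[? ?] /andP[? ?] /andP[? ?].
have t0 := normc_ge0 t.
split; rewrite ?addr_ge0 //.
  by rewrite ReD; lra.
rewrite ReD !natrD; move: (N%:R : R) HN => M HM; lra.
Qed.

(** Two admissible stages have the same limit, namely that of the larger one, so one value at each
    point serves every [p]. *)
Lemma continuation_ex : exists F : R[i]^o * R[i]^o -> R[i]^o,
  forall s t p, admissible K p s t -> continues a b p s t (F (s, t)).
Proof.
have H (q : R[i]^o * R[i]^o) : exists l : R[i], forall p, admissible K p q.1 q.2 ->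
    continues a b p q.1 q.2 l.
  have [p0 Hp0] := admissible_nbhs q.1 q.2.
  have n0 : normc (0 : R[i]) <= 1 by rewrite normc0.
  have [tau [tau0 H1 H2]] := Hp0 0 0 n0 n0; rewrite !addr0 in H1 H2.
  have adm0 : admissible K p0 q.1 q.2.
    by exists tau; split => //; apply: le_trans H2; rewrite lerD2r ler_nat leq_add2l.
  have [l Hl] := continues_ex itersum_le coef_le adm0; exists l => p admp.
  have [l' Hl'] := continues_ex itersum_le coef_le admp.
  have E0 := continues_leq itersum_le coef_le (leq_maxl p0 p) adm0 Hl.
  have E1 := continues_leq itersum_le coef_le (leq_maxr p0 p) admp Hl'.
  by rewrite (ctends_unique E0 E1).
have [F HF] := choice H.
by exists F => s t p; exact: (HF (s, t) p).
Qed.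

(** The candidates [al] and [be] for the partial derivatives are the sums of the termwise
    derivatives. By [jet_prod] the error of each term is quadratic with a constant [O(n^(-2))],
    hence so is the error of the sum. *)
Lemma continuation_entire (F : R[i]^o * R[i]^o -> R[i]^o) :
  (forall s t p, admissible K p s t -> continues a b p s t (F (s, t))) -> entire2 F.
Proof.
move=> HF [s t].
have [p Hp] := admissible_nbhs s t.
have n0 : normc (0 : R[i]) <= 1 by rewrite normc0.
have [tau [tau0 H1 H2]] := Hp 0 0 n0 n0; rewrite !addr0 in H1 H2.
have [C C0 HC] := convsum_jet itersum_le coef_le p (normc_ge0 t).
have [D D0 HD] := npow_dif_jet (2 * p) (normc_ge0 s).
have expo n : (0 < n)%N ->
  rpow ((2 * K + p).+1%:R + (tau + 3)) n%:R * rpow (3 - complex.Re s - (2 * p)%:R) n%:R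
  <= rpow (- 2) n%:R.
  move=> n1; rewrite -rpowD rpow_le ?ler1n //.
  move: H2; rewrite -(addn1 (_ + p)%N) !natrD.
  move: (K%:R : R) (p%:R : R) (complex.Re s) => k q x; lra.
have W (x y : R) n : 0 <= x <= C * rpow ((2 * K + p).+1%:R + (tau + 3)) n%:R ->
    0 <= y <= D * rpow (3 - complex.Re s - (2 * p)%:R) n%:R -> (0 < n)%N ->
    x * y <= C * D * rpow (- 2) n%:R.
  move=> /andP[x0 xC] /andP[y0 yD] n1; apply: le_trans (ler_pM x0 y0 xC yD) _.
  by rewrite mulrACA ler_wpM2l ?mulr_ge0 ?expo.
have JC n : (0 < n)%N -> _ := fun n1 => HC tau t n n1 tau0 H1 (lexx _).
have JD n : (0 < n)%N -> _ := fun n1 => HD s n (lexx _) n1.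
have CD0 : 0 <= C * D by rewrite mulr_ge0.
have [al Hal] : exists l, ctends (fun N => \sum_(1 <= n < N)
    convsum a b (2 * p) t n * npow_dif' (2 * p) s n) l.
  apply: (dominated_rpowN2 CD0) => n n1; rewrite normcM.
  have [J1 _ _] := JC n n1; have [_ J2 _] := JD n n1.
  apply: W => //; apply/andP; split; [exact: normc_ge0|exact: J1|exact: normc_ge0|exact: J2].
have [be Hbe] : exists l, ctends (fun N => \sum_(1 <= n < N)
    convsum' a b (2 * p) t n * npow_dif (2 * p) s n) l.
  apply: (dominated_rpowN2 CD0) => n n1; rewrite normcM.
  have [_ J1 _] := JC n n1; have [J2 _ _] := JD n n1.
  apply: W => //; apply/andP; split; [exact: normc_ge0|exact: J1|exact: normc_ge0|exact: J2].
(* The 6 is the 3 of [jet_prod] times the bound 2 for the sum of [n^(-2)]. *)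
apply: (@differentiable_quadratic _ F (s, t) al be (6 * (C * D))).
  by rewrite mulr_ge0.
move=> h1 h2 h11 h21 /=.
have c0 : continues a b p s t (F (s, t)).
  apply: HF; exists tau; split => //; apply: le_trans H2.
  by rewrite lerD2r ler_nat leq_add2l.
have [tau' [tau'0 H1' H2']] := Hp h1 h2 h11 h21.
have c1 : continues a b p (s + h1) (t + h2) (F (s + h1, t + h2)).
  apply: HF; exists tau'; split => //; apply: le_trans H2'.
  by rewrite lerD2r ler_nat leq_add2l.
have := ctendsB (ctendsB c1 c0) (ctendsD (ctendsMl h1 Hal) (ctendsMl h2 Hbe)).
move/ctends_le; apply; exists 0%N => N _.
rewrite !mulr_sumr -big_split -!sumrB /= (le_trans (normc_sum _ _ _)) //.
have -> : 6 * (C * D) * (normc h1 + normc h2) ^+ 2 =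
  3 * (C * D) * (normc h1 + normc h2) ^+ 2 * 2 by ring.
have X0 : 0 <= (normc h1 + normc h2) ^+ 2 by rewrite exprn_ge0 ?addr_ge0 ?normc_ge0.
apply: le_trans (_ : 3 * (C * D) * (normc h1 + normc h2) ^+ 2 *
    \sum_(1 <= n < N) rpow (- 2) n%:R <= _); last first.
  apply: ler_wpM2l; last exact: rpowN2_sum_le.
  by rewrite mulr_ge0 // mulr_ge0.
rewrite mulr_sumr ler_sum_nat // => n /andP[n1 _].
apply: le_trans (jet_prod (JC n n1) (JD n n1) h11 h21) _.
rewrite [leRHS]mulrAC ler_wpM2r // -[leRHS]mulrA ler_wpM2l //.
by apply: W => //; rewrite lexx mulr_ge0 // ltW ?rpow_gt0.
Qed.

End Entire.

(** * Discrete groups and their cusps *)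

Section Matrices2.
Variable R : realType.
Implicit Types (A B M : 'M[R]_2) (a b c d x : R) (z w : R[i]).

Definition mx2 a b c d : 'M[R]_2 :=
  \matrix_(i, j) if i == 0 then if j == 0 then a else b
                 else if j == 0 then c else d.

Lemma mx2E a b c d : (mx2 a b c d 0 0 = a) * (mx2 a b c d 0 1 = b) *
  (mx2 a b c d 1 0 = c) * (mx2 a b c d 1 1 = d).
Proof. by rewrite !mxE. Qed.

Lemma ord2E (i : 'I_2) : i = 0 \/ i = 1.
Proof. by case: i => [[|[|//]] ?]; [left|right]; exact: val_inj. Qed.

Lemma mx2_eta A : A = mx2 (A 0 0) (A 0 1) (A 1 0) (A 1 1).
Proof.
apply/matrixP => i j; rewrite mxE.
by case: (ord2E i) => ->; case: (ord2E j) => ->.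
Qed.

Lemma mx2_inj a b c d a' b' c' d' : mx2 a b c d = mx2 a' b' c' d' ->
  [/\ a = a', b = b', c = c' & d = d'].
Proof.
move=> /matrixP E; split.
- by have := E 0 0; rewrite !mx2E.
- by have := E 0 1; rewrite !mx2E.
- by have := E 1 0; rewrite !mx2E.
- by have := E 1 1; rewrite !mx2E.
Qed.

Lemma mul_mx2 a b c d a' b' c' d' : mx2 a b c d *m mx2 a' b' c' d' =
  mx2 (a * a' + b * c') (a * b' + b * d') (c * a' + d * c') (c * b' + d * d').
Proof.
rewrite [LHS]mx2_eta; congr mx2; rewrite !mxE !big_ord_recl big_ord0 addr0 !mxE //=.
Qed.

Lemma det_mx2 a b c d : \det (mx2 a b c d) = a * d - b * c.
Proof.
rewrite (expand_det_row _ 0) !big_ord_recl big_ord0 addr0 /cofactor !det_mx11 !mxE /=.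
by rewrite /= expr0 expr1 mul1r mulN1r mulrN.
Qed.

Lemma mx2_1 : 1%:M = mx2 1 0 0 1.
Proof. by rewrite [LHS]mx2_eta !mxE. Qed.

Lemma mx2_N a b c d : - mx2 a b c d = mx2 (- a) (- b) (- c) (- d).
Proof. by rewrite [LHS]mx2_eta !mxE. Qed.

Lemma trace_mx2 a b c d : \tr (mx2 a b c d) = a + d.
Proof. by rewrite /mxtrace !big_ord_recl big_ord0 addr0 !mxE. Qed.

Lemma SL2_mx2 a b c d : @SL2 R (mx2 a b c d) <-> a * d - b * c = 1.
Proof. by rewrite /SL2 /= det_mx2. Qed.

Lemma SL2_det A : SL2 A -> A 0 0 * A 1 1 - A 0 1 * A 1 0 = 1.
Proof. by rewrite {1}[A]mx2_eta => /SL2_mx2. Qed.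

Lemma SL2_mul A B : SL2 A -> SL2 B -> SL2 (A *m B).
Proof. by rewrite /SL2 /= det_mulmx => -> ->; rewrite mulr1. Qed.

Lemma SL2_unit A : SL2 A -> A \in unitmx.
Proof. by rewrite /SL2 /= unitmxE => ->; rewrite unitr1. Qed.

Lemma SL2_inv A : SL2 A -> SL2 (invmx A).
Proof. by rewrite /SL2 /= det_inv => ->; rewrite invr1. Qed.

Lemma SL2_1 : @SL2 R 1%:M. Proof. by rewrite /SL2 /= det1. Qed.

Lemma invmx2 A : SL2 A -> invmx A = mx2 (A 1 1) (- A 0 1) (- A 1 0) (A 0 0).
Proof.
move=> S; have D := SL2_det S; have U := SL2_unit S.
suff E : mx2 (A 1 1) (- A 0 1) (- A 1 0) (A 0 0) *m A = 1%:M.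
  by rewrite -[RHS]mulmx1 -(mulmxV U) mulmxA E mul1mx.
rewrite {5}[A]mx2_eta mul_mx2 mx2_1; congr mx2; rewrite -?D; ring.
Qed.

Lemma mulmx2E A B : A *m B =
  mx2 (A 0 0 * B 0 0 + A 0 1 * B 1 0) (A 0 0 * B 0 1 + A 0 1 * B 1 1)
      (A 1 0 * B 0 0 + A 1 1 * B 1 0) (A 1 0 * B 0 1 + A 1 1 * B 1 1).
Proof. by rewrite {1}[A]mx2_eta {1}[B]mx2_eta mul_mx2. Qed.

Lemma automorphy_Im A z : complex.Im (automorphy A z) = A 1 0 * complex.Im z.
Proof. by case: z => x y; rewrite /automorphy; simpc. Qed.

Lemma automorphy_Re A z :
  complex.Re (automorphy A z) = A 1 0 * complex.Re z + A 1 1.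
Proof. by case: z => x y; rewrite /automorphy; simpc. Qed.

Lemma normc_automorphy A z : normc (automorphy A z) ^+ 2 =
  (A 1 0 * complex.Re z + A 1 1) ^+ 2 + (A 1 0 * complex.Im z) ^+ 2.
Proof. by rewrite normc_sq automorphy_Im automorphy_Re. Qed.

Lemma automorphy_neq0 A z : SL2 A -> 0 < complex.Im z -> automorphy A z != 0.
Proof.
move=> S z0; apply/eqP => E.
have := automorphy_Im A z; rewrite E /= => /esym/eqP.
rewrite mulf_eq0 (gt_eqF z0) orbF => /eqP c0.
have := automorphy_Re A z; rewrite E /= c0 mul0r add0r => d0.
by have := SL2_det S; rewrite c0 -d0 !mulr0 subrr => /eqP; rewrite eq_sym oner_eq0.
Qed.

Lemma mobiusK A z : SL2 A -> 0 < complex.Im z ->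
  mobius A z * automorphy A z = (A 0 0)%:C * z + (A 0 1)%:C.
Proof. by move=> S z0; rewrite /mobius divfK // automorphy_neq0. Qed.

Lemma automorphyM A B z : SL2 B -> 0 < complex.Im z ->
  automorphy (A *m B) z = automorphy A (mobius B z) * automorphy B z.
Proof.
move=> SB z0; rewrite [automorphy A _]/automorphy mulrDl -mulrA mobiusK //.
rewrite /automorphy mulmx2E !mx2E !rmorphD !rmorphM /=; ring.
Qed.

Lemma mobiusM A B z : SL2 A -> SL2 B -> 0 < complex.Im z ->
  0 < complex.Im (mobius B z) -> mobius (A *m B) z = mobius A (mobius B z).
Proof.
move=> SA SB z0 Bz0; have SAB := SL2_mul SA SB.
apply: (mulIf (automorphy_neq0 SAB z0)); rewrite mobiusK // automorphyM //.
rewrite mulrA mobiusK // mulrDl -mulrA mobiusK //.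
rewrite /automorphy mulmx2E !mx2E !rmorphD !rmorphM /=; ring.
Qed.

Lemma mobius1 z : mobius 1%:M z = z.
Proof. by rewrite /mobius /automorphy mx2_1 !mx2E mul1r mul0r addr0 add0r divr1. Qed.

Lemma Im_mobius A z : SL2 A -> 0 < complex.Im z ->
  complex.Im (mobius A z) = complex.Im z / normc (automorphy A z) ^+ 2.
Proof.
move=> S z0; have j0 := automorphy_neq0 S z0.
have n0 : normc (automorphy A z) ^+ 2 != 0.
  by rewrite expf_neq0 //; apply: contra_neq j0; exact: eq0_normc.
apply: (mulIf n0); rewrite divfK //.
have Emul w' (u : R) : complex.Im w' * u = complex.Im (w' * u%:C).
  by case: w' => p q; simpc.
rewrite Emul.
have -> : (normc (automorphy A z) ^+ 2)%:C = automorphy A z * conjc (automorphy A z).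
  by rewrite normc_sq; case: (automorphy A z) => p q; simpc; rewrite !expr2 [q * p]mulrC addNr.
rewrite mulrA /mobius divfK //.
have D := SL2_det S.
rewrite /automorphy; case: z {j0 n0 z0} => x y; simpc => /=.
rewrite -[RHS]mul1r -D; ring.
Qed.

Lemma Im_mobius_gt0 A z : SL2 A -> 0 < complex.Im z -> 0 < complex.Im (mobius A z).
Proof.
move=> S z0; rewrite Im_mobius // divr_gt0 // exprn_gt0 // lt_neqAle normc_ge0 andbT eq_sym.
by apply: contra_neq (automorphy_neq0 S z0); exact: eq0_normc.
Qed.

End Matrices2.

Section Discrete.
Variable R : realType.
Implicit Types (A B M : 'M[R]_2) (x y : R) (G : set 'M[R]_2).

(** The sum of the entries in absolute value is submultiplicative, unlike the maximum norm behind
    the topology of matrices; [nbhs_mnormP] compares the two. *)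
Definition mnorm A : R := `|A 0 0| + `|A 0 1| + (`|A 1 0| + `|A 1 1|).

Lemma mnorm_ge0 A : 0 <= mnorm A. Proof. by rewrite !addr_ge0. Qed.

Lemma mnormD A B : mnorm (A + B) <= mnorm A + mnorm B.
Proof.
rewrite /mnorm !mxE; have := ler_normD (A 0 0) (B 0 0).
have := ler_normD (A 0 1) (B 0 1); have := ler_normD (A 1 0) (B 1 0).
have := ler_normD (A 1 1) (B 1 1); lra.
Qed.

Lemma mnormN A : mnorm (- A) = mnorm A.
Proof. by rewrite /mnorm !mxE !normrN. Qed.

Lemma mnormM A B : mnorm (A *m B) <= mnorm A * mnorm B.
Proof.
rewrite mulmx2E /mnorm !mx2E.
have H (a b c d : R) : `|a * b + c * d| <= `|a| * `|b| + `|c| * `|d|.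
  by rewrite -!normrM ler_normD.
apply: le_trans (lerD (lerD (H _ _ _ _) (H _ _ _ _)) (lerD (H _ _ _ _) (H _ _ _ _))) _.
have P (a b : R) : 0 <= `|a| * `|b| by rewrite mulr_ge0.
have := P (A 0 0) (B 1 0); have := P (A 0 0) (B 1 1).
have := P (A 0 1) (B 0 0); have := P (A 0 1) (B 0 1).
have := P (A 1 0) (B 1 0); have := P (A 1 0) (B 1 1).
have := P (A 1 1) (B 0 0); have := P (A 1 1) (B 0 1); lra.
Qed.

Lemma mnorm_entry A (i j : 'I_2) : `|A i j| <= mnorm A.
Proof.
rewrite /mnorm; case: (ord2E i) => ->; case: (ord2E j) => ->;
have := normr_ge0 (A 0 0); have := normr_ge0 (A 0 1);
have := normr_ge0 (A 1 0); have := normr_ge0 (A 1 1); lra.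
Qed.

Lemma mnorm_le A (e : R) : (forall i j, `|A i j| <= e) -> mnorm A <= 4 * e.
Proof.
move=> H; rewrite /mnorm; have := H 0 0; have := H 0 1; have := H 1 0.
by have := H 1 1; lra.
Qed.

Lemma nbhs_mnormP A (V : set 'M[R]_2) :
  nbhs A V <-> exists2 e : R, 0 < e & forall B, mnorm (B - A) < e -> V B.
Proof.
split.
  move=> /nbhs_ballP[e e0 eV]; exists e => // B Be; apply: eV; split => // i j.
  rewrite /ball /= distrC; have := mnorm_entry (B - A) i j.
  by rewrite !mxE => /le_lt_trans; apply.
move=> [e e0 eV]; apply/nbhs_ballP; exists (e / 8); first by rewrite /= divr_gt0.
move=> B [_ AB]; apply: eV.
apply: le_lt_trans (_ : 4 * (e / 8) < e); last by lra.
apply: mnorm_le => i j; rewrite !mxE distrC ltW //; exact: AB.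
Qed.

Lemma discrete_near1 G : discrete_subgroup G -> exists2 e : R, 0 < e &
  forall A, G A -> mnorm (A - 1%:M) < e -> A = 1%:M.
Proof.
move=> [[_ G1 _ _] /(_ _ G1)[_ [V /nbhs_mnormP[e e0 eV] VG]]]; exists e => // A GA Ae.
have : (V `&` G) A by split => //; exact: eV.
by rewrite VG.
Qed.

Lemma mnorm_conj_lt (S : 'M[R]_2) A (e : R) : SL2 S ->
  mnorm (invmx S *m A *m S - 1%:M) < e / (mnorm S * mnorm (invmx S) + 1) ->
  mnorm (A - 1%:M) < e.
Proof.
move=> SS H; have U := SL2_unit SS.
have -> : A - 1%:M = S *m (invmx S *m A *m S - 1%:M) *m invmx S.
  by rewrite mulmxBr mulmxBl mulmx1 !mulmxA mulmxV // mul1mx -mulmxA mulmxV // mulmx1.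
apply: le_lt_trans (mnormM _ _) _.
have P0 : 0 < mnorm S * mnorm (invmx S) + 1.
  by rewrite ltr_wpDl // mulr_ge0 ?mnorm_ge0.
move: H; rewrite ltr_pdivlMr //; apply: le_lt_trans.
apply: le_trans (ler_wpM2r (mnorm_ge0 _) (mnormM _ _)) _.
rewrite mulrAC mulrC ler_wpM2l ?mnorm_ge0 //.
by rewrite lerDl.
Qed.

Lemma discrete_conj_near1 G (S : 'M[R]_2) : discrete_subgroup G -> SL2 S ->
  exists2 e : R, 0 < e &
    forall A, G A -> mnorm (invmx S *m A *m S - 1%:M) < e -> A = 1%:M.
Proof.
move=> dG SS; have [e e0 He] := discrete_near1 dG.
have P0 : 0 < mnorm S * mnorm (invmx S) + 1.
  by rewrite ltr_wpDl // mulr_ge0 ?mnorm_ge0.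
exists (e / (mnorm S * mnorm (invmx S) + 1)); first by rewrite divr_gt0.
by move=> A GA /(mnorm_conj_lt SS); exact: He.
Qed.

Lemma real_discrete_subgroup (D : set R) (e : R) : 0 < e -> D 0 ->
  (forall s t, D s -> D t -> D (s - t)) ->
  (forall t, D t -> `|t| < e -> t = 0) -> (exists2 t, D t & t != 0) ->
  exists2 rho : R, 0 < rho & forall t, D t <-> exists n : int, t = n%:~R * rho.
Proof.
move=> e0 D0 DB De [t0 Dt0 t0n].
have DN t : D t -> D (- t) by move=> Dt; rewrite -[- t]add0r; exact: DB.
pose P := [set t | D t /\ 0 < t].
have hP : has_inf P.
  split; last by exists 0 => t [_ /ltW].
  have [t_gt0|t_le0] := ltP 0 t0; first by exists t0.
  by exists (- t0); split; [exact: DN|rewrite oppr_gt0 lt_neqAle t0n].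
(* A positive element within [e] of the infimum is already the least one: a smaller [t] would put
   the nonzero [rho - t] below [e]. *)
have [rho [Drho rho0] rholt] := inf_adherent e0 hP.
have minr t : D t -> 0 < t -> rho <= t.
  move=> Dt t_gt0; rewrite leNgt; apply/negP => trho.
  have it : inf P <= t by apply: ge_inf => //; exact: hP.2.
  have /De : D (rho - t) by exact: DB.
  have dpos : 0 < rho - t by rewrite subr_gt0.
  rewrite gtr0_norm // => H; move: dpos; rewrite H ?ltxx //; lra.
have DM (n : nat) : D (n%:R * rho).
  elim: n => [|n IH]; first by rewrite mul0r.
  by rewrite -addn1 natrD mulrDl mul1r -[rho in X in _ + X]opprK; apply: DB => //; exact: DN.
have DZ (n : int) : D (n%:~R * rho).
  case: n => n; first by rewrite -pmulrn.
  by rewrite NegzE mulrNz -pmulrn mulNr; apply: DN.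
exists rho => // t; split => [Dt|[n ->]]; last exact: DZ.
exists (Num.floor (t / rho)); set n := Num.floor _.
have /andP[n1 n2] := floor_itv (t / rho); rewrite -/n in n1 n2.
have Dd : D (t - n%:~R * rho) by exact: DB.
have d1 : t - n%:~R * rho < rho.
  by rewrite ltrBlDr -[X in X + _]mul1r -mulrDl addrC -ltr_pdivrMr //; move: n2; rewrite intrD.
have d0 : 0 <= t - n%:~R * rho by rewrite subr_ge0 -ler_pdivlMr.
have [dn|] := eqVneq (t - n%:~R * rho) 0; first by apply/eqP; rewrite -subr_eq0 dn.
move=> dn; have := minr _ Dd; rewrite lt_neqAle eq_sym dn d0 => /(_ isT).
by rewrite leNgt d1.
Qed.

End Discrete.

(** * Finite cusps, their widths and scaling matrices *)

Section RealCusp.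
Variable R : realType.
Implicit Types (A B M : 'M[R]_2) (x y t : R) (G : set 'M[R]_2) (z w : R[i]).

Definition transl x : 'M[R]_2 := mx2 1 x 0 1.

(** The coordinate change that moves the boundary point [x] to 0. The entry [0 1] vanishes exactly
    when [A] fixes [x], and the entry [1 1] is the automorphy factor [A 1 0 * x + A 1 1] at [x]. *)
Definition recenter x A : 'M[R]_2 := invmx (transl x) *m A *m transl x.

Definition lowtri t : 'M[R]_2 := mx2 1 0 t 1.

Lemma SL2_transl x : SL2 (transl x).
Proof. by apply/SL2_mx2; ring. Qed.

Lemma recenterE x A : recenter x A =
  mx2 (A 0 0 - x * A 1 0) (A 0 0 * x + A 0 1 - x * (A 1 0 * x + A 1 1))
      (A 1 0) (A 1 0 * x + A 1 1).
Proof.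
rewrite /recenter (invmx2 (SL2_transl x)) /transl !mx2E [A in LHS]mx2_eta !mul_mx2.
by congr mx2; ring.
Qed.

Lemma recenterM x A B : recenter x (A *m B) = recenter x A *m recenter x B.
Proof.
rewrite /recenter !mulmxA; congr (_ *m _); rewrite -!mulmxA; congr (_ *m _).
by rewrite [transl x *m _]mulmxA mulmxV ?SL2_unit ?mul1mx //; exact: SL2_transl.
Qed.

Lemma recenter1 x : recenter x 1%:M = 1%:M.
Proof. by rewrite /recenter mulmx1 mulVmx // SL2_unit //; exact: SL2_transl. Qed.

Lemma recenterV x A : SL2 A -> recenter x (invmx A) = invmx (recenter x A).
Proof.
move=> SA; have U : recenter x A \in unitmx.
  by apply: SL2_unit; rewrite /recenter; do 2?apply: SL2_mul => //;
    [apply: SL2_inv|]; exact: SL2_transl.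
by rewrite -[LHS]mulmx1 -(mulmxV U) mulmxA -recenterM mulVmx ?SL2_unit // recenter1 mul1mx.
Qed.

Lemma SL2_recenter x A : SL2 A -> SL2 (recenter x A).
Proof.
by move=> SA; do 2?apply: SL2_mul => //; [apply: SL2_inv|]; exact: SL2_transl.
Qed.

Lemma recenter_inj x A B : recenter x A = recenter x B -> A = B.
Proof.
have U := SL2_unit (SL2_transl x).
move=> E; have : transl x *m recenter x A *m invmx (transl x) =
  transl x *m recenter x B *m invmx (transl x) by rewrite E.
by rewrite /recenter !mulmxA !mulmxV // !mul1mx -!mulmxA !mulmxV // !mulmx1.
Qed.

Lemma lowtriD s t : lowtri s *m lowtri t = lowtri (s + t).
Proof. by rewrite mul_mx2; congr mx2; ring. Qed.

Lemma lowtri0 : lowtri 0 = 1%:M. Proof. by rewrite mx2_1. Qed.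

Lemma mnorm_lowtri t : mnorm (lowtri t - 1%:M) = `|t|.
Proof. by rewrite mx2_1 /mnorm !mxE /= !subrr subr0 normr0; ring. Qed.

Lemma invmx_lowtri t : invmx (lowtri t) = lowtri (- t).
Proof.
rewrite invmx2; last by apply/SL2_mx2; ring.
by rewrite !mx2E oppr0.
Qed.

Lemma boundary_fixP x A : SL2 A ->
  boundary_act A (Some x) = Some x <-> recenter x A 0 1 = 0.
Proof.
move=> SA; have D := SL2_det (SL2_recenter x SA).
rewrite recenterE !mx2E in D *; rewrite /boundary_act.
case: eqP => [d0|/eqP d0]; split=> //.
- by move: D => /[swap] ->; rewrite mul0r subr0 d0 mulr0 => /eqP; rewrite eq_sym oner_eq0.
- by move=> [E]; rewrite -[X in X - _](divfK d0) E subrr.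
- by move=> /subr0_eq ->; rewrite mulfK.
Qed.

(* Otherwise the conjugates of [Q] by the powers of [A] (or of its inverse) accumulate
   at [1]. *)
Lemma lowtri_diag_sq G x A Q (t : R) : discrete_subgroup G -> G A -> G Q ->
  recenter x A 0 1 = 0 -> recenter x Q = lowtri t -> t != 0 ->
  recenter x A 1 1 ^+ 2 = 1.
Proof.
move=> dG GA GQ A01 EQ t0; have [[GS G1 GM GV] _] := dG.
have [e e0 He] := discrete_conj_near1 dG (SL2_transl x).
suff key B : G B -> recenter x B 0 1 = 0 -> ~ (recenter x B 1 1 ^+ 2 < 1).
  have SA := GS _ GA; have D := SL2_det (SL2_recenter x SA).
  rewrite A01 mul0r subr0 in D.
  apply/eqP; rewrite eq_le !leNgt; apply/andP; split; apply/negP => H; last exact: key H.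
  have EI : recenter x (invmx A) = mx2 (recenter x A 1 1) (- recenter x A 0 1)
      (- recenter x A 1 0) (recenter x A 0 0).
    by rewrite recenterV // invmx2 //; exact: SL2_recenter.
  apply: (key (invmx A) (GV _ GA)); rewrite EI !mx2E; first by rewrite A01 oppr0.
  have l0 : recenter x A 1 1 != 0.
    by apply: contraTneq H => ->; rewrite expr0n /= ltr10.
  have -> : recenter x A 0 0 = (recenter x A 1 1)^-1.
    by apply: (mulIf l0); rewrite D mulVf.
  by rewrite exprVn invf_lt1 // exprn_even_gt0.
move=> GB B01 Blt.
have SB := GS _ GB; have D := SL2_det (SL2_recenter x SB).
set l := recenter x B 1 1 in Blt D; rewrite B01 mul0r subr0 in D.
have l0 : l != 0 by apply: contra_eq_neq D => ->; rewrite mulr0 eq_sym oner_eq0.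
have [p [q [EB EI pl]]] : exists p q, [/\ recenter x B = mx2 p 0 q l,
    recenter x (invmx B) = mx2 l 0 (- q) p & p * l = 1].
  exists (recenter x B 0 0), (recenter x B 1 0); split => //.
    by rewrite [LHS]mx2_eta B01.
  by rewrite recenterV // invmx2 ?B01 ?oppr0 //; exact: SL2_recenter.
(* Conjugation by [B] multiplies the lower left entry by [l ^ 2], which is less than 1. *)
have conjB (n : nat) : exists2 M, G M & recenter x M = lowtri (t * (l ^+ 2) ^+ n).
  elim: n => [|n [M GM' EM]]; first by exists Q; rewrite // expr0 mulr1.
  exists (B *m M *m invmx B); first exact: GM (GM _ _ GB GM') (GV _ GB).
  rewrite (recenterM x (B *m M)) (recenterM x B) EM EI EB !mul_mx2.
  congr mx2.
  - by ring: pl.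
  - by ring.
  - by rewrite [_ ^+ n.+1]exprS; move: ((l ^+ 2) ^+ n) => w; ring.
  - by ring: pl.
have l2 : 0 <= l ^+ 2 < 1 by rewrite sqr_ge0.
have nt0 : 0 < `|t| by rewrite normr_gt0.
have [N /(_ N (leqnn N)) HN] := expr_small l2 (divr_gt0 e0 (mulr_gt0 (ltr0n R 2) nt0)).
have [M GM' EM] := conjB N.
have M1 : M = 1%:M.
  apply: He => //; rewrite -/(recenter x M) EM mnorm_lowtri.
  have w0 : 0 <= (l ^+ 2) ^+ N by apply: exprn_ge0; exact: sqr_ge0.
  rewrite normrM (ger0_norm w0).
  apply: le_lt_trans (ler_wpM2l (normr_ge0 _) HN) _.
  have -> : `|t| * (e / (2 * `|t|)) = e / 2 by field; exact: lt0r_neq0.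
  by rewrite ltr_pdivrMr // mulr_natr mulr2n ltrDl.
move: EM; rewrite M1 recenter1 mx2_1 => /mx2_inj[_ _ /esym/eqP].
by rewrite mulf_eq0 (negPf t0) /= !expf_eq0 (negPf l0) !andbF.
Qed.

(** The sign is invisible on the upper half plane, but [- A] need not belong to the group along with
    [A]; so both signs are carried along. *)
Definition pm_lowtri x A t :=
  recenter x A = lowtri t \/ recenter x A = - lowtri t.

Lemma pm_lowtriB x A B s t : SL2 B -> pm_lowtri x A s -> pm_lowtri x B t ->
  pm_lowtri x (A *m invmx B) (s - t).
Proof.
move=> SB HA HB; rewrite /pm_lowtri recenterM recenterV //.
have HBI : invmx (recenter x B) = lowtri (- t) \/ invmx (recenter x B) = - lowtri (- t).
  case: HB => ->; first by left; rewrite invmx_lowtri.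
  right; rewrite mx2_N invmx2; last by apply/SL2_mx2; ring.
  by rewrite !mx2E /lowtri mx2_N; congr mx2; ring.
case: HA => ->; case: HBI => ->; rewrite ?mulmxN ?mulNmx ?opprK lowtriD; tauto.
Qed.

(** Squaring a parabolic element removes the sign of its trace. In the recentered coordinate it has
    diagonal [l, l] with [l^2 = 1] and lower left entry [q], so its square has lower left entry
    [2 l q]. *)
Lemma cusp_parabolic G x : discrete_subgroup G -> cusp G (Some x) ->
  exists Q t, [/\ G Q, recenter x Q = lowtri t & t != 0].
Proof.
move=> [[GS G1 GM GV] _] [P [GP [SP trP P1 PN1] fP]].
exists (P *m P); have /(boundary_fixP x SP) P01 := fP.
have D := SL2_det (SL2_recenter x SP); rewrite P01 mul0r subr0 in D.
have trE : recenter x P 0 0 + recenter x P 1 1 = \tr P.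
  by rewrite recenterE !mx2E [in RHS](mx2_eta P) trace_mx2; ring.
have EP : recenter x P = mx2 (recenter x P 0 0) 0 (recenter x P 1 0) (recenter x P 1 1).
  by rewrite [LHS]mx2_eta P01.
move: (recenter x P 0 0) (recenter x P 1 0) (recenter x P 1 1) EP D trE => p q l EP D trE.
have tr2 : (p + l) ^+ 2 = 4.
  by rewrite trE -real_normK ?num_real // trP; ring.
have pl : p = l by apply/eqP; rewrite -subr_eq0 -sqrf_eq0; apply/eqP; nra.
have l1 : l * l = 1 by rewrite -{1}pl.
exists (2 * l * q); split; first exact: GM.
- rewrite recenterM EP pl mul_mx2; congr mx2; rewrite ?mulr0 ?mul0r ?addr0 ?add0r //.
  by ring.
- apply/negP => /eqP E; have q0 : q = 0.
    have lq : l * q = 0 by lra.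
    by rewrite -[q]mul1r -l1 -mulrA lq mulr0.
  have /eqP : (l - 1) * (l + 1) = 0 by ring: l1.
  rewrite mulf_eq0 subr_eq0 addr_eq0 => /orP[] /eqP ll.
    by apply: P1; apply: (@recenter_inj x); rewrite recenter1 EP pl q0 ll mx2_1.
  apply: PN1; apply: (@recenter_inj x).
  by rewrite EP /recenter mulmxN mulNmx -/(recenter x 1%:M) recenter1 mx2_1 mx2_N pl q0 ll oppr0.
Qed.

Lemma cusp_width G x : discrete_subgroup G -> cusp G (Some x) ->
  exists2 rho : R, 0 < rho &
    (forall A, G A -> recenter x A 0 1 = 0 ->
      exists n : int, pm_lowtri x A (n%:~R * rho)) /\
    (forall n : int, exists2 A, G A & pm_lowtri x A (n%:~R * rho)).
Proof.
move=> dG cG; have [Q [t [GQ EQ t0]]] := cusp_parabolic dG cG.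
have [[GS G1 GM GV] _] := dG.
have [e e0 He] := discrete_conj_near1 dG (SL2_transl x).
pose D := [set t | exists2 A, G A & pm_lowtri x A t].
(* Again by squaring: whatever the sign, [A *m A] recenters to [lowtri (s + s)], whence the radius
   [e / 2]. *)
have Dmin s : D s -> `|s| < e / 2 -> s = 0.
  move=> [A GA HA] se.
  have EAA : recenter x (A *m A) = lowtri (s + s).
    by rewrite recenterM; case: HA => ->; rewrite ?mulmxN ?mulNmx ?opprK lowtriD.
  have AA1 : A *m A = 1%:M.
    apply: He; first exact: GM.
    rewrite -/(recenter x _) EAA mnorm_lowtri (le_lt_trans (ler_normD _ _)) //.
    by move: (`|s|) se => u se; lra.
  move: EAA; rewrite AA1 recenter1 mx2_1 => /mx2_inj[_ _ ? _]; lra.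
have D0 : D 0 by exists 1%:M => //; left; rewrite recenter1 lowtri0.
have DB s u : D s -> D u -> D (s - u).
  move=> [A GA HA] [B GB HB]; exists (A *m invmx B); first by apply: GM => //; exact: GV.
  exact: pm_lowtriB (GS _ GB) HA HB.
have e20 : 0 < e / 2 by rewrite divr_gt0.
have [rho rho0 Hrho] := real_discrete_subgroup e20 D0 DB Dmin
  (ex_intro2 _ _ t (ex_intro2 _ _ Q GQ (or_introl EQ)) t0).
exists rho => //; split => [A GA A01|n]; last by apply/Hrho; exists n.
(* An element fixing the cusp cannot be hyperbolic, so it is unipotent up to sign and belongs to the
   cyclic group just found. *)
have l2 := lowtri_diag_sq dG GA GQ A01 EQ t0.
have SA := GS _ GA; have Dt := SL2_det (SL2_recenter x SA).
rewrite A01 mul0r subr0 in Dt.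
have EA : recenter x A = mx2 (recenter x A 0 0) 0 (recenter x A 1 0) (recenter x A 1 1).
  by rewrite [LHS]mx2_eta A01.
move: (recenter x A 0 0) (recenter x A 1 0) (recenter x A 1 1) EA Dt l2 => p q l EA Dt l2.
have pl : p = l.
  have -> : p = p * l ^+ 2 by rewrite l2 mulr1.
  by rewrite expr2 mulrA Dt mul1r.
have : D (l * q).
  exists A => //; rewrite /pm_lowtri EA pl.
  have /eqP : (l - 1) * (l + 1) = 0 by ring: l2.
  rewrite mulf_eq0 subr_eq0 addr_eq0 => /orP[] /eqP ->.
    by left; rewrite mul1r.
  by right; rewrite mx2_N mulN1r opprK oppr0.
by move=> /Hrho[n En]; exists n; rewrite -En; move: EA; rewrite /pm_lowtri => ->;
  rewrite pl; have /eqP : (l - 1) * (l + 1) = 0 by [ring: l2];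
  rewrite mulf_eq0 subr_eq0 addr_eq0 => /orP[] /eqP ->;
  [left; rewrite mul1r|right; rewrite mx2_N mulN1r opprK oppr0].
Qed.

Lemma SL2_invM A B : SL2 A -> SL2 B -> invmx (A *m B) = invmx B *m invmx A.
Proof.
move=> SA SB; have U := SL2_unit (SL2_mul SA SB).
rewrite -[RHS]mulmx1 -(mulmxV U) !mulmxA -[_ *m invmx A *m A]mulmxA.
by rewrite mulVmx ?SL2_unit // mulmx1 mulVmx ?SL2_unit // mul1mx.
Qed.

(** Sends infinity to [x]. Conjugation by it turns [lowtri t] into the translation by [- t / r^2],
    so it is a scaling matrix when [r^2] is the width of the cusp. *)
Definition cusp_matrix (r x : R) : 'M[R]_2 := mx2 (x * r) (- r^-1) r 0.

Lemma SL2_cusp_matrix r x : 0 < r -> SL2 (cusp_matrix r x).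
Proof. by move=> r0; apply/SL2_mx2; field; rewrite gt_eqF. Qed.

Lemma cusp_matrix_conj r x A (t : R) : 0 < r -> recenter x A = lowtri t ->
  invmx (cusp_matrix r x) *m A *m cusp_matrix r x = mx2 1 (- (t / r ^+ 2)) 0 1.
Proof.
move=> r0 EA; have rn0 : r != 0 by rewrite gt_eqF.
have -> : cusp_matrix r x = transl x *m mx2 0 (- r^-1) r 0.
  by rewrite mul_mx2; congr mx2; ring.
have SW : SL2 (mx2 0 (- r^-1) r 0) by apply/SL2_mx2; field.
rewrite (SL2_invM (SL2_transl x) SW) !mulmxA.
have -> : invmx (mx2 0 (- r^-1) r 0) *m invmx (transl x) *m A *m transl x =
    invmx (mx2 0 (- r^-1) r 0) *m recenter x A by rewrite /recenter !mulmxA.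
rewrite EA (invmx2 SW) !mx2E !mul_mx2; congr mx2; field => //.
Qed.

Lemma mobius_transl n z : mobius (mx2 1 n 0 1) z = z + n%:C.
Proof. by rewrite /mobius /automorphy !mx2E mul1r mul0r add0r divr1. Qed.

Lemma mobiusN A z : mobius (- A) z = mobius A z.
Proof.
by rewrite /mobius /automorphy !mxE !rmorphN !mulNr -!opprD invrN mulrNN.
Qed.

Lemma scaling_matrix_real_cusp G x : discrete_subgroup G -> cusp G (Some x) ->
  exists2 r : R, 0 < r & scaling_matrix G (Some x) (cusp_matrix r x).
Proof.
move=> dG cG; have [rho rho0 [H1 H2]] := cusp_width dG cG.
have [[GS G1 GM GV] _] := dG.
pose r := Num.sqrt rho; have r0 : 0 < r by rewrite sqrtr_gt0.
have r2 : r ^+ 2 = rho by rewrite sqr_sqrtr // ltW.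
have conjE A n z : pm_lowtri x A (n%:~R * rho) ->
    mobius (invmx (cusp_matrix r x) *m A *m cusp_matrix r x) z = z + (- n)%:~R.
  have nE : z + (- n)%:~R = z + (- n%:~R)%:C by rewrite mulrNz -(rmorph_int (real_complex R))
    -rmorphN.
  have aux B : recenter x B = lowtri (n%:~R * rho) ->
      mobius (invmx (cusp_matrix r x) *m B *m cusp_matrix r x) z = z + (- n)%:~R.
    move=> EB; rewrite (cusp_matrix_conj r0 EB) mobius_transl nE r2 mulfK //.
    by rewrite gt_eqF.
  case=> EA; first exact: aux.
  rewrite -mobiusN -mulNmx -mulmxN; apply: aux.
  by rewrite /recenter mulmxN mulNmx -/(recenter x A) EA opprK.
exists r => //; split; first exact: SL2_cusp_matrix.
- by rewrite /boundary_act !mx2E gt_eqF // mulfK // gt_eqF.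
- split=> [_ [A [GA fA] <-]|n].
    have [n Hn] := H1 A GA ((boundary_fixP x (GS _ GA)).1 fA).
    by exists (- n) => z _; exact: conjE.
  have [A GA HA] := H2 (- n).
  exists (invmx (cusp_matrix r x) *m A *m cusp_matrix r x); split; last first.
    by move=> z _; rewrite (conjE A (- n)) // opprK.
  exists A => //; split => //; apply/(boundary_fixP x (GS _ GA)).
  by case: HA => ->; rewrite ?mx2_N !mx2E ?oppr0.
Qed.

Lemma cusp_form_decay k G f x : discrete_subgroup G -> cusp G (Some x) ->
  cusp_form (2 * k) G f -> cusp_decay f k x.
Proof.
move=> dG cG [_ _ cf]; have [r r0 Sr] := scaling_matrix_real_cusp dG cG.
have [alpha [M [y0 [alpha0 H]]]] := cf _ _ cG Sr.
exists r, (Num.max M 0), alpha, y0; split; rewrite ?le_max ?lexx ?orbT //.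
move=> z z0 hz.
set h := horocycle_height r x z in hz *.
have u0 : z - x%:C != 0.
  by apply: contraTneq z0 => /subr0_eq ->; rewrite ltxx.
pose n := normc (z - x%:C).
have n0 : 0 < n by rewrite lt_neqAle normc_ge0 andbT eq_sym; apply: contra_neq u0; exact:
  eq0_normc.
have h0 : 0 < h by rewrite divr_gt0 // exprn_gt0 ?mulr_gt0.
have rC : (r%:C : R[i]) != 0 by rewrite -(rmorph0 (real_complex R)) (inj_eq (@complexI R)) gt_eqF.
(* The preimage of [z] under the scaling matrix; its imaginary part is the horocycle height, and the
   automorphy factor [r w] has modulus [1 / (r |z - x|)]. *)
pose w := - (r%:C ^+ 2 * (z - x%:C))^-1.
have wn0 : w != 0 by rewrite oppr_eq0 invr_eq0 mulf_neq0 // expf_neq0.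
have zw : mobius (cusp_matrix r x) w = z.
  rewrite /mobius /automorphy !mx2E addr0 !rmorphM rmorphN fmorphV /= /w.
  by field; rewrite u0 rC.
have wim : complex.Im w = h.
  have -> : w = mobius (invmx (cusp_matrix r x)) z.
    rewrite invmx2; last exact: SL2_cusp_matrix.
    rewrite /mobius /automorphy !mx2E opprK mul0r add0r rmorphN fmorphV rmorphM /= /w.
    field; rewrite u0 rC andbT.
    suff -> : - r%:C * z + x%:C * r%:C = - (r%:C * (z - x%:C)).
      by rewrite oppr_eq0 mulf_neq0.
    by ring.
  rewrite Im_mobius //; last by apply: SL2_inv; exact: SL2_cusp_matrix.
  rewrite /h /horocycle_height invmx2; last exact: SL2_cusp_matrix.
  congr (_ / _ ^+ 2); rewrite /automorphy !mx2E.
  have -> : (- r)%:C * z + (x * r)%:C = - r%:C * (z - x%:C) by rewrite rmorphN rmorphM /=; ring.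
  by rewrite normcM normcN normcR ger0_norm // ltW.
have := H (complex.Re w) (complex.Im w).
rewrite wim => /(_ hz h0).
have -> : complex.Re w +i* h = w by rewrite -wim; case: (w).
rewrite norm_normc lecR /slash zw normcM normcV normcX.
have -> : automorphy (cusp_matrix r x) w = r%:C * w by rewrite /automorphy !mx2E addr0.
have -> : normc (r%:C * w) = (r * n)^-1.
  rewrite normcM normcR ger0_norm ?(ltW r0) // /w normcN normcV normcM normcX normcR ger0_norm
    ?(ltW r0) //.
  by rewrite -/n; field; rewrite !gt_eqF.
rewrite exprVn invrK mulrC => /le_trans; apply.
by rewrite ler_wpM2r ?expR_ge0 // le_max lexx.
Qed.

End RealCusp.

(** * Lattices and low points *)

Section HaarMeasure.
Variable R : realType.
Implicit Types (A B : 'M[R]_2) (G : set 'M[R]_2).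

Lemma mnormB A B : mnorm (A - B) = mnorm (B - A).
Proof. by rewrite -mnormN opprB. Qed.

Lemma open_mulmxl A (V : set 'M[R]_2) : open V -> open [set B | V (A *m B)].
Proof.
rewrite !openE => oV B VAB; have /nbhs_mnormP[e e0 eV] := oV _ VAB.
apply/nbhs_mnormP; exists (e / (mnorm A + 1)).
  by rewrite divr_gt0 // ltr_wpDl ?mnorm_ge0.
move=> M MB; apply: eV; rewrite -mulmxBr (le_lt_trans (mnormM _ _)) //.
have A0 : 0 < mnorm A + 1 by rewrite ltr_wpDl ?mnorm_ge0.
rewrite ltr_pdivlMr // in MB; apply: le_lt_trans MB.
by rewrite mulrC ler_wpM2l ?mnorm_ge0 // lerDl.
Qed.

Lemma open_measurable_M2 (V : set 'M[R]_2) : open V -> measurable (V : set (borel_M2 R)).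
Proof. by move=> oV; apply: sub_sigma_algebra. Qed.

Lemma measurable_mulmxl A (E : set (borel_M2 R)) : measurable E ->
  measurable ([set B | E (A *m B)] : set (borel_M2 R)).
Proof.
move=> mE.
have mf : measurable_fun [set: borel_M2 R] (fun B : borel_M2 R => A *m B : borel_M2 R).
  apply: (@measurability _ _ (borel_M2 R) (borel_M2 R) setT _ (@open 'M[R]_2)) => //.
  move=> _ [V oV <-]; rewrite setTI; apply: open_measurable_M2.
  exact: open_mulmxl.
by have := mf measurableT _ mE; rewrite setTI.
Qed.

Lemma image_mulmxl A (E : set 'M[R]_2) : SL2 A ->
  [set A *m B | B in E] = [set B | E (invmx A *m B)].
Proof.
move=> SA; have U := SL2_unit SA; apply/seteqP; split => [_ [B EB <-]|B EB] /=.
  by rewrite mulmxA mulVmx // mul1mx.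
by exists (invmx A *m B) => //; rewrite mulmxA mulmxV // mul1mx.
Qed.

Lemma measurable_SL2 : measurable (@SL2 R : set (borel_M2 R)).
Proof.
have -> : @SL2 R = (fun B : 'M[R]_2 => B 0 0 * B 1 1 - B 0 1 * B 1 0) @^-1` [set 1].
  apply/seteqP; split => B /=; first exact: SL2_det.
  by move=> E; rewrite [B]mx2_eta; apply/SL2_mx2.
rewrite -[X in measurable X]setCK; apply: measurableC; apply: open_measurable_M2.
rewrite openC; apply: preimage_closed; last exact: closed_eq.
have c (i j : 'I_2) : continuous (fun B : 'M[R]_2 => B i j) by exact: coord_continuous.
by move=> B _; apply: (cvgB (cvgM (c 0 0 B) (c 1 1 B)) (cvgM (c 0 1 B) (c 1 0 B))).
Qed.

(** Rational matrices are dense among all matrices but need not lie in SL2. For each of them and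
    each radius [1 / (n + 1)] a point of SL2 that close is picked, and the identity if there is
    none. *)
Lemma SL2_dense_sequence : exists s : nat -> 'M[R]_2, (forall k, SL2 (s k)) /\
  forall A (e : R), SL2 A -> 0 < e -> exists k, mnorm (s k - A) < e.
Proof.
pose near_rat (q : 'M[rat]_2 * nat) : set 'M[R]_2 :=
  [set A | SL2 A /\ mnorm (A - map_mx ratr q.1) < q.2.+1%:R^-1].
pose s k := if unpickle k is Some q then xget 1%:M (near_rat q) else 1%:M.
exists s; split => [k|A e SA e0].
  rewrite /s; case: unpickle => [q|]; last exact: SL2_1.
  by case: xgetP => [A -> []|_] //; exact: SL2_1.
pose n := Num.bound (2 / e).
have nP : 2 / e < n.+1%:R.
  apply: lt_trans (_ : n%:R < _); last by rewrite ltr_nat.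
  by apply: archi_boundP; rewrite divr_ge0 // ltW.
have n0 : 0 < n.+1%:R^-1 :> R by rewrite invr_gt0.
have Q (i j : 'I_2) : exists q : rat, `|A i j - ratr q| < n.+1%:R^-1 / 8.
  have lt2 : A i j - n.+1%:R^-1 / 8 < A i j + n.+1%:R^-1 / 8.
    have u0 : 0 < n.+1%:R^-1 / 8 :> R by rewrite divr_gt0.
    by rewrite ltrD2l (lt_trans _ u0) // oppr_lt0.
  have [q] := rat_in_itvoo lt2; rewrite in_itv /= => /andP[q1 q2]; exists q.
  move: q1 q2; move: (A i j) (ratr q) (n.+1%:R^-1 / 8) => x y u q1 q2.
  by rewrite ltr_norml; apply/andP; split; lra.
have /choice[q1 Hq1] := fun ij : 'I_2 * 'I_2 => Q ij.1 ij.2.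
pose q : 'M[rat]_2 := \matrix_(i, j) q1 (i, j).
have Aq : mnorm (A - map_mx ratr q) < n.+1%:R^-1.
  apply: le_lt_trans (_ : 4 * (n.+1%:R^-1 / 8) < _).
    by apply: mnorm_le => i j; rewrite !mxE ltW //; exact: (Hq1 (i, j)).
  by move: (n.+1%:R^-1 : R) n0 => u u0; lra.
exists (pickle (q, n)); rewrite /s pickleK.
case: xgetP => [B -> [SB Bq]|/(_ A)]; last by move=> H; case: H.
move: SB Bq; move: (xget _ _) => {}B /= SB Bq.
have -> : B - A = (B - map_mx ratr q) - (A - map_mx ratr q) by rewrite opprB addrA subrK.
apply: le_lt_trans (mnormD _ _) _; rewrite mnormN.
apply: lt_trans (ltrD Bq Aq) _ => /=.
rewrite -[X in X + X]mul1r -mulrDl ltr_pdivrMr // mulrC -ltr_pdivrMr //.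
Qed.

Lemma mnorm_inv A : SL2 A -> mnorm (invmx A) = mnorm A.
Proof.
move=> SA; rewrite (invmx2 SA) /mnorm !mx2E !normrN; ring.
Qed.

(** [A] is sent to the index of a point of the dense sequence at a distance inversely proportional
    to [mnorm A + 1]. If [A] and [B] share the index, then [invmx A *m B] is within [e] of 1.
    Assuming [mnorm A <= mnorm B], the tolerance of [A] covers both. *)
Lemma discrete_countable G : discrete_subgroup G -> countable G.
Proof.
move=> dG; have [[GS G1 GM GV] _] := dG.
have [e e0 He] := discrete_near1 dG; have [s [_ Hs]] := SL2_dense_sequence.
have P A : 0 < e / (4 * (mnorm A + 1)).
  by rewrite divr_gt0 ?mulr_gt0 // ltr_wpDl ?mnorm_ge0.
have H A : exists k, SL2 A -> mnorm (s k - A) < e / (4 * (mnorm A + 1)).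
  have [SA|nSA] := pselect (SL2 A); last by exists 0%N.
  by have [k Hk] := Hs A _ SA (P A); exists k.
have [c Hc] := choice H.
apply/countable_injP; exists c => A B /set_mem GA /set_mem GB cAB.
wlog AB : A B GA GB cAB / mnorm A <= mnorm B.
  move=> W; have [AB|/ltW BA] := leP (mnorm A) (mnorm B); first exact: W.
  by apply: esym; apply: W.
have SA := GS _ GA; have SB := GS _ GB.
have H1 := Hc A SA; have H2 := Hc B SB; rewrite -cAB in H2.
suff AB1 : invmx A *m B = 1%:M.
  by rewrite -[LHS]mulmx1 -AB1 mulmxA mulmxV ?SL2_unit // mul1mx.
apply: He; first by apply: GM => //; exact: GV.
have -> : invmx A *m B - 1%:M = invmx A *m (B - A).
  by rewrite mulmxBr mulVmx // SL2_unit.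
apply: le_lt_trans (mnormM _ _) _; rewrite mnorm_inv //.
have {}H2 : mnorm (s (c A) - B) < e / (4 * (mnorm A + 1)).
  apply: lt_le_trans H2 _; rewrite ler_pM2l // lef_pV2 ?posrE ?mulr_gt0 ?ltr_wpDl ?mnorm_ge0 //.
  by rewrite ler_pM2l // lerD2r.
have H3 : mnorm (B - A) <= e / (4 * (mnorm A + 1)) + e / (4 * (mnorm A + 1)).
  have -> : B - A = (s (c A) - A) - (s (c A) - B) by rewrite opprB [RHS]addrC addrA subrK.
  by rewrite (le_trans (mnormD _ _)) // mnormN lerD // ltW.
apply: le_lt_trans (ler_wpM2l (mnorm_ge0 _) H3) _.
have := mnorm_ge0 A; move: (mnorm A) => u u0.
have u10 : u + 1 != 0 by rewrite gt_eqF // ltr_wpDl.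
have -> : u * (e / (4 * (u + 1)) + e / (4 * (u + 1))) = e * (u / (u + 1)) / 2.
  by field.
have : u / (u + 1) <= 1 by rewrite ler_pdivrMr ?mul1r ?lerDl // ltr_wpDl.
by move: (u / (u + 1)) => v v1; nra.
Qed.

End HaarMeasure.

Section FiniteVolume.
Variable R : realType.
Implicit Types (A B : 'M[R]_2) (G : set 'M[R]_2).
Variable mu : {measure set (borel_M2 R) -> \bar R}.
Hypothesis haar_mu : haar_SL2 mu.

Definition injects G (U : set 'M[R]_2) :=
  forall A x, G A -> U x -> U (A *m x) -> A = 1%:M.

(** [U] is cut into the pieces [E n] that the [n]-th group element carries into [F]. Their images
    [W n] have the same measure by invariance, and they are disjoint in [F] because [U] injects into
    the quotient. *)
Lemma injecting_measure_le G (F U : set (borel_M2 R)) : discrete_subgroup G ->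
  fundamental_domain G F -> measurable U -> U `<=` @SL2 R -> injects G U ->
  (mu U <= mu F)%E.
Proof.
move=> dG [mF FS Funiq] mU US inj; have [[GS G1 GM GV] _] := dG.
have [_ _ _ invmu] := haar_mu.
have /countable_injP[c cinj] := discrete_countable dG.
have {}cinj A B : G A -> G B -> c A = c B -> A = B.
  by move=> GA GB; apply: cinj; apply/mem_set.
pose E n : set (borel_M2 R) := [set x | U x /\ exists A, [/\ G A, c A = n & F (A *m x)]].
pose W n : set (borel_M2 R) := [set y | F y /\ exists A, [/\ G A, c A = n & U (invmx A *m y)]].
have EW n : [/\ measurable (E n), measurable (W n) & mu (W n) = mu (E n)].
  have [[A [GA cA]]|nA] := pselect (exists A, G A /\ c A = n); last first.
    have -> : E n = set0.
      by apply/seteqP; split => // x [_ [A [GA cA _]]]; apply: nA; exists A.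
    have -> : W n = set0.
      by apply/seteqP; split => // x [_ [A [GA cA _]]]; apply: nA; exists A.
    by split; [exact: measurable0|exact: measurable0|].
  have uA B : G B -> c B = n -> B = A by move=> GB cB; apply: cinj => //; rewrite cB.
  have SA := GS _ GA; have UA := SL2_unit SA.
  have EE : E n = U `&` [set x | F (A *m x)].
    apply/seteqP; split => x [Ux H]; split => //.
      by case: H => B [GB cB FB]; rewrite -(uA B).
    by exists A.
  have WE : W n = [set A *m B | B in E n].
    rewrite EE; apply/seteqP; split => [y [Fy [B [GB cB UB]]]|_ [x [Ux Fx] <-]].
      rewrite (uA B GB cB) in UB; exists (invmx A *m y).
        by split => //=; rewrite mulmxA mulmxV // mul1mx.
      by rewrite mulmxA mulmxV // mul1mx.
    split => //; exists A; split => //.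
    by rewrite mulmxA mulVmx // mul1mx.
  have mE : measurable (E n).
    by rewrite EE; apply: measurableI => //; exact: measurable_mulmxl.
  split => //; last by rewrite WE invmu.
  rewrite WE (image_mulmxl _ SA); exact: measurable_mulmxl.
have UE : U = \bigcup_n E n.
  apply/seteqP; split => [x Ux|x [n _ []]] //.
  have [A [[GA FA] _]] := Funiq x (US _ Ux).
  by exists (c A) => //; split => //; exists A.
have tE : trivIset setT E.
  move=> n m _ _ [x [[Ux [A [GA <- FA]]] [_ [B [GB <- FB]]]]].
  have [C [_ HC]] := Funiq x (US _ Ux).
  by rewrite -(HC A (conj GA FA)) -(HC B (conj GB FB)).
have tW : trivIset setT W.
  move=> n m _ _ [y [[Fy [A [GA <- UA]]] [_ [B [GB <- UB]]]]].
  have SA := SL2_unit (GS _ GA); have SB := SL2_unit (GS _ GB).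
  have H : invmx B *m A = 1%:M.
    apply: (inj _ (invmx A *m y)) => //; first by apply: GM => //; exact: GV.
    by rewrite -mulmxA [A *m _]mulmxA mulmxV // mul1mx.
  by rewrite -[A]mul1mx -(mulmxV SB) -mulmxA H mulmx1.
have mE n : measurable (E n) by have [] := EW n.
have mW n : measurable (W n) by have [] := EW n.
have muE : mu (\bigcup_n E n) = mu (\bigcup_n W n).
  rewrite !measure_bigcup //; apply: eq_eseriesr => n _.
  by have [_ _ ->] := EW n.
rewrite UE muE; apply: le_measure; rewrite ?inE //.
  exact: bigcup_measurable.
by move=> y [n _ []].
Qed.

Definition SL2_ball (e : R) : set (borel_M2 R) :=
  [set B | SL2 B /\ mnorm (B - 1%:M) < e].

Lemma measurable_SL2_ball (e : R) : measurable (SL2_ball e).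
Proof.
have -> : SL2_ball e = (@SL2 R : set (borel_M2 R)) `&` [set B | mnorm (B - 1%:M) < e] by [].
apply: measurableI; first exact: measurable_SL2.
apply: open_measurable_M2; rewrite openE => B Be.
apply/nbhs_mnormP; exists (e - mnorm (B - 1%:M)); first by rewrite subr_gt0.
move=> C CB /=; have -> : C - 1%:M = (C - B) + (B - 1%:M) by rewrite addrA subrK.
by rewrite (le_lt_trans (mnormD _ _)) // -ltrBrDr.
Qed.

(** Countably many translates of the ball, centred at a dense sequence, cover SL2. If the ball were
    null, so would be the whole group. *)
Lemma haar_SL2_ball_gt0 (e : R) : 0 < e -> (0 < mu (SL2_ball e))%E.
Proof.
move=> e0; have [_ mSL _ invmu] := haar_mu.
rewrite lt_neqAle measure_ge0 andbT eq_sym; apply: contra_neq mSL => muV.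
have [s [sS Hs]] := SL2_dense_sequence R.
pose T k : set (borel_M2 R) := [set s k *m B | B in SL2_ball e].
have mT k : measurable (T k).
  rewrite /T (image_mulmxl _ (sS k)).
  by apply: measurable_mulmxl; exact: measurable_SL2_ball.
have T0 k : mu (T k) = 0%E by rewrite invmu //; exact: measurable_SL2_ball.
have cover : (@SL2 R : set (borel_M2 R)) `<=` \bigcup_k T k.
  move=> A SA.
  have P0 : 0 < mnorm A + 1 by rewrite ltr_wpDl ?mnorm_ge0.
  pose d := Num.min 1 (e / (mnorm A + 1)).
  have d0 : 0 < d by rewrite lt_min ltr01 divr_gt0.
  have [k Hk] := Hs A d SA d0; exists k => //.
  have Uk := SL2_unit (sS k).
  exists (invmx (s k) *m A); last by rewrite mulmxA mulmxV // mul1mx.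
  split; first by apply: SL2_mul => //; exact: SL2_inv.
  have -> : invmx (s k) *m A - 1%:M = invmx (s k) *m (A - s k) by rewrite mulmxBr mulVmx.
  apply: le_lt_trans (mnormM _ _) _; rewrite mnorm_inv // mnormB.
  have H1 : mnorm (s k) <= mnorm A + 1.
    have -> : s k = A + (s k - A) by rewrite addrC subrK.
    rewrite (le_trans (mnormD _ _)) // lerD2l ltW // (lt_le_trans Hk) //.
    by rewrite ge_min lexx.
  apply: le_lt_trans (ler_wpM2r (mnorm_ge0 _) H1) _.
  rewrite mulrC -ltr_pdivlMr // (lt_le_trans Hk) // ge_min lexx orbT //.
apply/eqP; rewrite -measure_le0.
apply: le_trans (le_measure mu _ _ cover) _; rewrite ?inE //.
- exact: measurable_SL2.
- exact: bigcup_measurable.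
apply: le_trans (measure_sigma_subadditive _ _ _ (subset_refl _)) _ => //.
  exact: bigcup_measurable.
by rewrite eseries0.
Qed.

End FiniteVolume.

(** * Small displacements along a vertical geodesic *)

Section ThinPart.
Variable R : realType.
Implicit Types (A B : 'M[R]_2) (G : set 'M[R]_2) (x u e : R).

(* Otherwise infinitely many translates of one ball embed disjointly in the quotient. *)
Lemma lattice_translates_meet G e (g : nat -> 'M[R]_2) : lattice_SL2 G -> 0 < e ->
  (forall i, SL2 (g i)) ->
  ~ (forall A i j v w, G A -> SL2_ball e v -> SL2_ball e w ->
      A *m (g i *m v) = g j *m w -> i = j /\ A = 1%:M).
Proof.
move=> [dG [mu [F [haar_mu fdF finF]]]] e0 Sg disj.
have [[GS G1 GM GV] _] := dG; have [mF FS _] := fdF.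
have [_ _ _ invmu] := haar_mu.
pose V := SL2_ball e; have mV : measurable V by exact: measurable_SL2_ball.
have V0 : (0 < mu V)%E by exact: haar_SL2_ball_gt0.
pose T i : set (borel_M2 R) := [set g i *m B | B in V].
have mT i : measurable (T i).
  by rewrite /T (image_mulmxl _ (Sg i)); apply: measurable_mulmxl.
have muT i : mu (T i) = mu V by rewrite invmu.
have tT : trivIset setT T.
  move=> i j _ _ [y [[v Vv <-] [w Vw E]]].
  by have [] := disj 1%:M i j v w G1 Vv Vw; rewrite ?mul1mx.
have le N : (\sum_(i < N) mu V <= mu F)%E.
  have -> : (\sum_(i < N) mu V = mu (\big[setU/set0]_(i < N) T i))%E.
    by rewrite measure_bigsetU //; apply: eq_bigr => i _; exact: esym (muT i).
  apply: (injecting_measure_le haar_mu dG fdF).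
  - exact: bigsetU_measurable.
  - rewrite -bigcup_mkord => _ [i _ [v [Sv _] <-]]; exact: SL2_mul.
  - move=> A y GA; rewrite -bigcup_mkord => -[i _ [v Vv <-]] [j _ [w Vw E]].
    by have [] := disj A i j v w GA Vv Vw (esym E).
have finV : mu V \is a fin_num.
  rewrite fin_numE; have := le 1%N; rewrite big_ord1 => le1.
  rewrite gt_eqF ?(lt_trans _ V0) ?ltNyr //=.
  by rewrite lt_eqF // (le_lt_trans le1).
have finF' : mu F \is a fin_num.
  by rewrite fin_numE gt_eqF ?(lt_le_trans _ (measure_ge0 _ _)) ?ltNyr //= lt_eqF.
move: V0 le finF; rewrite -(fineK finV) -(fineK finF').
move: (fine _) (fine _) => f v; rewrite lte_fin => v0 le _.
pose N := Num.bound (`|f| / v).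
have := le N; rewrite sumEFin lee_fin sumr_const card_ord -[v *+ N]mulr_natl.
apply/negP; rewrite -ltNge (le_lt_trans (ler_norm f)) // -ltr_pdivrMr //.
by apply: archi_boundP; rewrite divr_ge0 // ltW.
Qed.

(** It maps the point [i] to [x + i / u^2], so growing [u] means running down the vertical geodesic
    towards [x]. *)
Definition frame x u : 'M[R]_2 := transl x *m mx2 u^-1 0 0 u.

Lemma SL2_frame x u : 0 < u -> SL2 (frame x u).
Proof.
move=> u0; apply: SL2_mul; first exact: SL2_transl.
by apply/SL2_mx2; rewrite mulVf ?gt_eqF // mulr0 subr0.
Qed.

Definition displacement x u A := mnorm (invmx (frame x u) *m A *m frame x u - 1%:M).

Lemma ball_quotient e v w : 0 < e -> e <= 1 -> SL2_ball (e / 8) v -> SL2_ball (e / 8) w ->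
  mnorm (w *m invmx v - 1%:M) < e.
Proof.
move=> e0 e1 [Sv v1] [Sw w1].
have -> : w *m invmx v - 1%:M = (w - v) *m invmx v.
  by rewrite mulmxBl mulmxV // SL2_unit.
apply: le_lt_trans (mnormM _ _) _; rewrite mnorm_inv //.
have m1 : mnorm (1%:M : 'M[R]_2) = 2.
  by rewrite mx2_1 /mnorm !mx2E normr0 normr1; ring.
have H1 : mnorm v <= 2 + e / 8.
  have -> : v = 1%:M + (v - 1%:M) by rewrite addrC subrK.
  by rewrite (le_trans (mnormD _ _)) // m1 lerD2l ltW.
have H2 : mnorm (w - v) <= e / 8 + e / 8.
  have -> : w - v = (w - 1%:M) - (v - 1%:M) by rewrite opprB addrA subrK.
  by rewrite (le_trans (mnormD _ _)) // mnormN lerD // ltW.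
apply: le_lt_trans (ler_pM (mnorm_ge0 _) (mnorm_ge0 _) H2 H1) _; nra.
Qed.

(** The bottom row of the frame is [(0, u)], so its size records the position on the geodesic.
    Together with [frame_bottom_row_ge] this shows that the group can identify balls around two
    frames only if their parameters have a ratio at most 8. *)
Lemma frame_bottom_row x u v : SL2_ball 8^-1 v -> 0 < u ->
  `|(frame x u *m v) 1 0| + `|(frame x u *m v) 1 1| <= 2 * u.
Proof.
move=> [_ Hv] u0; rewrite /frame /transl mul_mx2 mulmx2E !mx2E.
have := Hv; rewrite {1}/mnorm mx2_1 !mxE /=.
rewrite !subr0 !mul0r !mul1r ?add0r => Hv'.
rewrite (mul0r (v 0 0)) (mul0r (v 0 1)) !add0r !normrM (gtr0_norm u0).
have : `|v 1 1| <= `|v 1 1 - 1| + 1.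
  by rewrite -[X in `|X| <= _](subrK 1) (le_trans (ler_normD _ _)) // normr1.
have := normr_ge0 (v 0 0 - 1); have := normr_ge0 (v 0 1).
move: (`|v 1 1 - 1|) (`|v 1 1|) (`|v 1 0|) (`|v 0 1|) (`|v 0 0 - 1|) Hv' => p q r s t.
by nra.
Qed.

(** The bottom row of [A *m frame x u] is [(A 1 0 / u, (A 1 0 x + A 1 1) u)]. By hypothesis the
    second entry is at least [u / 2] in modulus, and a factor [v] within [1 / 8] of 1 destroys at
    most a quarter of the total. *)
Lemma frame_bottom_row_ge x u A v : SL2_ball 8^-1 v -> 0 < u ->
  2^-1 <= (A 1 0 * x + A 1 1) ^+ 2 ->
  u / 4 <= `|(A *m (frame x u *m v)) 1 0| + `|(A *m (frame x u *m v)) 1 1|.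
Proof.
move=> [_ Hv] u0 HA.
have -> : A *m (frame x u *m v) =
  mx2 (A 0 0) (A 0 0 * x + A 0 1) (A 1 0) (A 1 0 * x + A 1 1) *m (mx2 u^-1 0 0 u *m v).
  rewrite /frame !mulmxA; congr (_ *m _ *m _).
  by rewrite [A in LHS]mx2_eta mul_mx2; congr mx2; ring.
rewrite (mulmx2E _ v) mul_mx2 !mx2E.
move: (A 1 0 * x + A 1 1) HA => d HA.
have d2 : 2^-1 <= `|d|.
  rewrite -real_normK ?num_real // in HA; have := normr_ge0 d; nra.
move: Hv; rewrite /mnorm mx2_1 !mxE /= !subr0.
have cE (a b : R) : A 1 0 * (u^-1 * a + 0 * b) + d * (0 * a + u * b) =
    A 1 0 * u^-1 * a + d * u * b by ring.
rewrite !cE; move: (A 1 0 * u^-1) => c.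
have ud : u / 2 <= `|d * u| by rewrite normrM (gtr0_norm u0); nra.
move: (d * u) ud => {HA d2} d' ud.
have T (a b : R) : `|a| - `|b| <= `|a + b|.
  by have := ler_normD (a + b) (- b); rewrite addrK normrN; lra.
have E0 : c * v 0 0 + d' * v 1 0 = c + (c * (v 0 0 - 1) + d' * v 1 0) by ring.
have E1 : c * v 0 1 + d' * v 1 1 = d' + (c * v 0 1 + d' * (v 1 1 - 1)) by ring.
have := T c (c * (v 0 0 - 1) + d' * v 1 0); have := T d' (c * v 0 1 + d' * (v 1 1 - 1)).
have := ler_normD (c * (v 0 0 - 1)) (d' * v 1 0); have := ler_normD (c * v 0 1) (d' * (v 1 1 -
  1)).
rewrite -E0 -E1 !normrM.
have := normr_ge0 c; have := normr_ge0 (v 0 0 - 1); have := normr_ge0 (v 0 1).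
have := normr_ge0 (v 1 0); have := normr_ge0 (v 1 1 - 1).
move: (`|c * v 0 0 + d' * v 1 0|) (`|c * v 0 1 + d' * v 1 1|) => X Y.
move: (`|c * (v 0 0 - 1) + d' * v 1 0|) (`|c * v 0 1 + d' * (v 1 1 - 1)|) => Z W.
move: (`|c|) (`|d'|) ud => C D ud.
move: (`|v 1 1 - 1|) (`|v 1 0|) (`|v 0 1|) (`|v 0 0 - 1|) => p q r s p0 q0 r0 s0 C0 H1 H2 H3 H4
  H5.
have p8 : p <= 8^-1 by lra.
have q8 : q <= 8^-1 by lra.
have r8 : r <= 8^-1 by lra.
have s8 : s <= 8^-1 by lra.
have D0 : 0 <= D by lra.
have := ler_wpM2l C0 s8; have := ler_wpM2l C0 r8.
have := ler_wpM2l D0 p8; have := ler_wpM2l D0 q8; lra.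
Qed.

(** Otherwise there are arbitrarily large parameters at which no nontrivial element has small
    displacement. Small balls around these frames then embed in the quotient, and for a lacunary
    choice of parameters they are pairwise disjoint there, against the finite covolume. *)
Lemma thin_part G x e : lattice_SL2 G ->
  (forall A, G A -> 2^-1 <= (A 1 0 * x + A 1 1) ^+ 2) -> 0 < e ->
  exists2 u0 : R, 0 < u0 & forall u, u0 <= u ->
    exists A, [/\ G A, A <> 1%:M & displacement x u A < e].
Proof.
move=> lG Hx; wlog e1 : e / e <= 1.
  move=> W e0; have [e1|/ltW e1] := leP e 1; first exact: W.
  have [u0 u00 Hu] := W 1 (lexx _) ltr01; exists u0 => // u uu.
  by have [A [GA A1 HA]] := Hu u uu; exists A; split => //; exact: lt_le_trans e1.
move=> e0; apply: contrapT => noU.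
have bad t : exists u, t <= u /\ forall A, G A -> displacement x u A < e -> A = 1%:M.
  apply: contrapT => H; apply: noU; exists (Num.max t 1); first by rewrite lt_max ltr01 orbT.
  move=> u; rewrite ge_max => /andP[tu _]; apply: contrapT => H'; apply: H; exists u; split => //.
  by move=> A GA HA; apply: contrapT => A1; apply: H'; exists A.
have [nxt Hn] := choice bad.
(* The ratio 16 exceeds the ratio 8 within which the group could identify two of the balls. *)
pose us := fix us n := if n is m.+1 then nxt (16 * us m + 1) else nxt 1.
have us0 n : 0 < us n.
  elim: n => [|n IH] /=; first by have [/(lt_le_trans ltr01)] := Hn 1.
  have [H _] := Hn (16 * us n + 1); rewrite (lt_le_trans _ H) // addr_gt0 ?mulr_gt0 //.
have usS n : 16 * us n <= us n.+1.
  by have [H _] := Hn (16 * us n + 1); rewrite (le_trans _ H) // lerDl.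
have us_lt i j : (i < j)%N -> 16 * us i <= us j.
  elim: j => [//|j IH]; rewrite ltnS leq_eqVlt => /orP[/eqP -> //|ij].
  rewrite (le_trans (IH ij)) // (le_trans _ (usS j)) //.
  by have := us0 j; lra.
have ubad n A : G A -> displacement x (us n) A < e -> A = 1%:M.
  by case: n => [|n] /=; [have [_] := Hn 1|have [_] := Hn (16 * us n + 1)]; exact.
have [[[GS G1 GM GV] _] _] := lG.
have e80 : 0 < e / 8 by rewrite divr_gt0.
have balls v : SL2_ball (e / 8) v -> SL2_ball 8^-1 v.
  by move=> [Sv Hv]; split => //; rewrite (lt_le_trans Hv) //; lra.
have key A i j v w : G A -> SL2_ball (e / 8) v -> SL2_ball (e / 8) w ->
    A *m (frame x (us i) *m v) = frame x (us j) *m w -> us i <= 8 * us j.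
  move=> GA /balls Vv /balls Vw E.
  have := frame_bottom_row_ge Vv (us0 i) (Hx A GA); rewrite E.
  by have := frame_bottom_row x Vw (us0 j); lra.
apply: (@lattice_translates_meet G (e / 8) (fun n => frame x (us n))) => //.
  by move=> i; exact: SL2_frame.
move=> A i j v w GA Vv Vw E.
have ij : i = j.
  have k1 := key A i j v w GA Vv Vw E.
  have UA := SL2_unit (GS _ GA).
  have k2 : us j <= 8 * us i.
    apply: (key (invmx A) j i w v (GV _ GA) Vw Vv).
    by rewrite -E !mulmxA mulVmx // mul1mx.
  have [ij|ji|//] := ltngtP i j.
    by exfalso; have := us_lt _ _ ij; have := us0 i; have := us0 j; lra.
  by exfalso; have := us_lt _ _ ji; have := us0 i; have := us0 j; lra.
split => //; subst j; apply: (ubad i) => //; rewrite /displacement.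
move: (SL2_unit (SL2_frame x (us0 i))) E; rewrite /=.
move: (frame x (us i)) => g Ug E.
have Uv := SL2_unit Vv.1.
have -> : invmx g *m A *m g = w *m invmx v.
  have E2 : invmx g *m A *m g *m v = w by rewrite -!mulmxA E mulmxA mulVmx // mul1mx.
  by rewrite -E2 -[RHS]mulmxA mulmxV // mulmx1.
exact: ball_quotient.
Qed.

End ThinPart.

(** * From small displacements to parabolic elements *)

Section ThinIsParabolic.
Variable R : realType.
Implicit Types (A B X Y S : 'M[R]_2) (G : set 'M[R]_2) (x u e : R).

Definition cj S A := invmx S *m A *m S.

Lemma cjM S A B : SL2 S -> cj S (A *m B) = cj S A *m cj S B.
Proof.
move=> /SL2_unit U; rewrite /cj !mulmxA; congr (_ *m _); rewrite -!mulmxA.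
by congr (_ *m _); rewrite [S *m _]mulmxA mulmxV // mul1mx.
Qed.

Lemma SL2_cj S A : SL2 S -> SL2 A -> SL2 (cj S A).
Proof. by move=> SS SA; do 2?apply: SL2_mul => //; exact: SL2_inv. Qed.

Lemma cjV S A : SL2 S -> SL2 A -> cj S (invmx A) = invmx (cj S A).
Proof.
move=> SS SA; have U := SL2_unit (SL2_cj SS SA).
rewrite -[LHS]mulmx1 -(mulmxV U) mulmxA -cjM // mulVmx ?SL2_unit //.
by rewrite /cj mulmx1 mulVmx ?SL2_unit // mul1mx.
Qed.

Lemma cj_mul S T A : SL2 S -> SL2 T -> cj (S *m T) A = cj T (cj S A).
Proof. by move=> SS ST; rewrite /cj SL2_invM // !mulmxA. Qed.

Lemma displacementE x u A : 0 < u -> displacement x u A =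
  `|recenter x A 0 0 - 1| + `|recenter x A 0 1| * u ^+ 2 +
  (`|recenter x A 1 0| / u ^+ 2 + `|recenter x A 1 1 - 1|).
Proof.
move=> u0; have un0 : u != 0 by rewrite gt_eqF.
have SD : SL2 (mx2 u^-1 0 0 u) by apply/SL2_mx2; rewrite mulVf // mulr0 subr0.
rewrite /displacement -/(cj (frame x u) A) /frame cj_mul //; last exact: SL2_transl.
rewrite -[cj (transl x) A]/(recenter x A); move: (recenter x A) => M.
have -> : cj (mx2 u^-1 0 0 u) M = mx2 (M 0 0) (M 0 1 * u ^+ 2) (M 1 0 / u ^+ 2) (M 1 1).
  by rewrite /cj (invmx2 SD) !mx2E [M in LHS]mx2_eta !mul_mx2; congr mx2; field.
rewrite mx2_1 /mnorm !mxE /= !subr0.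
by rewrite (normrM (M 0 1)) (normrM (M 1 0)) normfV (ger0_norm (sqr_ge0 u)).
Qed.

(** The error is quadratic because [X Y - Y X] equals the commutator of [X - 1] and [Y - 1], which
    is then multiplied by the two inverses; on SL2 inversion preserves [mnorm]. *)
Lemma commutator_displacement x u A B : 0 < u -> SL2 A -> SL2 B ->
  displacement x u (A *m B *m (invmx A *m invmx B)) <=
  2 * (displacement x u A * displacement x u B) *
    ((2 + displacement x u A) * (2 + displacement x u B)).
Proof.
move=> u0 SA SB; have SF := SL2_frame x u0.
rewrite /displacement -!/(cj (frame x u) _) !cjM // !cjV //.
have SX := SL2_cj SF SA; have SY := SL2_cj SF SB.
move: (cj _ A) (cj _ B) SX SY => X Y SX SY.
have UX := SL2_unit SX; have UY := SL2_unit SY.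
have m1 : mnorm (1%:M : 'M[R]_2) <= 2.
  by rewrite mx2_1 /mnorm !mx2E normr0 normr1; lra.
have le2 (M : 'M[R]_2) : mnorm M <= 2 + mnorm (M - 1%:M).
  have E : M = 1%:M + (M - 1%:M) by rewrite addrC subrK.
  by rewrite {1}E; apply: le_trans (mnormD _ _) _; rewrite lerD2r.
have E : X *m Y *m (invmx X *m invmx Y) - 1%:M =
  ((X - 1%:M) *m (Y - 1%:M) - (Y - 1%:M) *m (X - 1%:M)) *m (invmx X *m invmx Y).
  have E1 : (X - 1%:M) *m (Y - 1%:M) - (Y - 1%:M) *m (X - 1%:M) = X *m Y - Y *m X.
    rewrite !mulmxBr !mulmxBl !mulmx1 !mul1mx !opprB.
    move: (X *m Y) (Y *m X) (1%:M) => M N I.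
    by apply/matrixP => i j; rewrite !mxE; ring.
  rewrite E1 mulmxBl; congr (_ - _).
  by rewrite mulmxA -[Y *m X *m _]mulmxA mulmxV // mulmx1 mulmxV.
rewrite E (le_trans (mnormM _ _)) // ler_pM ?mnorm_ge0 //.
  rewrite (le_trans (mnormD _ _)) // mnormN mulrDl !mul1r.
  by rewrite lerD // ?mnormM // mulrC mnormM.
rewrite (le_trans (mnormM _ _)) // !mnorm_inv // ler_pM ?mnorm_ge0 //; exact: le2.
Qed.

(** By discreteness the displacements of nontrivial elements are bounded away from 0, so their
    infimum is positive and some element lies below twice the infimum. *)
Lemma near_minimal_displacement G x u : discrete_subgroup G -> 0 < u ->
  (exists A, G A /\ A <> 1%:M) ->
  exists A, [/\ G A, A <> 1%:M & forall B, G B -> B <> 1%:M ->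
    displacement x u A <= 2 * displacement x u B].
Proof.
move=> dG u0 [A0 [GA0 A01]].
have [e e0 He] := discrete_conj_near1 dG (SL2_frame x u0).
pose D := [set d | exists A, [/\ G A, A <> 1%:M & d = displacement x u A]].
have lbD : lbound D e.
  move=> _ [A [GA A1 ->]]; rewrite leNgt; apply/negP => H; apply: A1; exact: He.
have hD : has_inf D by split; [exists (displacement x u A0); exists A0|exists e].
have I0 : 0 < inf D.
  apply: lt_le_trans e0 _; apply: lb_le_inf => //; exact: hD.1.
have [_ [A [GA A1 ->]] HA] := inf_adherent I0 hD.
exists A; split => // B GB B1; rewrite (le_trans (ltW HA)) //.
have : inf D <= displacement x u B by apply: ge_inf; [exact: hD.2|exists B].
lra.
Qed.

Lemma displacement_gt0 G x u : discrete_subgroup G -> 0 < u ->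
  forall A, G A -> A <> 1%:M -> 0 < displacement x u A.
Proof.
move=> dG u0 A GA A1; rewrite lt_neqAle mnorm_ge0 andbT eq_sym; apply/eqP => H.
have [e e0 He] := discrete_conj_near1 dG (SL2_frame x u0).
by apply: A1; apply: He => //; rewrite -/(displacement x u A) H.
Qed.

(** Commuting matrices of size 2 have proportional trace-free parts; these are the relations that
    transport the ratios to the entry [0 1]. *)
Lemma recenter_comm x A B : A *m B = B *m A ->
  let X := recenter x A in let Y := recenter x B in
  X 0 1 * Y 1 0 = Y 0 1 * X 1 0 /\ Y 0 1 * (X 0 0 - X 1 1) = X 0 1 * (Y 0 0 - Y 1 1).
Proof.
move=> E /=; have : recenter x A *m recenter x B = recenter x B *m recenter x A.
  by rewrite -!recenterM E.
rewrite !mulmx2E => /mx2_inj[E00 E01 _ _].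
by split; [move: E00|move: E01]; lra.
Qed.

Lemma recenter_lower_powers G x A n : subgroup_SL2 G -> G A -> recenter x A 0 1 = 0 ->
  exists B, [/\ G B, recenter x B 0 1 = 0 & recenter x B 1 1 = recenter x A 1 1 ^+ n].
Proof.
move=> [GS G1 GM GV] GA A01; elim: n => [|n [B [GB B01 B11]]].
  by exists 1%:M; split => //; rewrite recenter1 mx2_1 !mx2E ?expr0.
exists (A *m B); split; [exact: GM| |]; rewrite recenterM mulmx2E !mx2E.
  by rewrite A01 B01 mulr0 mul0r addr0.
by rewrite B01 mulr0 add0r B11 exprS.
Qed.

(* Else [A 1 0 * x + A 1 1] tends to [0] along the powers of [A] or of its inverse. *)
Lemma lower_triangular_is_unipotent G x A : subgroup_SL2 G ->
  (forall A, G A -> 2^-1 <= (A 1 0 * x + A 1 1) ^+ 2) ->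
  G A -> recenter x A 0 1 = 0 -> recenter x A 1 1 ^+ 2 = 1.
Proof.
move=> sG Hx GA A01; have [GS G1 GM GV] := sG.
have key B : G B -> recenter x B 0 1 = 0 -> ~ recenter x B 1 1 ^+ 2 < 1.
  move=> GB B01 B11; have B2 : 0 <= recenter x B 1 1 ^+ 2 < 1 by rewrite sqr_ge0.
  have h0 : 0 < 4^-1 :> R by rewrite invr_gt0.
  have [N /(_ N (leqnn N)) HN] := expr_small B2 h0.
  have [C [GC C01 C11]] := recenter_lower_powers N sG GB B01.
  have := Hx C GC; have -> : C 1 0 * x + C 1 1 = recenter x C 1 1 by rewrite recenterE mx2E.
  by rewrite C11 exprAC; lra.
have SA := GS _ GA; have D := SL2_det (SL2_recenter x SA); rewrite A01 mul0r subr0 in D.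
have k1 := key A GA A01.
have k2 := key (invmx A) (GV _ GA); rewrite recenterV // invmx2 in k2; last exact: SL2_recenter.
rewrite !mx2E A01 oppr0 in k2; have {}k2 := k2 erefl.
move: k1 k2 => /negP; rewrite -leNgt => k1 /negP; rewrite -leNgt => k2.
move: (recenter x A 0 0) (recenter x A 1 1) D k1 k2 => p d pd d1 p1.
have E : p ^+ 2 * d ^+ 2 = 1 by rewrite -exprMn pd expr1n.
by apply/eqP; rewrite eq_le d1 andbT; nra.
Qed.

Lemma cusp_of_unipotent G x A : subgroup_SL2 G -> G A -> A <> 1%:M ->
  recenter x A 0 1 = 0 -> recenter x A 1 1 = 1 -> cusp G (Some x).
Proof.
move=> [GS G1 GM GV] GA A1 A01 A11; have SA := GS _ GA.
have D := SL2_det (SL2_recenter x SA); rewrite A01 A11 mul0r subr0 mulr1 in D.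
have trA : \tr A = 2.
  have <- : recenter x A 0 0 + recenter x A 1 1 = \tr A.
    by rewrite recenterE !mx2E [in RHS](mx2_eta A) trace_mx2; ring.
  by rewrite D A11.
exists A; split => //; last by apply/(boundary_fixP x SA).
split => //; first by rewrite trA ger0_norm.
move=> E; move: trA; rewrite E mx2_1 mx2_N trace_mx2; lra.
Qed.

(* Along the vertical geodesic ending at [x] almost minimal displaced elements at
   consecutive heights commute, as the commutator of two elements close to [1] is
   much closer to [1].  They therefore lie in one abelian subgroup, and
   discreteness forces one of them to fix [x]. *)
Lemma cusp_of_low_point G x : lattice_SL2 G ->
  (forall A, G A -> 2^-1 <= (A 1 0 * x + A 1 1) ^+ 2) -> cusp G (Some x).
Proof.
move=> lG Hx; have [dG _] := lG; have [sG _] := dG; have [GS G1 GM GV] := sG.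
(* With this [e] the displacements below satisfy [a <= 1/200] and [b <= 1/50], so that of the
   commutator is at most [2 a b * 5 <= a / 5]. This is less than [a / 2] and contradicts the almost
   minimality of [a]. *)
have [e [e0 eE]] : exists e : R, 0 < e /\ 400 * e = 1 by exists 400^-1; split; lra.
have [u0 u00 Hu] := thin_part lG Hx e0.
pose us j : R := u0 * 2 ^+ j.
have us_ge j : u0 <= us j by rewrite /us ler_peMr ?exprn_ege1 ?ler1n // ltW.
have us0 j : 0 < us j by rewrite (lt_le_trans u00).
have /choice[As HAs] : forall j, exists A, [/\ G A, A <> 1%:M,
    displacement x (us j) A <= 2 * e & forall B, G B -> B <> 1%:M ->
      displacement x (us j) A <= 2 * displacement x (us j) B].
  move=> j; have [B [GB B1 HB]] := Hu _ (us_ge j).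
  have [A [GA A1 HA]] := near_minimal_displacement x dG (us0 j) (ex_intro _ B (conj GB B1)).
  by exists A; split => //; rewrite (le_trans (HA B GB B1)) // ler_pM2l // ltW.
have GAs j : G (As j) by have [] := HAs j.
have As1 j : As j <> 1%:M by have [] := HAs j.
have dAs j : displacement x (us j) (As j) <= 2 * e by have [] := HAs j.
(* Halving [u] multiplies the displacement by at most 4, through the term with [u^2] in the
   denominator. *)
have step j : displacement x (us j) (As j.+1) <= 8 * e.
  have := dAs j.+1; rewrite !displacementE //.
  have -> : us j.+1 ^+ 2 = 4 * us j ^+ 2 by rewrite /us [2 ^+ j.+1]exprS; ring.
  have U2 : 0 < us j ^+ 2 by rewrite exprn_gt0.
  move: (normr_ge0 (recenter x (As j.+1) 0 1)) (normr_ge0 (recenter x (As j.+1) 1 0)).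
  move: (normr_ge0 (recenter x (As j.+1) 0 0 - 1)) (normr_ge0 (recenter x (As j.+1) 1 1 - 1)).
  move: (`|_ 0 0 - 1|) (`|_ 1 1 - 1|) (`|_ 0 1|) (`|_ 1 0|) (us j ^+ 2) U2.
  move=> p d b c U U0 p0 d0 b0 c0.
  have y0 : 0 <= c / (4 * U) by rewrite divr_ge0 // mulr_ge0 // ltW.
  have -> : c / U = 4 * (c / (4 * U)) by field; rewrite gt_eqF.
  have bU : 0 <= b * U by rewrite mulr_ge0 // ltW.
  by move: (c / (4 * U)) y0 => y y0; lra.
have comm j : As j *m As j.+1 = As j.+1 *m As j.
  have SA := GS _ (GAs j); have SB := GS _ (GAs j.+1).
  set C := As j *m As j.+1 *m (invmx (As j) *m invmx (As j.+1)).
  suff C1 : C = 1%:M.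
    have : C *m (As j.+1 *m As j) = As j.+1 *m As j by rewrite C1 mul1mx.
    move=> <-; rewrite /C -!mulmxA [invmx (As j.+1) *m _]mulmxA mulVmx ?SL2_unit // mul1mx.
    by rewrite mulVmx ?SL2_unit // mulmx1.
  apply: contrapT => C1.
  have GC : G C by apply: (GM _ _ (GM _ _ (GAs j) (GAs j.+1)) (GM _ _ (GV _ (GAs j)) (GV _ (GAs
    j.+1)))).
  have [_ _ _ /(_ C GC C1) mini] := HAs j.
  have := commutator_displacement x (us0 j) SA SB; rewrite -/C.
  have := dAs j; have := step j; have := displacement_gt0 x dG (us0 j) (GAs j) (@As1 j).
  have : 0 <= displacement x (us j) (As j.+1) by exact: mnorm_ge0.
  move: (displacement x (us j) C) mini => c.
  move: (displacement x (us j) (As j)) (displacement x (us j) (As j.+1)) => a b ac b0 a0 b8 a2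
    cle.
  have b50 : b <= 50^-1 by lra.
  have a200 : a <= 200^-1 by lra.
  have H : (2 + a) * (2 + b) <= 5 by nra.
  have ab : a * b <= a * 50^-1 by rewrite ler_wpM2l // ltW.
  have : 2 * (a * b) * ((2 + a) * (2 + b)) <= 2 * (a * b) * 5.
    by rewrite ler_wpM2l // mulr_ge0 // mulr_ge0 // ltW.
  by lra.
(* Suppose none fixes [x]. As neighbours commute, all trace-free parts are proportional, with fixed
   ratios [k1] and [k2] to the entry [0 1]. The bounded displacement makes this entry [O(4^(-j))],
   so the matrices tend to 1, against discreteness. *)
have [j Aj01] : exists j, recenter x (As j) 0 1 = 0.
  apply: contrapT => nz.
  have {}nz j : recenter x (As j) 0 1 != 0.
    by apply/eqP => E; apply: nz; exists j.
  pose k1 := recenter x (As 0) 1 0 / recenter x (As 0) 0 1.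
  pose k2 := (recenter x (As 0) 0 0 - recenter x (As 0) 1 1) / recenter x (As 0) 0 1.
  have ratios j : recenter x (As j) 1 0 = k1 * recenter x (As j) 0 1 /\
      recenter x (As j) 0 0 - recenter x (As j) 1 1 = k2 * recenter x (As j) 0 1.
    elim: j => [|j [E1 E2]]; first by rewrite !divfK.
    have [C1 C2] := recenter_comm x (comm j); rewrite E1 in C1; rewrite E2 in C2.
    split; apply: (mulfI (nz j)); first by rewrite C1; ring.
    by rewrite -C2; ring.
  have [e1 e10 He1] := discrete_conj_near1 dG (SL2_transl x).
  pose k : R := `|k1| + `|k2| + 1.
  have k0 : 0 < k by rewrite ltr_wpDl // addr_ge0.
  (* The off-diagonal entries will be at most [m0] and the diagonal ones within [2 m0] of 1, in
     total at most [6 m0 < e1]. *)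
  pose m0 := Num.min 1 (e1 / 8); have m00 : 0 < m0 by rewrite lt_min ltr01 divr_gt0.
  have [j Hj] : exists j, k * `|recenter x (As j) 0 1| <= m0.
    have q4 : 0 <= (4^-1 : R) < 1 by rewrite invr_ge0 ler0n invf_lt1 ?ltr0n ?ltr1n.
    have d0 : 0 < m0 / k * u0 ^+ 2 by rewrite mulr_gt0 ?divr_gt0 ?exprn_gt0.
    have [N /(_ N (leqnn N)) HN] := expr_small q4 d0; exists N.
    have := dAs N; rewrite displacementE //.
    move: (normr_ge0 (recenter x (As N) 0 0 - 1)) (normr_ge0 (recenter x (As N) 1 1 - 1)).
    have := normr_ge0 (recenter x (As N) 1 0).
    move: (`|_ 0 0 - 1|) (`|_ 1 1 - 1|) (`|_ 1 0|) (`|_ 0 1|) => p d c b c0 p0 d0' H.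
    have U0 : 0 < us N ^+ 2 by rewrite exprn_gt0.
    have cU : 0 <= c / us N ^+ 2 by rewrite divr_ge0 // ltW.
    have bU : b * us N ^+ 2 <= 1 by lra.
    have UE : us N ^+ 2 = u0 ^+ 2 * 4 ^+ N.
      by rewrite /us exprMn -exprM mulnC exprM; congr (_ * _ ^+ _); ring.
    have F0 : 0 < 4 ^+ N :> R by rewrite exprn_gt0.
    rewrite exprVn in HN.
    have bq : b <= (u0 ^+ 2)^-1 * (4 ^+ N)^-1.
      by rewrite -invfM -UE -[leRHS]mul1r ler_pdivlMr.
    have k00 : 0 <= k := ltW k0.
    apply: le_trans (ler_wpM2l k00 bq) _.
    apply: le_trans (_ : k * ((u0 ^+ 2)^-1 * (m0 / k * u0 ^+ 2)) <= _).
      by rewrite ler_wpM2l // ler_wpM2l // invr_ge0 exprn_ge0 // ltW.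
    rewrite (_ : k * _ = m0) //; field.
    by rewrite !gt_eqF.
  apply: (@As1 j); apply: He1 => //; rewrite -[_ *m _ *m _]/(recenter x (As j)).
  have [R1 R2] := ratios j; have D := SL2_det (SL2_recenter x (GS _ (GAs j))).
  have := dAs j; rewrite displacementE //.
  move: (recenter x (As j)) R1 R2 D Hj => M R1 R2 D Hj.
  rewrite mx2_1 /mnorm !mxE /= !subr0 R1.
  have c0 : `|k1 * M 0 1| <= m0.
    by apply: le_trans Hj; rewrite normrM ler_wpM2r // /k -addrA lerDl addr_ge0.
  have d0 : `|M 0 0 - M 1 1| <= m0.
    by apply: le_trans Hj; rewrite R2 normrM ler_wpM2r // /k addrAC lerDr addr_ge0.
  have b0 : `|M 0 1| <= m0.
    by apply: le_trans Hj; rewrite ler_peMl // /k lerDr addr_ge0.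
  rewrite R1 in D.
  have m1 : m0 <= 1 by rewrite ge_min lexx.
  have me : m0 <= e1 / 8 by rewrite ge_min lexx orbT.
  move: (M 0 0) (M 1 1) (M 0 1) (k1 * _) D c0 d0 b0.
  move=> p d b c D c0 d0 b0 H.
  have U0 : 0 < us j ^+ 2 by rewrite exprn_gt0.
  have bU : 0 <= `|b| * us j ^+ 2 by rewrite mulr_ge0 // ltW.
  have cU : 0 <= `|c| / us j ^+ 2 by rewrite divr_ge0 // ltW.
  have bc : `|b * c| <= m0.
    by rewrite normrM -[leRHS]mulr1 ler_pM // (le_trans c0).
  have pe : `|p - 1| <= 200^-1.
    by have := normr_ge0 (d - 1); lra.
  have dE : `|d - 1| <= 200^-1.
    by have := normr_ge0 (p - 1); lra.
  rewrite !ler_norml in bc d0 pe dE.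
  (* Both [p - d] and [p d - 1 = b c] are at most [m0] in modulus; the bound [1/200] keeps [p] and
     [d] away from the other solution -1. *)
  have p2 : `|p - 1| <= 2 * m0.
    by rewrite ler_norml; apply/andP; split; nra.
  have d2 : `|d - 1| <= 2 * m0.
    by rewrite ler_norml; apply/andP; split; nra.
  by lra.
have l2 := lower_triangular_is_unipotent sG Hx (GAs j) Aj01.
apply: (cusp_of_unipotent sG (GAs j) (@As1 j) Aj01).
have := dAs j; rewrite displacementE // Aj01 normr0 mul0r addr0.
have U0 : 0 < us j ^+ 2 by rewrite exprn_gt0.
have cU : 0 <= `|recenter x (As j) 1 0| / us j ^+ 2 by rewrite divr_ge0 // ltW.
have := normr_ge0 (recenter x (As j) 0 0 - 1).
move: (`|_ 0 0 - 1|) (`|_ 1 0| / _) cU => p c c0 p0 H.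
have {}H : `|recenter x (As j) 1 1 - 1| <= 200^-1 by lra.
move: (recenter x (As j) 1 1) l2 H => d d2; rewrite ler_norml => /andP[d1 d3].
have /eqP : (d - 1) * (d + 1) = 0 by ring: d2.
by rewrite mulf_eq0 subr_eq0 => /orP[/eqP //|/eqP d4]; exfalso; lra.
Qed.

End ThinIsParabolic.

(** * Growth of cusp forms *)

Section Growth.
Variable R : realType.
Implicit Types (A B : 'M[R]_2) (G : set 'M[R]_2) (x : R) (z w : R[i]) (f : R[i] -> R[i]).

Definition size_inv f (kap : nat) z : R := normc (f z) * complex.Im z ^+ kap.

Lemma size_inv_mobius f kap G A z : subgroup_SL2 G -> cusp_form (2 * kap) G f ->
  G A -> 0 < complex.Im z -> size_inv f kap (mobius A z) = size_inv f kap z.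
Proof.
move=> [GS _ _ _] [_ inv _] GA z0; have SA := GS _ GA.
rewrite /size_inv Im_mobius // -(inv A z GA z0) /slash normcM normcV normcX.
rewrite expr_div_n exprM; move: (_ ^+ kap)^-1 => J.
by rewrite [LHS]mulrCA [RHS]mulrC [J * _]mulrC.
Qed.

(** Any orbit with bounded heights contains such a point. The factor 2 reappears as the threshold
    [1/2] for the squared automorphy factors. *)
Definition almost_highest G z := 0 < complex.Im z /\
  forall A, G A -> complex.Im (mobius A z) <= 2 * complex.Im z.

Lemma almost_highest_automorphy G A z : subgroup_SL2 G -> almost_highest G z -> G A ->
  2^-1 <= (A 1 0 * complex.Re z + A 1 1) ^+ 2 + (A 1 0 * complex.Im z) ^+ 2.
Proof.
move=> [GS _ _ _] [z0 Hz] GA; have SA := GS _ GA; have := Hz A GA.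
rewrite Im_mobius // -normc_automorphy; have j0 := automorphy_neq0 SA z0.
have n0 : 0 < normc (automorphy A z) ^+ 2.
  by rewrite exprn_gt0 // lt_neqAle normc_ge0 andbT eq_sym; apply: contra_neq j0; exact:
    eq0_normc.
rewrite ler_pdivrMr // mulrAC -[X in X <= _]mul1r ler_pM2r // => H.
by rewrite -[2^-1]mul1r ler_pdivrMr // mulrC.
Qed.

Lemma recenter_zpower G x Q (t : R) (m : int) : subgroup_SL2 G -> G Q ->
  recenter x Q = lowtri t -> exists2 B, G B & recenter x B = lowtri (m%:~R * t).
Proof.
move=> [GS G1 GM GV] GQ EQ.
have pos (n : nat) : exists2 B, G B & recenter x B = lowtri (n%:R * t).
  elim: n => [|n [B GB EB]]; first by exists 1%:M; rewrite // mul0r recenter1 lowtri0.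
  exists (Q *m B); first exact: GM.
  by rewrite recenterM EQ EB lowtriD -[n.+1]addn1 natrD mulrDl mul1r addrC.
case: m => n; first by have [B GB EB] := pos n; exists B; rewrite // -pmulrn.
have [B GB EB] := pos n.+1; exists (invmx B); first exact: GV.
by rewrite recenterV ?EB ?invmx_lowtri ?NegzE ?mulrNz -?pmulrn ?mulNr //; exact: GS.
Qed.

(* The parabolic elements fixing [x] force almost highest points to approach [x]
   inside a cone. *)
Lemma almost_highest_cone G x : lattice_SL2 G -> cusp G (Some x) ->
  exists2 eta : R, 0 < eta & forall z, almost_highest G z ->
    `|complex.Re z - x| < eta -> `|complex.Re z - x| <= 2 * complex.Im z.
Proof.
move=> [dG _] cG; have [sG _] := dG.
have [Q [t [GQ EQ t0]]] := cusp_parabolic dG cG.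
have nt0 : 0 < `|t| by rewrite normr_gt0.
exists (10^-1 / `|t|); first by rewrite divr_gt0 ?invr_gt0.
move=> z hz; set p := complex.Re z - x => pe; have [z0 _] := hz.
rewrite leNgt; apply/negP => py.
have p0 : p != 0.
  by apply: contraTneq py => ->; rewrite normr0 -leNgt mulr_ge0 // ltW.
pose w := t * p; have w0 : w != 0 by rewrite mulf_neq0.
have we : `|w| < 10^-1.
  by rewrite normrM mulrC -ltr_pdivlMr.
(* The power of [Q] for which [1 + m w], the real part of the automorphy factor, is nearly 0.
   Outside the cone its imaginary part is small too, and the squared modulus stays below
   [1/100 + 121/400 < 1/2]. *)
pose m := Num.floor (- w^-1).
have [B GB EB] := recenter_zpower m sG GQ EQ.
have := almost_highest_automorphy sG hz GB.
have E10 : B 1 0 = m%:~R * t by have := EB; rewrite recenterE => /mx2_inj[].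
have E11 : B 1 0 * x + B 1 1 = 1 by have := EB; rewrite recenterE => /mx2_inj[].
have -> : B 1 0 * complex.Re z + B 1 1 = 1 + m%:~R * w.
  have -> : B 1 1 = 1 - B 1 0 * x by move: (B 1 0 * x) E11 => u; lra.
  by rewrite E10 /w /p; ring.
rewrite E10.
have /andP[m1 m2] := floor_itv (- w^-1); rewrite -/m in m1 m2.
have mw : `|1 + m%:~R * w| <= `|w|.
  have -> : 1 + m%:~R * w = (m%:~R + w^-1) * w by rewrite mulrDl mulVf // addrC.
  rewrite normrM -[leRHS]mul1r ler_wpM2r //.
  by rewrite intrD in m2; rewrite ler_norml; move: (m%:~R : R) (w^-1) m1 m2 => a b m1 m2;
    apply/andP; split; lra.
have E : (m%:~R * t * complex.Im z) ^+ 2 * p ^+ 2 = (m%:~R * w) ^+ 2 * complex.Im z ^+ 2.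
  by rewrite /w; ring.
have p2 : 4 * complex.Im z ^+ 2 < p ^+ 2.
  rewrite -[p ^+ 2]real_normK ?num_real //.
  by have := normr_ge0 p; move: (`|p|) py => P py P0; nra.
have pp : 0 < p ^+ 2 by rewrite exprn_even_gt0.
move: (complex.Im z) z0 (m%:~R * t * complex.Im z) E p2 => y y0 v E p2.
move: (m%:~R * w) mw E => s mw E.
have s1 : s ^+ 2 <= 121 / 100.
  by have := le_lt_trans mw we; rewrite ltr_norml => /andP[? ?]; nra.
have s2 : (1 + s) ^+ 2 <= 1 / 100.
  by have := le_lt_trans mw we; rewrite ltr_norml => /andP[? ?]; nra.
have v2 : v ^+ 2 <= 121 / 400.
  rewrite -(ler_pM2r pp) E.
  by have := sqr_ge0 y; have := sqr_ge0 s; nra.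
apply/negP; rewrite -ltNge.
apply: le_lt_trans (lerD s2 v2) _.
by lra.
Qed.

(** In the cone [|z - x|^2 <= 5 y^2], so a low point is high as seen from the cusp. There
    [|f| y^kap] equals the slashed form times [h^kap], which the exponential decay in [h] keeps
    bounded. *)
Lemma size_inv_near_cusp G f kap x : lattice_SL2 G -> cusp G (Some x) ->
  cusp_form (2 * kap) G f -> exists2 eta : R, 0 < eta & exists C : R,
    forall z, almost_highest G z -> `|complex.Re z - x| < eta ->
      complex.Im z < eta -> size_inv f kap z <= C.
Proof.
move=> lG cG cf; have [dG _] := lG.
have [e1 e10 cone] := almost_highest_cone lG cG.
have [r [M [alpha [Y0 [r0 alpha0 M0 Hd]]]]] := cusp_form_decay dG cG cf.
have [C C0 HC] := expR_poly_bound kap alpha0.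
have r20 : 0 < r ^+ 2 by rewrite exprn_gt0.
have Y10 : 0 < `|Y0| + 1 by rewrite ltr_wpDl.
(* Below this height [h >= 1 / (5 r^2 y)] exceeds [Y0], so the decay estimate applies. *)
pose e2 := (5 * r ^+ 2 * (`|Y0| + 1))^-1.
have e20 : 0 < e2 by rewrite invr_gt0 !mulr_gt0.
exists (Num.min e1 e2); first by rewrite lt_min e10.
exists (M * C) => z hz; rewrite !lt_min => /andP[p1 _] /andP[_ y2].
have [z0 _] := hz; have pc := cone z hz p1.
set h := horocycle_height r x z in Hd.
have n0 : 0 < normc (z - x%:C).
  rewrite (lt_le_trans z0) // (le_trans _ (ler_Im_normc _)) // ImD ImN /= subr0.
  exact: ler_norm.
have n2 : normc (z - x%:C) ^+ 2 <= 5 * complex.Im z ^+ 2.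
  rewrite normc_sq ReD ReN ImD ImN /= subr0.
  have : (complex.Re z - x) ^+ 2 <= (2 * complex.Im z) ^+ 2.
    rewrite -[leLHS]real_normK ?num_real // lerXn2r ?nnegrE // mulr_ge0 // ltW //.
  move: (complex.Im z) => y; move: ((_ - x) ^+ 2) => P; nra.
have w0 : 0 < (r * normc (z - x%:C)) ^+ 2 by rewrite exprn_gt0 // mulr_gt0.
have hY : Y0 <= horocycle_height r x z.
  rewrite /horocycle_height ler_pdivlMr // exprMn.
  have H1 : (5 * r ^+ 2 * (`|Y0| + 1)) * complex.Im z <= 1.
    by rewrite -ler_pdivlMl ?mulr_gt0 // mulr1 ltW.
  apply: le_trans (_ : (`|Y0| + 1) * (r ^+ 2 * (5 * complex.Im z ^+ 2)) <= _).
    apply: le_trans (_ : (`|Y0| + 1) * (r ^+ 2 * normc (z - x%:C) ^+ 2) <= _).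
      apply: ler_wpM2r; first by rewrite mulr_ge0 ?exprn_ge0 ?normc_ge0 // ltW.
      by rewrite (le_trans (ler_norm Y0)) // lerDl.
    by rewrite ler_wpM2l ?(ltW Y10) // ler_wpM2l // ltW.
  have -> : (`|Y0| + 1) * (r ^+ 2 * (5 * complex.Im z ^+ 2)) =
    5 * r ^+ 2 * (`|Y0| + 1) * complex.Im z * complex.Im z by ring.
  by rewrite -[leRHS]mul1r ler_wpM2r // ltW.
have zE : complex.Im z = horocycle_height r x z * (r * normc (z - x%:C)) ^+ 2.
  by rewrite /horocycle_height divfK // gt_eqF.
have h0 : 0 <= horocycle_height r x z by rewrite divr_ge0 ?ltW.
have Hz := Hd z z0 hY.
rewrite /size_inv zE exprMn -exprM.
rewrite (_ : _ * _ = normc (f z) * (r * normc (z - x%:C)) ^+ (2 * kap) * horocycle_height r x z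
  ^+ kap); last by ring.
apply: le_trans (ler_wpM2r (exprn_ge0 _ h0) Hz) _.
by rewrite -mulrA ler_wpM2l // mulrC HC.
Qed.

(** Either [x] meets the inequality for the whole group and is a cusp, or some [A] violates it at
    [x]. In the second case [A] violates it near [x] as well and lifts all low points there, so none
    of them is almost highest. *)
Lemma low_bound_local G f kap x : lattice_SL2 G -> cusp_form (2 * kap) G f ->
  exists2 eta : R, 0 < eta & exists C : R,
    forall z, almost_highest G z -> `|complex.Re z - x| < eta ->
      complex.Im z < eta -> size_inv f kap z <= C.
Proof.
move=> lG cf; have [sG _] := lG.1.
have [H|] := pselect (forall A, G A -> 2^-1 <= (A 1 0 * x + A 1 1) ^+ 2).
  by apply: size_inv_near_cusp => //; exact: cusp_of_low_point.
move=> /existsNP[A /not_implyP[GA /negP]]; rewrite -ltNge => HA.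
pose d := A 1 0 * x + A 1 1; pose del := 2^-1 - d ^+ 2.
have del0 : 0 < del by rewrite subr_gt0.
(* Moving from [x] to [z] changes the squared modulus by at most [2 d P + P^2 + Q^2 <= 4 t], half of
   the available margin [del]. *)
pose t := Num.min 1 (del / 8); have t0 : 0 < t by rewrite lt_min ltr01 divr_gt0.
have c0 : 0 < `|A 1 0| + 1 by rewrite ltr_wpDl.
exists (t / (`|A 1 0| + 1)); first by rewrite divr_gt0.
exists 0 => z hz; rewrite !ltr_pdivlMr // => pz yz; exfalso.
have [z0 _] := hz; have := almost_highest_automorphy sG hz GA.
apply/negP; rewrite -ltNge.
have -> : A 1 0 * complex.Re z + A 1 1 = d + A 1 0 * (complex.Re z - x) by rewrite /d; ring.
have H1 : `|A 1 0 * (complex.Re z - x)| <= t.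
  by rewrite normrM (le_trans _ (ltW pz)) // [leLHS]mulrC ler_wpM2l // lerDl.
have H2 : `|A 1 0 * complex.Im z| <= t.
  by rewrite normrM (gtr0_norm z0) (le_trans _ (ltW yz)) // [leLHS]mulrC ler_wpM2l ?(ltW z0) //
    lerDl.
have t1 : t <= 1 by rewrite ge_min lexx.
have t8 : t <= del / 8 by rewrite ge_min lexx orbT.
have d1 : `|d| <= 1.
  have : `|d| ^+ 2 < 2^-1 by rewrite real_normK ?num_real.
  by have := normr_ge0 d; nra.
rewrite ler_norml in d1; rewrite !ler_norml in H1 H2.
move: (A 1 0 * (complex.Re z - x)) (A 1 0 * complex.Im z) H1 H2 => P Q H1 H2.
have Q2 : Q ^+ 2 <= t by nra.
have P2 : P ^+ 2 <= t by nra.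
have dP : d * P <= t by nra.
by rewrite /del in t8; nra.
Qed.

(** A single parameter [i] serves as the height and, inverted, as the bound. Compactness can then be
    used as a near-covering statement along one filter at [0^+]. *)
Lemma low_bound G f kap : lattice_SL2 G -> cusp_form (2 * kap) G f ->
  exists2 eta : R, 0 < eta & forall z, almost_highest G z ->
    `|complex.Re z| <= 2^-1 -> complex.Im z < eta -> size_inv f kap z <= eta^-1.
Proof.
move=> lG cf.
have /compact_near_coveringP cov := @segment_compact R (- 2^-1) 2^-1.
pose P (i x : R) := forall z, almost_highest G z -> complex.Re z = x ->
  complex.Im z < i -> size_inv f kap z <= i^-1.
have : \forall i \near (0 : R)^'+, `[- 2^-1, 2^-1] `<=` P i.
  apply: cov => x _.
  have [eta eta0 [C HC]] := low_bound_local x lG cf.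
  have C0 : 0 < `|C| + 1 by rewrite ltr_wpDl.
  pose e1 := Num.min eta (`|C| + 1)^-1.
  have e10 : 0 < e1 by rewrite lt_min eta0 invr_gt0.
  exists (ball x eta, [set i | 0 < i < e1]); first split.
  - exact: nbhsx_ballx.
  - by near=> i; apply/andP; split; near: i; [exact: nbhs_right_gt|exact: nbhs_right_lt].
  move=> [x' i] [/= xx' /andP[i0 ie]] z hz zx' zi.
  rewrite lt_min in ie; have [ie1 ie2] := andP ie.
  apply: le_trans (HC z hz _ (lt_trans zi ie1)) _.
    by rewrite zx' distrC.
  rewrite (le_trans (ler_norm C)) // (le_trans (_ : _ <= `|C| + 1)) ?lerDl //.
  by rewrite -[leLHS]invrK lef_pV2 ?posrE ?invr_gt0 // ltW.
move=> H.
have [|i [Hi i0]] := filter_ex (filterI H (nbhs_right_gt 0)).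
  exact: at_right_proper_filter.
exists i => // z hz zx zi; apply: (Hi (complex.Re z)) => //.
by rewrite /= in_itv /= -ler_norml.
Unshelve. all: by end_near.
Qed.

(** If the orbit of [z] reaches height [eta], the Fourier decay bounds the invariant function there.
    Otherwise its heights have a finite supremum; a point above half of it is almost highest, and an
    integer translation moves it into the strip of [low_bound]. *)
Lemma cusp_form_growth G f a kap : lattice_SL2 G -> cusp_oo_width1 G ->
  cusp_form (2 * kap) G f -> fourier_expansion f a -> moderate_growth f kap.
Proof.
move=> lG [_ [_ tG]] cf fa; have [sG _] := lG.1; have [GS G1 GM GV] := sG.
have [eta eta0 Hlow] := low_bound lG cf.
have [C C0 HC] := fourier_decay fa eta0.
have pi20 : 0 < 2 * pi :> R by rewrite mulr_gt0 ?pi_gt0.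
have [D D0 HD] := expR_poly_bound kap pi20.
have high z : eta <= complex.Im z -> size_inv f kap z <= C * D.
  move=> ez; have z0 : 0 < complex.Im z by rewrite (lt_le_trans eta0).
  rewrite /size_inv; apply: le_trans (ler_wpM2r (exprn_ge0 _ (ltW z0)) (HC z ez)) _.
  by rewrite -mulrA ler_wpM2l // mulrC; have := HD _ (ltW z0); rewrite /qabs mulNr.
exists (Num.max (C * D) eta^-1) => z z0; rewrite -/(size_inv f kap z) le_max.
have [[A GA Aeta]|nA] := pselect (exists2 A, G A & eta <= complex.Im (mobius A z)).
  by rewrite -(size_inv_mobius sG cf GA z0) high.
have low A : G A -> complex.Im (mobius A z) < eta.
  by move=> GA; rewrite ltNge; apply/negP => H; apply: nA; exists A.
pose S := [set y | exists2 A, G A & y = complex.Im (mobius A z)].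
have supS : has_sup S.
  split; first by exists (complex.Im (mobius 1%:M z)), 1%:M.
  by exists eta => _ [A GA ->]; exact: ltW (low A GA).
have S0 : 0 < sup S.
  rewrite (lt_le_trans z0) //; apply: ub_le_sup; first exact: supS.2.
  by exists 1%:M => //; rewrite mobius1.
have [_ [A GA ->] HA] := sup_adherent (divr_gt0 S0 (ltr0n R 2)) supS.
have SA := GS _ GA; have Az0 := Im_mobius_gt0 SA z0.
have [T [[GT _] HT]] := tG (- Num.floor (complex.Re (mobius A z) + 2^-1)).
have ST := GS _ GT.
set w := mobius A z in HA HT Az0.
have TE := HT w Az0; set n := Num.floor _ in TE.
have nE : (- n)%:~R = (- n%:~R : R)%:C :> R[i].
  by rewrite mulrNz -(rmorph_int (real_complex R)) -rmorphN.
have Iw : complex.Im (mobius T w) = complex.Im w by rewrite TE nE ImD /= addr0.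
have Rw : `|complex.Re (mobius T w)| <= 2^-1.
  rewrite TE nE ReD /=.
  have /andP[] := floor_itv (complex.Re w + 2^-1).
  by rewrite -/n intrD ler_norml; move: (n%:~R : R) => u ? ?; apply/andP; split; lra.
have hw : almost_highest G (mobius T w).
  split=> [|B GB]; first by rewrite Iw.
  have Tw0 : 0 < complex.Im (mobius T w) by rewrite Iw.
  have SB := GS _ GB.
  rewrite -mobiusM // -mobiusM //; last exact: SL2_mul.
  have : complex.Im (mobius (B *m T *m A) z) <= sup S.
    by apply: ub_le_sup; [exact: supS.2|exists (B *m T *m A) => //; exact: GM (GM _ _ GB GT) GA].
  by rewrite Iw; move: HA; rewrite /w; lra.
rewrite -(size_inv_mobius sG cf GA z0) -/w -(size_inv_mobius sG cf GT Az0).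
by rewrite Hlow ?orbT // Iw low.
Qed.

(** Hecke's bound, obtained on the horizontal line of height [1 / n]. *)
Lemma cusp_coef_bound f a kap : fourier_expansion f a -> moderate_growth f kap ->
  exists2 C : R, 0 <= C & forall n, (0 < n)%N -> normc (a n) <= C * n%:R ^+ kap.
Proof.
move=> fa [C HC]; have C0 : 0 <= C.
  by apply: le_trans (HC (0 +i* 1) ltr01); rewrite mulr_ge0 ?normc_ge0 //= expr1n.
have q10 := qabs_gt0 (1 : R).
exists (C / qabs 1); first by rewrite divr_ge0 // ltW.
move=> n n0; have nR : 0 < n%:R :> R by rewrite ltr0n.
have y0 : 0 < n%:R^-1 :> R by rewrite invr_gt0.
have := @itersum_coef_bound R f a 0 n n%:R^-1 (C * n%:R ^+ kap) fa y0 n0.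
rewrite -qabsMn mulfV ?gt_eqF // => H.
rewrite [leRHS]mulrAC ler_pdivlMr //; apply: H => z zy.
rewrite expr0 divr1 -ler_pdivrMr ?exprn_gt0 // -exprVn -zy.
by apply: HC; rewrite zy.
Qed.

End Growth.

Theorem theorem3p2p1 (R : realType) (G : set 'M[R]_2) (k l : nat)
    (f g : R[i] -> R[i]) (a b : nat -> R[i])
    (lattice_G : lattice_SL2 G) (cusp_oo : cusp_oo_width1 G)
    (cusp_0 : cusp G (Some 0)) (even_k : ~~ odd k) (even_l : ~~ odd l)
    (f_cusp : cusp_form k G f) (g_cusp : cusp_form l G g)
    (f_fourier : fourier_expansion f a) (g_fourier : fourier_expansion g b) :
  exists F : R[i]^o * R[i]^o -> R[i]^o, entire2 F /\
    exists sigma : R, forall s t : R[i],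
      sigma < complex.Re s -> sigma < complex.Re t ->
      (fun N : nat => \sum_(1 <= n < N) sharp_term a b s t n : R[i]^o) @ \oo
        --> F (s, t).
Proof.
have dG := lattice_G.1.
pose kap := k./2; pose lam := l./2.
have kE : k = (2 * kap)%N by rewrite mul2n -[LHS]odd_double_half (negPf even_k).
have lE : l = (2 * lam)%N by rewrite mul2n -[LHS]odd_double_half (negPf even_l).
rewrite kE in f_cusp; rewrite lE in g_cusp.
have f_growth := cusp_form_growth lattice_G cusp_oo f_cusp f_fourier.
have g_growth := cusp_form_growth lattice_G cusp_oo g_cusp g_fourier.
have f_decay := cusp_form_decay dG cusp_0 f_cusp.
(* A common exponent that dominates half of either weight. *)
pose K := (kap + lam)%N.
have weaken (C : R) n i j : 0 <= C -> (0 < n)%N -> (i <= j)%N ->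
    C * n%:R ^+ i <= C * n%:R ^+ j.
  by move=> C0 n0 ij; rewrite ler_wpM2l // ler_weXn2l // ler1n.
have a_le p : exists2 C : R, 0 <= C & forall n, (0 < n)%N ->
    normc (itersum (2 * p) a n) <= C * n%:R ^+ (K + p).
  have [C C0 HC] := itersum_cusp_bound p f_fourier f_growth f_decay.
  exists C => // n n0; apply: le_trans (HC n n0) (weaken _ _ _ _ C0 n0 _).
  by rewrite /K; lia.
have b_le : exists2 C : R, 0 <= C & forall n, (0 < n)%N ->
    normc (b n) <= C * n%:R ^+ K.
  have [C C0 HC] := cusp_coef_bound g_fourier g_growth.
  exists C => // n n0; apply: le_trans (HC n n0) (weaken _ _ _ _ C0 n0 _).
  by rewrite /K; lia.
have [F HF] := continuation_ex a_le b_le.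
exists F; split; first exact: (continuation_entire a_le b_le HF).
(* This is the condition [admissible] for [p = 0] and [tau = 0]. At that stage no summation by parts
   has taken place, and the terms are those of the given double series. *)
exists (2 * K + 9)%:R => s t s_gt t_gt.
have t0 : 0 <= complex.Re t by rewrite (le_trans _ (ltW t_gt)).
have adm : admissible K 0 s t.
  exists 0; split; rewrite ?oppr_le0 ?addr0 ?lexx //; last exact: ltW.
apply/ctendsP/ctends_ext/HF/adm; exists 0%N => N _; apply: eq_bigr => n _.
rewrite /term /sharp_term /convsum /npow_dif muln0 /= mulrC; congr (_ * _).
by apply: eq_bigr => j _; rewrite /natcpow mulNr cexpN.
Qed.
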